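(* Let $\mathcal X=\{X_\varepsilon\}$ be the family of perturbations of the geometric Lorenz vector field $X_0$ described in the context, with associated one-dimensional maps $T_\varepsilon:I\to I$ and $T=T_0$. Let $h_\varepsilon$ and $h=h_0$ denote the densities of the unique absolutely continuous invariant probability measures of $T_\varepsilon$ and $T$ respectively. Then $$\lim_{\varepsilon\to 0}\|h_\varepsilon-h\|_1=0,$$ where $\|\cdot\|_1$ is the $L^1$-norm with respect to Lebesgue measure on $I$.
   Context: **The unperturbed flow $X_0$.** $X_0:\mathbb R^3\to\mathbb R^3$ is a vector field whose flow has an equilibrium at $0$, with attractor $\Lambda$, such that: - $DX_0(0)$ has three real eigenvalues $\lambda_2<\lambda_3<0<\lambda_1$ with $\lambda_1+\lambda_3>0$ and $\lambda_1+\lambda_2<\lambda_3$. - Let $\Sigma=\{(x,y,1): -\frac12\le x,y\le\frac12\}$, let $\Gamma=\{(0,y,1): -\frac12\le y\le\frac12\}$ be the intersection of $\Sigma$ with the local stable manifold of $0$, and let $\Sigma^{\pm}$ be the parts of $\Sigma$ with $x>0$, resp. $x<0$. There is a well-defined Poincaré map $F:\Sigma\to\Sigma$ such that the images of $\Sigma^\pm$ are curvilinear triangles $S^\pm$ without the vertices $(\pm1,0,1)$, and every segment $\{x=\text{const}\}$ of $\Sigma$ except $\Gamma$ is mapped into a segment $\{(x,y,1)\in S^\pm: x=\text{const}\}$. The return time $\tau:\Sigma\setminus\Gamma\to\mathbb R$ is $\tau(x,y,1)=-\frac1{\lambda_1}\log|x|$. - The flow maps $\Sigma$ into $S^\pm$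 smoothly, so that $F(x,y)=(T(x),g(x,y))$, where, with $I=[-\frac12,\frac12]$: $T:I\to I$ has a discontinuity at $0$ with $T(0^+)=-\frac12$, $T(0^-)=\frac12$; $T$ is piecewise monotone increasing and $C^1$ on $I\setminus\{0\}$; $\lim_{x\to0^\pm}T'(x)=+\infty$; $1/T'$ is $\alpha$-Hölder on $[-\frac12,0]$ and on $[0,\frac12]$, with $0<\alpha\le1$; there are $C>0,\theta>1$ with $(T^n)'(x)\ge C\theta^n$ for all $n\in\mathbb N$; $T$ is transitive; $g$ preserves the foliation $\mathcal F$ of $\Sigma$ by segments $\{x=\text{const}\}$ and is uniformly contracting: there are $K>0$, $0<\rho<1$ such that for every leaf $\gamma$, $\xi_1,\xi_2\in\gamma$ and $n\ge1$, $\mathrm{dist}(F^n(\xi_1),F^n(\xi_2))\le K\rho^n\,\mathrm{dist}(\xi_1,\xi_2)$. **$p$-variation.** Set $p:=1/\alpha$. For $f$ on an interval $J$, $V_{p|J}(f)=\sup\big(\sum_{i=1}^n|f(x_i)-f(x_{i-1})|^p\big)^{1/p}$, the supremum being over all finite sequences $x_0<\dots<x_n$ in $J$. **The family $\mathcal X$.** $\mathcal X=\{X_\varepsilon\}$ is a family of $C^1$ perturbations of $X_0$ ($\varepsilon\ge 0$ small; objects with $\varepsilon=0$ are those of $X_0$, e.g. $T_0=T$): there are an open neighbourhood $U\subset\mathbb R^3$ of $\Lambda$ and an open neighbourhood $\mathcal U$ of $X_0$ containing $\mathcal X$ such that - for each $X_\varepsilon\in\mathcal X$ the maximal forward invariant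 set $\Lambda_{X_\varepsilon}$ is contained in $U$ and is an attractor containing a hyperbolic singularity; - for each $X_\varepsilon\in\mathcal X$, $\Sigma$ is a cross-section for the flow with return time $\tau_\varepsilon$ and Poincaré map $F_\varepsilon$; - $F_\varepsilon$ admits a $C^{1+\alpha}$ uniformly contracting invariant foliation $\mathcal F_\varepsilon$ on $\Sigma$; - $F_\varepsilon(x,y)=(T_\varepsilon(x),g_\varepsilon(x,y))$, where $g_\varepsilon$ is $C^{1+\alpha}$ and a uniform contraction on stable leaves; - $T_\varepsilon:I\to I$ is transitive, piecewise $C^1$ and expanding with two branches (with monotonicity intervals $I_{1,\varepsilon},I_{2,\varepsilon}$) and a discontinuity point $O_\varepsilon$ such that $T_\varepsilon(O_\varepsilon^+)=-\frac12$, $T_\varepsilon(O_\varepsilon^-)=\frac12$, $\lim_{x\to O_\varepsilon^\pm}T_\varepsilon'(x)=+\infty$; - for any $\eta>0$ there are $\varepsilon_0$ and an interval $H=H(\varepsilon_0)\subset I$ such that for all $0\le\varepsilon<\varepsilon_0$: $\{O_\varepsilon,0\}\subset H$, $|H|=2|O_{\varepsilon_0}|<\eta$, and $d(T,T_\varepsilon):=\sup_{x\in I\setminus H}\{|T_\varepsilon(x)-T(x)|+|T_\varepsilon'(x)-T'(x)|\}\le C\eta$; - there are constants $C>0,\theta>1$, uniform in $\varepsilon$ and $x$, with $(T_\varepsilon^n)'(x)\ge C\theta^n$ except at the discontinuity; - there is $W>0$, uniform in $\varepsilon$, with $\max_{i\in\{1,2\}}V_{p|I_{i,\varepsilon}}(1/T_\varepsilon')\le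 W$; - with $\mathcal P_\varepsilon=\{I_{1,\varepsilon},I_{2,\varepsilon}\}$ and $\mathcal P_\varepsilon^{(n)}=\bigvee_{j=0}^{n-1}T_\varepsilon^{-j}(\mathcal P_\varepsilon)$, for each $n>0$ there is $\delta_n>0$ independent of $\varepsilon$ with $\min_{J\in\mathcal P_\varepsilon^{(n)}}|J|\ge\delta_n$; - there is a constant $C>0$ such that for each $X_\varepsilon\in\mathcal X$ the return time $\tau_\varepsilon:\Sigma\setminus\Gamma_\varepsilon\to\mathbb R$ satisfies $\tau_\varepsilon(\xi)\le -C\log|\pi_\varepsilon(\xi)-O_\varepsilon|$, where $\pi_\varepsilon$ is the projection along leaves of $\mathcal F_\varepsilon$ onto $I$ and $\Gamma_\varepsilon$ is the leaf over $O_\varepsilon$. Each $T_\varepsilon$ ($\varepsilon\ge0$) has a unique absolutely continuous invariant probability measure $\bar\mu_\varepsilon$, with density $h_\varepsilon$.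
   Formalization: The assumed vertices (±1,0,1) of the triangles S^± cannot lie in Σ (|x|≤1/2) and contradict T(0^+)=-1/2, T(0^-)=1/2; the formal version takes the vertex of S^+ to be (-1/2,0,1) and that of S^- to be (1/2,0,1). *)

(* Defs.v *)
From HB Require Import structures.
From mathcomp Require Import all_boot all_order all_algebra.
From mathcomp Require Import complex.
From mathcomp Require Import all_classical all_reals all_analysis.
Set Implicit Arguments.
Unset Strict Implicit.
Unset Printing Implicit Defensive.
Import Order.TTheory GRing.Theory Num.Theory.
Import numFieldNormedType.Exports.
Local Open Scope classical_set_scope.
Local Open Scope ring_scope.

Section Regularity.
Context {R : realType}.

(* Derivatives relative to a set.  [D] need not be open (a closed interval, a
   square, a planar section of 3-space), so [df x] is only a linear map that
   approximates [f] along [D]. *)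
Definition differential_within (V W : normedModType R) (D : set V)
    (f : V -> W) (df : V -> {linear V -> W}) : Prop :=
  forall x, D x -> forall e : R, 0 < e ->
    \forall y \near within D (nbhs x),
      `|f y - f x - df x (y - x)| <= e * `|y - x|.

Definition C1_on (V W : normedModType R) (D : set V) (f : V -> W) : Prop :=
  exists2 df : V -> {linear V -> W}, differential_within D f df &
    forall v, {within D, continuous (fun x => df x v)}.

Definition holder_on (a : R) (D : set R) (f : R -> R) : Prop :=
  exists C : R, forall x y, D x -> D y -> `|f x - f y| <= C * `|x - y| `^ a.

Definition C1holder_on (V W : normedModType R) (a : R) (D : set V)
    (f : V -> W) : Prop :=
  exists2 df : V -> {linear V -> W}, differential_within D f df &
    exists C : R, forall x y, D x -> D y -> forall v,
      `|df x v - df y v| <= C * `|x - y| `^ a * `|v|.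

End Regularity.

Section Flows.
Context {R : realType}.
Local Notation V := 'rV[R]_3.

Definition C1_field (X : V -> V) : Prop :=
  (forall x, differentiable X x) /\ continuous (jacobian X).

(* Open sets of the (compact-open) C^1 topology on C^1 vector fields. *)
Definition C1_open (UU : set (V -> V)) : Prop :=
  UU `<=` C1_field /\
  forall X, UU X -> exists K : set V, exists r : R, [/\ compact K, 0 < r &
    forall Y, C1_field Y ->
      (forall x, K x -> `|Y x - X x| < r /\ `|jacobian Y x - jacobian X x| < r) -> UU Y].

Definition is_flow (X : V -> V) (phi : R -> V -> V) : Prop :=
  (forall x, phi 0 x = x) /\
  forall (t : R) x, is_derive t (1 : R) (fun s : R => phi s x) (X (phi t x)).

(* The maximal (positively) invariant set of [U]. *)
Definition max_invariant (phi : R -> V -> V) (U : set V) : set V :=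
  \bigcap_(t in [set t : R | 0 <= t]) (phi t @` U).

(* An attractor is a compact invariant set which is the maximal invariant set
   of a forward invariant open neighbourhood and has a dense forward orbit. *)
Definition is_attractor (phi : R -> V -> V) (L : set V) : Prop :=
  [/\ compact L,
      forall t, phi t @` L = L,
      exists U, [/\ open U, L `<=` U,
        forall t, 0 <= t -> phi t @` U `<=` U & L = max_invariant phi U] &
      exists2 x, L x & closure [set phi t x | t in [set t : R | 0 <= t]] = L].

Definition hyperbolic_singularity (X : V -> V) (s : V) : Prop :=
  X s = 0 /\
  forall z : R[i],
    eigenvalue (map_mx (real_complex R) (jacobian X s)) z -> complex.Re z != 0.

Definition local_stable (phi : R -> V -> V) (s : V) (B : set V) : set V :=
  [set x | (forall t, 0 <= t -> B (phi t x)) /\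
           phi t x @[t --> +oo] --> s].

Definition first_return (phi : R -> V -> V) (S : set V) (x : V) (t : R) : Prop :=
  [/\ 0 < t, S (phi t x) & forall s, 0 < s < t -> ~ S (phi s x)].

End Flows.

Section CrossSection.
Context {R : realType}.
Local Notation V := 'rV[R]_3.

Definition Ihalf : set R := `[- 2^-1, 2^-1].
Definition square : set (R * R) := Ihalf `*` Ihalf.
Definition sec (p : R * R) : V := \row_i [:: p.1; p.2; 1]`_i.
Definition Sigma : set V := sec @` square.

(* Being a triangle with one side on a line [x = const]: the region between
   two curves over [a, b] (or [b, a]) that meet exactly over [a], at the vertex
   [sec (a, c)]. *)
Definition curvilinear_triangle (a c : R) (S : set V) : Prop :=
  exists (b : R) (lo hi : R -> R),
    let J : set R := `[Num.min a b, Num.max a b]%classic in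
    [/\ a != b, {within J, continuous lo} /\ {within J, continuous hi},
        lo a = c /\ hi a = c,
        forall x, J x -> x != a -> lo x < hi x &
        S = sec @` [set p | J p.1 /\ lo p.1 <= p.2 <= hi p.1]].

End CrossSection.

Section IntervalMaps.
Context {R : realType}.
Implicit Types (T : R -> R) (O : R).

(* Derivative of [f] as a function on [Ihalf]: it is one-sided at +-1/2.  The
   limit is a junk value when it does not exist. *)
Definition slope (f : R -> R) (x y : R) : R := (f y - f x) / (y - x).
Definition derI (f : R -> R) (x : R) : R :=
  lim (slope f x y @[y --> within Ihalf (x^')]).

Definition C1I_on (D : set R) (f : R -> R) : Prop :=
  (forall x, D x -> cvg (slope f x y @[y --> within Ihalf (x^')])) /\
  {within D, continuous (derI f)}.

(* 1/T', extended by its limit 0 at the discontinuity [O] *)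
Definition inv_derI T O (x : R) : R := if x == O then 0 else (derI T x)^-1.

(* [T^n] does not meet the discontinuity at [x]: its value at [O] is
   immaterial, so statements about [T^n] are made at such points only. *)
Definition avoids T O (n : nat) (x : R) : Prop :=
  forall j, (j < n)%N -> iter j T x != O.

Definition left_branch O : set R := `[- 2^-1, O[.
Definition right_branch O : set R := `]O, 2^-1].
Definition branches O : set (set R) := [set left_branch O; right_branch O].

Definition transitiveI T O : Prop :=
  exists x, [/\ Ihalf x, forall n, avoids T O n x &
    Ihalf `<=` closure [set iter n T x | n in setT]].

Record lorenz_map T O : Prop := LorenzMap {
  lm_sing : - 2^-1 < O < 2^-1;
  lm_into : forall x, Ihalf x -> Ihalf (T x);
  lm_incr : forall J, branches O J ->
    forall x y, J x -> J y -> x < y -> T x < T y;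
  lm_C1 : C1I_on (Ihalf `\ O) T;
  lm_right : T x @[x --> O^'+] --> (- 2^-1 : R);
  lm_left : T x @[x --> O^'-] --> (2^-1 : R);
  lm_der_right : derI T x @[x --> O^'+] --> +oo;
  lm_der_left : derI T x @[x --> O^'-] --> +oo;
  lm_transitive : transitiveI T O }.

Definition expanding (C theta : R) T O : Prop :=
  forall n x, Ihalf x -> avoids T O n x ->
    C * theta ^+ n <= derI (iter n T) x.

Definition pvariation (p : R) (J : set R) (f : R -> R) : \bar R :=
  ereal_sup [set v | exists (n : nat) (x : nat -> R),
    [/\ forall i, (i <= n)%N -> J (x i),
        forall i, (i < n)%N -> x i < x i.+1 &
        v = ((\sum_(i < n) `|f (x i.+1) - f (x i)| `^ p) `^ p^-1)%:E]].

(* The (nonempty) elements of the n-th refinement of the partition [P]. *)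
Definition refinement T (P : set (set R)) (n : nat) : set (set R) :=
  [set A | A !=set0 /\ exists2 w : nat -> set R,
    forall j, (j < n)%N -> P (w j) &
    A = \bigcap_(j in [set j | (j < n)%N]) (iter j T @^-1` w j)].

Definition is_acip T (mu : probability (measurableTypeR R) R) : Prop :=
  [/\ mu Ihalf = 1%E, mu `<< lebesgue_measure &
      forall A, measurable A -> A `<=` Ihalf -> mu (Ihalf `&` T @^-1` A) = mu A].

Definition is_unique_acip T (mu : probability (measurableTypeR R) R) : Prop :=
  is_acip T mu /\
  forall nu : probability (measurableTypeR R) R, is_acip T nu ->
    forall A, measurable A -> nu A = mu A.

Definition is_density (h : R -> R)
    (mu : probability (measurableTypeR R) R) : Prop :=
  [/\ measurable_fun Ihalf h, forall x, Ihalf x -> 0 <= h x &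
      forall A, measurable A -> A `<=` Ihalf ->
        mu A = (\int[lebesgue_measure]_(x in A) (h x)%:E)%E].

Definition L1_dist (f g : R -> R) : \bar R :=
  (\int[lebesgue_measure]_(x in Ihalf) `|f x - g x|%:E)%E.

End IntervalMaps.

(* A vector field with its flow, the return time and Poincare map of [Sigma],
   and the data of an invariant foliation of [Sigma]: [lcoord] straightens the
   leaves (they are the sets [(lcoord xi).1 = const]), [lchart] is its inverse,
   and in these coordinates the Poincare map is (x, y) |-> (base x, fiber (x, y))
   with [base] discontinuous at [sing]. *)
Record lorenz_system (R : realType) := LorenzSystem {
  vfield : 'rV[R]_3 -> 'rV[R]_3;
  flow : R -> 'rV[R]_3 -> 'rV[R]_3;
  rtime : 'rV[R]_3 -> R;
  poincare : 'rV[R]_3 -> 'rV[R]_3;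
  lcoord : 'rV[R]_3 -> R * R;
  lchart : R * R -> 'rV[R]_3;
  base : R -> R;
  fiber : R * R -> R;
  sing : R }.

Section Systems.
Context {R : realType}.
Local Notation V := 'rV[R]_3.
Implicit Type S : lorenz_system R.

Definition leafproj S (xi : V) : R := (lcoord S xi).1.
Definition Gamma S : set V := [set xi | Sigma xi /\ leafproj S xi = sing S].
Definition skew S (p : R * R) : R * R := (base S p.1, fiber S p).

(* Transversality of the field to the plane z = 1 and first return. *)
Definition is_cross_section S : Prop :=
  (forall xi, Sigma xi -> vfield S xi 0 2%:R != 0) /\
  forall xi, Sigma xi -> ~ Gamma S xi ->
    first_return (flow S) Sigma xi (rtime S xi) /\
    poincare S xi = flow S (rtime S xi) xi.

Definition contracting_foliation S : Prop :=
  exists K rho : R, [/\ 0 < K, 0 < rho < 1 &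
    forall xi1 xi2, Sigma xi1 -> Sigma xi2 -> leafproj S xi1 = leafproj S xi2 ->
    forall n, (1 <= n)%N -> avoids (base S) (sing S) n (leafproj S xi1) ->
      `|iter n (poincare S) xi1 - iter n (poincare S) xi2|
        <= K * rho ^+ n * `|xi1 - xi2|].

Definition contracting_fiber S : Prop :=
  exists K rho : R, [/\ 0 < K, 0 < rho < 1 &
    forall x y1 y2, Ihalf x -> Ihalf y1 -> Ihalf y2 ->
    forall n, (1 <= n)%N -> avoids (base S) (sing S) n x ->
      `|(iter n (skew S) (x, y1)).2 - (iter n (skew S) (x, y2)).2|
        <= K * rho ^+ n * `|y1 - y2|].

(* What is required of each member of the family, the unperturbed one
   included. *)
Record lorenz_type (alpha : R) S : Prop := LorenzType {
  lt_field : C1_field (vfield S);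
  lt_flow : is_flow (vfield S) (flow S);
  lt_section : is_cross_section S;
  lt_chart : [/\ forall p, square p -> Sigma (lchart S p),
                 forall xi, Sigma xi -> square (lcoord S xi),
                 forall p, square p -> lcoord S (lchart S p) = p &
                 forall xi, Sigma xi -> lchart S (lcoord S xi) = xi];
  lt_foliation : C1holder_on alpha square (lchart S) /\
                 C1holder_on alpha Sigma (lcoord S);
  lt_skew : forall xi, Sigma xi -> ~ Gamma S xi ->
    lcoord S (poincare S xi) = skew S (lcoord S xi);
  lt_contracting : contracting_foliation S;
  lt_fiber : forall J, branches (sing S) J ->
    C1holder_on alpha (J `*` Ihalf) (fiber S);
  lt_fiber_contracting : contracting_fiber S;
  lt_base : lorenz_map (base S) (sing S) }.

Definition Sigma_plus : set V := [set xi | Sigma xi /\ 0 < xi 0 0].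
Definition Sigma_minus : set V := [set xi | Sigma xi /\ xi 0 0 < 0].

(* The image of x > 0 (x < 0) is a triangle pinched at T(0+) = -1/2
   (T(0-) = 1/2); its vertex, on the axis y = 0, is not attained. *)
Definition triangle_image S (D : set V) (a : R) (Tr : set V) : Prop :=
  [/\ curvilinear_triangle a 0 Tr, Tr `<=` Sigma,
      poincare S @` D = Tr `\ sec (a, 0) & C1_on D (poincare S)].

Record geometric_lorenz (alpha : R) (Lambda : set V) S : Prop :=
  GeometricLorenz {
  gl_type : lorenz_type alpha S;
  gl_equilibrium : vfield S 0 = 0;
  gl_attractor : is_attractor (flow S) Lambda;
  gl_eigen : exists l1 l2 l3 : R,
    [/\ eigenvalue (jacobian (vfield S) 0) =i [:: l1; l2; l3],
        l2 < l3 < 0 /\ 0 < l1,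
        0 < l1 + l3 /\ l1 + l2 < l3 &
        forall xi, Sigma xi -> xi 0 0 != 0 ->
          rtime S xi = - l1^-1 * ln `|xi 0 0|];
  gl_vertical : forall xi, Sigma xi -> lcoord S xi = (xi 0 0, xi 0 1);
  gl_sing : sing S = 0;
  gl_stable : exists2 B, nbhs (0 : V) B &
    Gamma S = Sigma `&` local_stable (flow S) 0 B;
  gl_triangles : exists Sp Sm : set V,
    [/\ triangle_image S Sigma_plus (- 2^-1) Sp,
        triangle_image S Sigma_minus 2^-1 Sm &
        forall c, Ihalf c -> c != 0 -> exists d,
          [set poincare S (sec (c, y)) | y in Ihalf] `<=`
          (if 0 < c then Sp else Sm) `&` [set xi | xi 0 0 = d]];
  gl_holder : holder_on alpha `[- 2^-1, 0] (inv_derI (base S) 0) /\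
              holder_on alpha `[0, 2^-1] (inv_derI (base S) 0);
  gl_expanding : exists C theta : R,
    [/\ 0 < C, 1 < theta & expanding C theta (base S) (sing S)] }.

(* The family is indexed by [0 <= e < emax]. *)
Record lorenz_family (alpha emax : R) (X : R -> lorenz_system R) : Prop :=
  LorenzFamily {
  lf_alpha : 0 < alpha <= 1;
  lf_emax : 0 < emax;
  lf_attractor : exists Lambda : set V, geometric_lorenz alpha Lambda (X 0) /\
    exists (U : set V) (UU : set (V -> V)),
    [/\ open U, Lambda `<=` U, max_invariant (flow (X 0)) U = Lambda,
        C1_open UU /\ UU (vfield (X 0)) &
        forall e : R, 0 <= e < emax ->
          let Le := max_invariant (flow (X e)) U in
          [/\ UU (vfield (X e)), Le `<=` U, is_attractor (flow (X e)) Le &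
              exists2 s, Le s & hyperbolic_singularity (vfield (X e)) s]];
  lf_type : forall e : R, 0 <= e < emax -> lorenz_type alpha (X e);
  lf_close : exists2 C : R, 0 < C & forall eta : R, 0 < eta ->
    exists (e0 : R) (H : set R),
      [/\ 0 < e0 < emax, is_interval H /\ H `<=` Ihalf,
          lebesgue_measure H = (2 * `|sing (X e0)|)%:E,
          2 * `|sing (X e0)| < eta &
          forall e : R, 0 <= e < e0 ->
            [/\ H (sing (X e)), H 0 &
            (ereal_sup [set (`|base (X e) x - base (X 0) x|
                        + `|derI (base (X e)) x - derI (base (X 0)) x|)%:E
                       | x in Ihalf `\` H] <= (C * eta)%:E)%E]];
  lf_expanding : exists C theta : R, [/\ 0 < C, 1 < theta &
    forall e : R, 0 <= e < emax -> expanding C theta (base (X e)) (sing (X e))];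
  lf_variation : exists2 W : R, 0 < W & forall e : R, 0 <= e < emax ->
    forall J, branches (sing (X e)) J ->
      (pvariation alpha^-1 J (fun x => (derI (base (X e)) x)^-1)%R
        <= W%:E)%E;
  lf_partition : forall n, (0 < n)%N -> exists2 delta : R, 0 < delta &
    forall e : R, 0 <= e < emax -> forall J,
      refinement (base (X e)) (branches (sing (X e))) n J ->
      (delta%:E <= lebesgue_measure J)%E;
  lf_rtime : exists2 C : R, 0 < C & forall e : R, 0 <= e < emax ->
    forall xi, Sigma xi -> ~ Gamma (X e) xi ->
      rtime (X e) xi <= - C * ln `|leafproj (X e) xi - sing (X e)| }.

End Systems.

(* Main.v *)
Require Import Defs.
From HB Require Import structures.
From mathcomp Require Import all_boot all_order all_algebra.
From mathcomp Require Import all_classical all_reals all_analysis measurable_realfun.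
From mathcomp Require Import zify ring lra.
Import Order.TTheory GRing.Theory Num.Theory.
Import numFieldNormedType.Exports.

(** Let [L] be the transfer operator of a map [T] of the family ([transfer]) and
    [dens n] the function [L^n 1], the density of the image of Lebesgue measure
    under [T^n].  The theorem rests on two estimates for these functions, with
    constants that are the same for all members of the family, and on a
    compactness principle.

    Estimates ([dens_uniform_bound], [dens_uniform_mesh]).  For a sequence of
    disjoint, increasing, weighted pairs of points [(w, z, z')], consider
    [sum w (L f z - L f z')].  Up to an error, this is the same expression for [f]
    and for the pairs pulled back by the two inverse branches; these are again
    disjoint and increasing.  The error has two sources: the variation of the
    weight [1/T'] along the pulled back pairs, and the pairs that straddle an end
    of the image of a branch, at most two per branch.  The first one is bounded
    through [d <= tau + d^P / tau^(P-1)], where the [P]-th powers are summable with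
    a uniform bound because [1/T'] has bounded [p]-variation and [P >= p].  As the
    weights decay like [theta^-j] under pulling back, a good choice of the
    thresholds [tau_j] makes the errors of all levels add up to a geometric series
    ([wdiff_dens]).
    - For a sup bound, pair each preimage of [y] under [T^n] with a point of the
      same [n]-cylinder where the density is at most [2 / delta_n]; there is one
      since the cylinder has length at least [delta_n] and the density has
      integral 1.  The resulting inequality [dens_bound] lowers an exponential
      bound on the growth of [dens n] to a smaller exponential, and finitely many
      repetitions reach a constant.
    - For an oscillation bound, pair points of each cell of a mesh of size
      [l^-P]: the mean oscillation over the mesh is at most [c / l].

    Compactness ([L1_limit]).  Densities with common bounds of both kinds that
    are asymptotically invariant under [T], tested on rays, converge in L1 to the
    density of the acip of [T] if this acip is unique.  Indeed along any
    ultrafilter the masses of each Borel set converge; by the sup bound the limit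
    is a countably additive absolutely continuous probability, it is invariant,
    hence it is the acip.  On each cell the density of the acip lies almost
    everywhere between the limits of the infima and of the suprema, so the oscillation bound upgrades
    set-wise convergence to convergence in L1.

    The principle is used twice.  For a fixed parameter [e], the mean of
    [dens 0 ... dens n] is invariant up to [1/(n+1)], so these means tend to the
    density [h e].  Choose one of them at distance at most [e] from [h e] and
    invariant up to [e].  As [e] tends to 0, the chosen functions are
    asymptotically invariant under the unperturbed map: off a short interval the
    two maps are uniformly close, so the preimages of a ray under them differ by a
    subset of that interval and of the preimage of another short interval.  Hence
    they tend to [h 0], and so does [h e]. *)

Set Implicit Arguments.
Unset Strict Implicit.
Unset Printing Implicit Defensive.
Local Open Scope classical_set_scope.
Local Open Scope ring_scope.


(** * Weighted pairs of points and p-variation *)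

Section Pairs.
Context {R : realType}.
Implicit Types (t u : R * R * R) (c : seq (R * R * R)).

(** A weighted pair is a triple: its weight, then its two points in either
    order.  The pairs of a sequence related by [below] span disjoint intervals,
    listed from left to right. *)
Definition below t u : bool :=
  [&& t.1.2 < u.1.2, t.1.2 < u.2, t.2 < u.1.2 & t.2 < u.2].

Lemma belowP t u : reflect [/\ t.1.2 < u.1.2, t.1.2 < u.2, t.2 < u.1.2 & t.2 < u.2] (below t u).
Proof. exact: and4P. Qed.

Lemma eq_ler (x y : R) : x = y -> x <= y.
Proof. by move=> ->. Qed.

(** Trades a first power for a [P]-th power, which p-variation controls: a
    distance is below the threshold [tau] or is dominated by its [P]-th power. *)
Lemma le_threshold (tau d : R) (P : nat) : 0 < tau -> 0 <= d -> (0 < P)%N ->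
  d <= tau + d ^+ P / tau ^+ P.-1.
Proof.
case: P => // P t0 d0 _ /=; have [dt|/ltW td] := leP d tau.
  by rewrite (le_trans dt)// lerDl divr_ge0// exprn_ge0// ltW.
apply: (@le_trans _ _ (d ^+ P.+1 / tau ^+ P)); last by rewrite lerDr ltW.
rewrite ler_pdivlMr ?exprn_gt0// exprS ler_wpM2l// lerXn2r// nnegrE.
exact: ltW.
Qed.

(** Disjoint pairs that leave an interval each contain one of its two ends. *)
Lemma size_crossing_pairs (D : set R) c : is_interval D -> pairwise below c ->
  (forall t, t \in c -> D t.1.2 /\ ~ D t.2) -> (size c <= 2)%N.
Proof.
move=> iD; case: c => [//|t1 [//|t2 [//|t3 c]]] /= /andP[/andP[b12 /andP[b13 _]]].
move=> /andP[/andP[b23 _] _] H; exfalso.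
have [D1 _] := H t1 (mem_head _ _).
have [D2 nD2] : D t2.1.2 /\ ~ D t2.2 by apply: H; rewrite !inE eqxx orbT.
have [D3 _] : D t3.1.2 /\ ~ D t3.2 by apply: H; rewrite !inE eqxx !orbT.
move: b12 b23 => /belowP[_ h _ _] /belowP[_ _ h' _].
by apply: nD2; apply: (iD _ _ D1 D3); rewrite !ltW.
Qed.

Section Variation.
Variables (g : R -> R) (p : R).

Fixpoint varsum (x : R) (s : seq R) : R :=
  if s is y :: s' then `|g y - g x| `^ p + varsum y s' else 0.

Lemma varsum_ge0 x s : 0 <= varsum x s.
Proof. by elim: s x => //= y s IH x; rewrite addr_ge0 ?powR_ge0. Qed.

Lemma varsumE x s : varsum x s =
  \sum_(i < size s) `|g (nth 0 (x :: s) i.+1) - g (nth 0 (x :: s) i)| `^ p.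
Proof.
elim: s x => [|y s IH] x; first by rewrite big_ord0.
by rewrite big_ord_recl/= IH; congr (_ + _).
Qed.

(** Pairs of equal points are skipped so that the sequence is strictly
    increasing, as [pvariation] requires. *)
Definition endpoints c : seq R :=
  flatten [seq if t.1.2 == t.2 then [::] else
     [:: Num.min t.1.2 t.2; Num.max t.1.2 t.2] | t <- c].

Lemma endpoints_cons t c : endpoints (t :: c) =
  if t.1.2 == t.2 then endpoints c else
  Num.min t.1.2 t.2 :: Num.max t.1.2 t.2 :: endpoints c.
Proof. by rewrite /endpoints/=; case: ifP. Qed.

Lemma mem_endpoints c x : x \in endpoints c ->
  exists2 t, t \in c & (x == t.1.2) || (x == t.2).
Proof.
move=> /flatten_mapP[t tc]; case: ifP => // _ xt; exists t => //.
by move: xt; rewrite !inE; case: leP => _; rewrite // orbC.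
Qed.

Lemma endpoints_sorted c : pairwise below c -> sorted <%R (endpoints c).
Proof.
rewrite lt_sorted_pairwise; elim: c => //= t c IH /andP[/allP tc /IH pc].
rewrite endpoints_cons; case: eqVneq => //= tt'.
have H y : y \in endpoints c -> (t.1.2 < y) && (t.2 < y).
  move=> /mem_endpoints[u uc yu]; have /belowP[? ? ? ?] := tc _ uc.
  by move: yu => /orP[]/eqP->; apply/andP.
rewrite pc andbT; apply/andP; split; [apply/andP; split|].
- by case: (ltgtP t.1.2 t.2) tt' => // ->; rewrite eqxx.
- by apply/allP => y /H /=; case: (leP t.1.2 t.2) => _ /andP[].
- by apply/allP => y /H /=; case: (leP t.1.2 t.2) => _ /andP[].
Qed.

Lemma sum_le_varsum c x :
  0 < p ->
  \sum_(t <- c) `|g t.1.2 - g t.2| `^ p <= varsum x (endpoints c).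
Proof.
move=> p0; elim: c x => [|t c IH] x; first by rewrite big_nil.
rewrite big_cons endpoints_cons; case: eqVneq => [->|tt'] /=.
  by rewrite subrr normr0 powR0 ?gt_eqF// add0r.
apply: (@le_trans _ _ (`|g t.1.2 - g t.2| `^ p +
  varsum (Num.max t.1.2 t.2) (endpoints c))); first by rewrite lerD2l.
rewrite (_ : `|g t.1.2 - g t.2| =
  `|g (Num.max t.1.2 t.2) - g (Num.min t.1.2 t.2)|); last first.
  by case: leP => _; rewrite // distrC.
by rewrite lerDr powR_ge0.
Qed.

Lemma sum_le_varsum0 c : 0 < p -> endpoints c != [::] ->
  \sum_(t <- c) `|g t.1.2 - g t.2| `^ p <=
  varsum (head 0 (endpoints c)) (behead (endpoints c)).
Proof.
move=> p0; elim: c => [|t c IH] //.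
rewrite big_cons endpoints_cons; case: (eqVneq t.1.2 t.2) => [->|tt' _] /=.
  by rewrite subrr normr0 powR0 ?gt_eqF// add0r.
apply: (@le_trans _ _ (`|g t.1.2 - g t.2| `^ p +
  varsum (Num.max t.1.2 t.2) (endpoints c))).
  by rewrite lerD2l sum_le_varsum.
by rewrite lerD2r; case: (leP t.1.2 t.2) => _; rewrite // distrC.
Qed.

Lemma sum_powR_le_pvariation (J : set R) (W : R) c : 0 < p -> 0 <= W ->
  (pvariation p J g <= W%:E)%E -> pairwise below c ->
  (forall t, t \in c -> J t.1.2 /\ J t.2) ->
  \sum_(t <- c) `|g t.1.2 - g t.2| `^ p <= W `^ p.
Proof.
move=> p0 W0 VW sc Jc; have [ec|ec] := eqVneq (endpoints c) [::].
  rewrite (le_trans (sum_le_varsum c 0 p0))// ec/= powR_ge0//.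
rewrite (le_trans (sum_le_varsum0 p0 ec))//.
have := endpoints_sorted sc.
have JE x : x \in endpoints c -> J x.
  by move=> /mem_endpoints[t /Jc[J1 J2]] /orP[]/eqP->.
case: (endpoints c) ec JE => // x s _ JE /= xs.
have xs' i : (i < size s)%N -> nth 0 (x :: s) i < nth 0 (x :: s) i.+1.
  by move=> is'; have /(pathP 0)/(_ _ is') := xs.
have : ((varsum x s `^ p^-1)%:E <= W%:E)%E.
  apply: le_trans VW; apply: ereal_sup_ubound.
  exists (size s), (fun i => nth 0 (x :: s) i); split => //.
  - by move=> i ? ; apply: JE; rewrite mem_nth.
  - by rewrite varsumE.
rewrite lee_fin => h.
rewrite -[leLHS](@powRr1 _ (varsum x s)) ?varsum_ge0//.
rewrite -(@mulVf _ p) ?gt_eqF// powRrM.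
by apply: ge0_ler_powR => //; rewrite ?nnegrE ?powR_ge0// ltW.
Qed.

End Variation.

(** As the increments [d] of [g] are at most [G], the quotient [d / G] is at most 1
    and its [P]-th power is at most its [p]-th power. *)
Lemma sum_expr_le_pvariation (g : R -> R) (p W G : R) (P : nat) (J : set R) c :
  0 < p -> 0 <= W -> 0 < G -> p <= P%:R ->
  (forall x, J x -> 0 <= g x <= G) ->
  (pvariation p J g <= W%:E)%E -> pairwise below c ->
  (forall t, t \in c -> J t.1.2 /\ J t.2) ->
  \sum_(t <- c) `|g t.1.2 - g t.2| ^+ P <= G ^+ P * (W `^ p * G^-1 `^ p).
Proof.
move=> p0 W0 G0 pP gG VW sc Jc.
have GV0 : 0 < G^-1 by rewrite invr_gt0.
apply: (@le_trans _ _
  (\sum_(t <- c) G ^+ P * (`|g t.1.2 - g t.2| `^ p * G^-1 `^ p))).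
  rewrite big_seq [leRHS]big_seq; apply: ler_sum => t /Jc[/gG/andP[a1 a2] /gG/andP[b1 b2]].
  have : `|g t.1.2 - g t.2| <= G by rewrite ler_norml; apply/andP; split; lra.
  have : 0 <= `|g t.1.2 - g t.2| by exact: normr_ge0.
  move: `|_| => d d0 dG.
  rewrite -powRM ?(ltW GV0)// -ler_pdivrMl ?exprn_gt0// mulrC -exprVn -exprMn.
  rewrite -powR_mulrn ?mulr_ge0 ?(ltW GV0)//.
  move: d0; rewrite le_eqVlt => /predU1P[<-|d0].
    by rewrite mul0r !powR0 ?gt_eqF// (lt_le_trans p0).
  have G0' : 0 < d / G by rewrite mulr_gt0.
  rewrite -[d / G]lnK ?posrE// -!expRM ler_expR.
  by rewrite ler_wnM2l// ln_le0// ler_pdivrMr// mul1r.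
rewrite -mulr_sumr -mulr_suml ler_wpM2l ?exprn_ge0 ?(ltW G0)//.
by rewrite ler_wpM2r ?powR_ge0//; exact: (@sum_powR_le_pvariation g p J).
Qed.

End Pairs.

(** * Lebesgue measure on open intervals and a change of variables *)

Section Measure.
Context {R : realType}.
Local Notation mu := (@lebesgue_measure R).
Local Open Scope ereal_scope.

Lemma measure_splitI (nu : {measure set (measurableTypeR R) -> \bar R})
    (A B : set R) : measurable A -> measurable B ->
  nu A = nu (A `&` B) + nu (A `&` ~` B).
Proof.
move=> mA mB; rewrite -measureU.
- by rewrite -setIUr setUv setIT.
- exact: (measurableI _ _ mA mB).
- exact: (measurableI _ _ mA (measurableC mB)).
- by rewrite setIACA setICr setI0.
Qed.

(** Near the ends of the interval nothing is known about [nu], which may even be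
    infinite there.  On a compact subinterval, [nu] completed by Lebesgue measure
    outside agrees with Lebesgue measure on all intervals, and the open interval is
    an increasing union of such subintervals. *)
Lemma lebesgue_measure_unique_oo (nu : {measure set (measurableTypeR R) -> \bar R})
    (l r : R) : (l < r)%R ->
  (forall s t, (l < s)%R -> (s <= t)%R -> (t < r)%R -> nu `]s, t]%classic = (t - s)%:E) ->
  forall E, measurable E -> nu (E `&` `]l, r[) = mu (E `&` `]l, r[).
Proof.
move=> lr nuE E mE.
pose d (n : nat) : R := ((r - l) / 2 / n.+1%:R)%R.
have d0 n : (0 < d n)%R by rewrite /d !divr_gt0// subr_gt0.
have dn n : (d n <= (r - l) / 2)%R.
  by rewrite /d ler_pdivrMr// ler_peMr// ?ler1n// divr_ge0// subr_ge0 ltW.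
pose B n : set R := `](l + d n)%R, (r - d n)%R]%classic.
have mB n : measurable (B n) by exact: measurable_itv.
have eqB n F : measurable F -> nu (F `&` B n) = mu (F `&` B n).
  move=> mF.
  (* the completed measure *)
  pose m1 := mrestr nu (mB n); pose m2 := mrestr mu (measurableC (mB n)).
  have h := @lebesgue_measure_unique R (measure_add m1 m2).
  have {}h : forall X, ocitv X -> mu X = measure_add m1 m2 X.
    move=> _ [[a b]] _ <- /=; rewrite measure_addE.
    change (mu `]a, b]%classic =
      nu (`]a, b]%classic `&` B n) + mu (`]a, b]%classic `&` ~` B n)).
    have mab : measurable (`]a, b]%classic : set R) by exact: measurable_itv.
    have -> : nu (`]a, b]%classic `&` B n) = mu (`]a, b]%classic `&` B n).
      pose s := Num.max a (l + d n)%R; pose t := Num.min b (r - d n)%R.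
      have -> : `]a, b]%classic `&` B n = `]s, t]%classic.
        apply/seteqP; split => x; rewrite /B /= !in_itv/= /s /t gt_max le_min.
          by move=> [/andP[-> ->] /andP[-> ->]].
        by move=> /andP[/andP[-> ->] /andP[-> ->]].
      have [st|ts] := leP s t; last first.
        by rewrite set_itv_ge ?measure0// bnd_simp -leNgt ltW.
      rewrite nuE//; last 2 first.
      - by rewrite /s lt_max ltrDl d0 orbT.
      - by rewrite /t gt_min gtrBl d0 orbT.
      rewrite lebesgue_measure_itv/= lte_fin -EFinB.
      by move: st; rewrite le_eqVlt => /predU1P[->|->//]; rewrite subrr ltxx.
    exact: measure_splitI.
  have {}h := lebesgue_measure_unique h.
  have hF := h _ (measurableI _ _ mF (mB n)).
  have {}hF : mu (F `&` B n) = nu (F `&` B n `&` B n) + mu (F `&` B n `&` ~` B n).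
    exact: (etrans hF (measure_addE _ _ _)).
  rewrite [RHS]hF -!setIA setIid.
  by rewrite setICr setI0 measure0 adde0.
have BU : `]l, r[%classic = \bigcup_n B n.
  apply/seteqP; split => [x|x [n _]]; rewrite /B /= !in_itv/=; last first.
    by move=> /andP[h1 h2]; have := d0 n; move=> h3; apply/andP; split; lra.
  move=> /andP[lx xr].
  pose e := Num.min (x - l)%R (r - x)%R.
  have e0 : (0 < e)%R by rewrite /e lt_min !subr_gt0 lx.
  have rl0 : (0 <= e^-1 * ((r - l) / 2))%R.
    by rewrite mulr_ge0 ?divr_ge0 ?subr_ge0 ?invr_ge0 ?ltW.
  have dNe : (d (Num.bound (e^-1 * ((r - l) / 2))) < e)%R.
    rewrite /d ltr_pdivrMr// -ltr_pdivrMl//.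
    by apply: (lt_le_trans (archi_boundP rl0)); rewrite ler_nat.
  exists (Num.bound (e^-1 * ((r - l) / 2))) => //; rewrite /= in_itv/=.
  move: dNe; rewrite lt_min => /andP[h1 h2]; apply/andP; split; lra.
have cv (nu' : {measure set (measurableTypeR R) -> \bar R}) :
    nu' (E `&` B n) @[n --> \oo] --> nu' (E `&` `]l, r[).
  rewrite BU setI_bigcupr; apply: nondecreasing_cvg_mu.
  - by move=> n; exact: (measurableI _ _ mE (mB n)).
  - by apply: bigcup_measurable => n _; exact: (measurableI _ _ mE (mB n)).
  - move=> n m nm; apply/subsetPset; apply: setIS => x; rewrite /B /= !in_itv/=.
    have : (d m <= d n)%R.
      by rewrite /d ler_wpM2l ?divr_ge0 ?subr_ge0 ?(ltW lr)// lef_pV2 ?posrE// ler_nat.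
    by move=> h /andP[h1 h2]; apply/andP; split; lra.
have h1 := cv nu; have h2 := cv mu.
have e : (fun n => nu (E `&` B n)) = (fun n => mu (E `&` B n)).
  by apply/funext => n; exact: eqB.
rewrite e in h1; exact: cvg_unique h1 h2.
Qed.

Import HBNNSimple.

(** A change of variables along [psi] with jacobian [w], known for sets, holds for
    functions: by linearity for simple ones, then by monotone convergence. *)
Lemma ge0_integral_weighted_comp (w psi : R -> R) (B : set R) :
  measurable_fun setT w -> (forall y, (0 <= w y)%R) ->
  measurable_fun setT psi -> measurable B ->
  (forall E, measurable E ->
     \int[mu]_(y in setT) (w y * \1_E (psi y))%:E = mu (E `&` B)) ->
  forall u : R -> R, measurable_fun setT u -> (forall x, (0 <= u x)%R) ->
  \int[mu]_(y in setT) (w y * u (psi y))%:E = \int[mu]_(x in B) (u x)%:E.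
Proof.
move=> mw w0 mpsi mB wE u mu_ u0.
have mEu : measurable_fun setT (EFin \o u) by exact/measurable_EFinP.
pose h := nnsfun_approx measurableT mEu.
have hcvg x : (EFin \o h n) x @[n --> \oo] --> (u x)%:E.
  by apply: (@cvg_nnsfun_approx _ _ _ _ measurableT _ mEu) => // y _; rewrite lee_fin.
have hnd x : {homo (fun n => (h n x)%:E) : n m / (n <= m)%N >-> n <= m}.
  by move=> n m nm; rewrite lee_fin; exact/lefP/nd_nnsfun_approx.
have mh n : measurable_fun setT (h n) by exact/measurable_funP.
have -> : \int[mu]_(x in B) (u x)%:E = lim (\int[mu]_(x in B) (h n x)%:E @[n --> \oo]).
  rewrite -monotone_convergence//.
  - by apply: eq_integral => x _; apply/esym/cvg_lim => //; exact: hcvg.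
  - by move=> n; apply/measurable_EFinP; apply: measurable_funTS; exact: mh.
  - by move=> n x _; rewrite lee_fin.
have -> : \int[mu]_(y in setT) (w y * u (psi y))%:E =
    lim (\int[mu]_(y in setT) (w y * h n (psi y))%:E @[n --> \oo]).
  rewrite -monotone_convergence//.
  - apply: eq_integral => y _; apply/esym/cvg_lim => //.
    under eq_fun do rewrite EFinM; rewrite EFinM.
    by apply: cvgeZl => //; exact: hcvg.
  - move=> n; apply/measurable_EFinP; apply: measurable_funM => //.
    exact: measurableT_comp.
  - by move=> n x _; rewrite lee_fin mulr_ge0.
  - move=> y _ n m nm; rewrite lee_fin ler_wpM2l// -lee_fin; exact: hnd.
congr (limn _); apply/funext => n /=.
pose g r x := (r * \1_(h n @^-1` [set r]) x)%R.
have hE x : (h n x)%:E = \sum_(r \in range (h n)) (g r x)%:E.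
  by rewrite fimfunE -fsumEFin.
have g0 r x : (0 <= g r x)%R.
  have := nnfun_muleindic_ge0 (h n) r x; rewrite -EFinM lee_fin; exact.
have mg r : measurable_fun setT (g r).
  by apply: measurable_funM => //; exact: measurable_indic.
under eq_integral => y _.
  rewrite EFinM hE ge0_mule_fsumr//; last by move=> r; rewrite lee_fin.
  under eq_fsbigr do rewrite -EFinM.
  over.
rewrite ge0_integral_fsum//; last 2 first.
- move=> r; apply/measurable_EFinP; apply: measurable_funM => //.
  exact: measurableT_comp.
- by move=> r y _; rewrite lee_fin mulr_ge0.
under [RHS]eq_integral => x _ do rewrite hE.
rewrite [RHS]ge0_integral_fsum//; last 2 first.
- by move=> r; apply/measurable_EFinP; apply: measurable_funTS; exact: mg.
- by move=> r x _; rewrite lee_fin.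
apply: eq_fsbigr => r; rewrite inE => -[x _ <-].
rewrite /g; set E := _ @^-1` [set h n x]; have mE : measurable E by exact: measurable_sfunP.
under eq_integral => y _ do rewrite mulrCA EFinM.
rewrite ge0_integralZl//; last 3 first.
- apply/measurable_EFinP; apply: measurable_funM => //.
  have mE1 : measurable_fun setT (\1_E : R -> R) by exact: measurable_indic.
  exact: (measurableT_comp mE1 mpsi).
- by move=> y _; rewrite lee_fin mulr_ge0.
- by rewrite lee_fin.
under [RHS]eq_integral => y _ do rewrite EFinM.
rewrite ge0_integralZl//; last 2 first.
- by apply/measurable_EFinP; apply: measurable_funTS; exact: measurable_indic.
- by rewrite lee_fin.
by rewrite wE// integral_indic.
Qed.

End Measure.

(** * The mesh of the interval *)

Section Mesh.
Context {R : realType}.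

Lemma lebesgue_Ihalf : @lebesgue_measure R (@Ihalf R) = 1%E.
Proof.
rewrite lebesgue_measure_itv/= lte_fin ifT; last by lra.
by rewrite -EFinB; congr EFin; lra.
Qed.

Lemma measurable_Ihalf : measurable (@Ihalf R : set (measurableTypeR R)).
Proof. exact: measurable_itv. Qed.

Definition bin (N r : nat) : set R :=
  `[- 2^-1 + r%:R / N%:R, - 2^-1 + r.+1%:R / N%:R[.

Lemma bin_Ihalf N r x : (r < N)%N -> bin N r x -> Ihalf x.
Proof.
move=> rN; have N0 : 0 < N%:R :> R by rewrite ltr0n; case: N rN.
rewrite /bin /Ihalf/= !in_itv/= => /andP[h1 h2].
have a : 0 <= r%:R / N%:R :> R by rewrite divr_ge0.
have b : r.+1%:R / N%:R <= 1 :> R by rewrite ler_pdivrMr// mul1r ler_nat.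
by apply/andP; split; lra.
Qed.

End Mesh.

(** * Branches, derivatives along orbits and inverse branches *)

Section Branches.
Context {R : realType}.
Variables (T : R -> R) (O : R).
Hypothesis lT : lorenz_map T O.

Definition branch (b : bool) : set R := if b then right_branch O else left_branch O.

Lemma branches_branch b : branches O (branch b).
Proof. by case: b; [right|left]. Qed.

Lemma sing_itv : - 2^-1 < O < 2^-1.
Proof. exact: lm_sing lT. Qed.

Lemma branch_Ihalf b x : branch b x -> Ihalf x.
Proof.
have /andP[s1 s2] := sing_itv; rewrite /Ihalf.
by case: b; rewrite /branch /right_branch /left_branch /= !in_itv/=
  => /andP[h1 h2]; apply/andP; split; lra.
Qed.

Lemma branchP b x : branch b x <-> Ihalf x /\ (if b then O < x else x < O).
Proof.
have /andP[s1 s2] := sing_itv.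
split; first by move=> bx; split; [exact: branch_Ihalf bx|];
  by case: b bx; rewrite /branch /right_branch /left_branch /= in_itv/= => /andP[].
by case: b => -[]; rewrite /Ihalf /branch /right_branch /left_branch /= !in_itv/=
  => /andP[h1 h2] h3;
  apply/andP; split.
Qed.

Lemma branch_side b x : branch b x -> if b then O < x else x < O.
Proof.
by case: b; rewrite /branch /right_branch /left_branch /= in_itv/= => /andP[].
Qed.

Lemma branch_neq b x : branch b x -> x != O.
Proof.
by move=> /branchP[_]; case: b => h; [rewrite gt_eqF|rewrite lt_eqF].
Qed.

Lemma branch_ltP b x : branch b x -> (O < x) = b.
Proof. by move=> /branchP[_]; case: b => // h; apply/negbTE; rewrite -leNgt ltW. Qed.

Lemma exists_branch x : Ihalf x -> x != O -> branch (O < x) x.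
Proof. by move=> Ix xO; apply/branchP; split => //; case: ltgtP xO. Qed.

Lemma branch_is_interval b : is_interval (branch b).
Proof. by case: b; exact: interval_is_interval. Qed.

Lemma T_Ihalf x : Ihalf x -> Ihalf (T x).
Proof. exact: lm_into lT x. Qed.

Lemma T_lt b x y : branch b x -> branch b y -> (T x < T y) = (x < y).
Proof.
move=> bx bY; apply/idP/idP; last exact: (lm_incr lT (branches_branch b)).
apply: contraLR; rewrite -!leNgt le_eqVlt => /predU1P[->//|yx].
by rewrite ltW// (lm_incr lT (branches_branch b)).
Qed.

Lemma T_le b x y : branch b x -> branch b y -> (T x <= T y) = (x <= y).
Proof. by move=> bx bY; rewrite !leNgt (T_lt bY bx). Qed.

Lemma T_inj b x y : branch b x -> branch b y -> T x = T y -> x = y.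
Proof.
by move=> bx bY Txy; apply/eqP; rewrite eq_le -(T_le bx bY) -(T_le bY bx) Txy lexx.
Qed.

(** Makes limits of slopes unique, also at the ends of the interval, so that
    [derI] can be computed. *)
Lemma Ihalf_dnbhs_proper (x : R) : Ihalf x -> ProperFilter (within Ihalf x^').
Proof.
rewrite /Ihalf /= in_itv/= => /andP[x1 x2].
split; last exact: within_filter.
rewrite /within/= /dnbhs/= /within/= => /nbhs_ballP[e /= e0 H].
have [xlt|xge] := ltP x 2^-1.
  pose y := Num.min (x + e / 2) 2^-1.
  have y1 : x < y by rewrite /y lt_min xlt andbT; lra.
  have y2 : y <= 2^-1 by rewrite /y ge_min lexx orbT.
  have y3 : y <= x + e / 2 by rewrite /y ge_min lexx.
  apply: (H y).
  - by rewrite /ball/= ltr_norml; apply/andP; split; lra.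
  - by rewrite gt_eqF.
  - by rewrite in_itv/=; apply/andP; split; lra.
pose y := Num.max (x - e / 2) (-2^-1).
have y1 : y < x by rewrite /y gt_max; apply/andP; split; lra.
have y2 : -2^-1 <= y by rewrite /y le_max lexx orbT.
have y3 : x - e / 2 <= y by rewrite /y le_max lexx.
apply: (H y).
- by rewrite /ball/= ltr_norml; apply/andP; split; lra.
- by rewrite lt_eqF.
- by rewrite in_itv/=; apply/andP; split; lra.
Qed.

Lemma near_Ihalf_dnbhs (x : R) (P : set R) :
  nbhs x [set y | y != x -> Ihalf y -> P y] -> nbhs (within Ihalf x^') P.
Proof. by []. Qed.

Lemma dnbhs_Ihalf_near (x : R) (P : set R) :
  nbhs (within Ihalf x^') P -> nbhs x [set y | y != x -> Ihalf y -> P y].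
Proof. by []. Qed.

Lemma cvg_slope x : Ihalf x -> x != O ->
  slope T x y @[y --> within Ihalf x^'] --> derI T x.
Proof.
by move=> Ix xO; have [+ _] := lm_C1 lT => /(_ x); apply; split => //; exact/eqP.
Qed.

Lemma cvg_within_sub (x : R) : (y - x) @[y --> within Ihalf x^'] --> (0 : R).
Proof.
have h : (y - x) @[y --> x] --> (0 : R).
  by rewrite -(subrr x); apply: cvgB; [exact: cvg_id|exact: cvg_cst].
apply: (cvg_trans _ h); apply: cvg_app.
by move=> P Px; apply: near_Ihalf_dnbhs; apply: filterS Px => y Py _ _.
Qed.

Lemma cvg_T_dnbhs x : Ihalf x -> x != O ->
  T y @[y --> within Ihalf x^'] --> T x.
Proof.
move=> Ix xO; have PF := Ihalf_dnbhs_proper Ix.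
have h : (T x + slope T x y * (y - x)) @[y --> within Ihalf x^'] --> T x + derI T x * 0.
  apply: cvgD; first exact: cvg_cst.
  by apply: cvgM; [exact: cvg_slope|exact: cvg_within_sub].
rewrite mulr0 addr0 in h; apply: cvg_trans h; apply: near_eq_cvg.
apply: near_Ihalf_dnbhs; apply: filterS filterT => y _ yx _.
by rewrite /slope divfK ?subr_eq0// addrC subrK.
Qed.

Lemma cvg_T_nbhs x : Ihalf x -> x != O ->
  T y @[y --> within Ihalf (nbhs x)] --> T x.
Proof.
move=> Ix xO V Vx; have /dnbhs_Ihalf_near := cvg_T_dnbhs Ix xO Vx.
apply: filterS => y /= h Iy; have [->|yx] := eqVneq y x; last exact: h.
exact: nbhs_singleton.
Qed.

Lemma nbhs_branch b x : branch b x -> \forall y \near x, Ihalf y -> branch b y.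
Proof.
move=> /branchP[_]; case: b => xO.
  near=> y => Iy; apply/branchP; split => //; near: y.
  exact: lt_nbhsr.
near=> y => Iy; apply/branchP; split => //; near: y.
exact: lt_nbhsl.
Unshelve. all: by end_near. Qed.

Lemma cvg_T_within x : Ihalf x -> x != O ->
  T y @[y --> within Ihalf x^'] --> within Ihalf (T x)^'.
Proof.
move=> Ix xO V /dnbhs_Ihalf_near VT; apply: near_Ihalf_dnbhs.
have /dnbhs_Ihalf_near := cvg_T_dnbhs Ix xO VT.
have := nbhs_branch (exists_branch Ix xO).
apply: filterS2 => y hb h yx Iy; apply: h => //; last exact: T_Ihalf.
apply: contra yx => /eqP Tyx; apply/eqP.
exact: (T_inj (hb Iy) (exists_branch Ix xO)).
Qed.

Lemma cvg_within_mono (A B : set R) (x : R) : A `<=` B ->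
  within A (nbhs x) `=>` within B (nbhs x).
Proof. by move=> AB P; apply: (@filterS _ (nbhs x)) => y h /AB. Qed.

Lemma continuous_T_within (D : set R) : D `<=` Ihalf `\ O ->
  {within D, continuous T}.
Proof.
move=> DI; apply/subspace_continuousP => x Dx.
have [Ix /eqP xO] := DI _ Dx.
apply: cvg_trans (cvg_T_nbhs Ix xO); apply: cvg_app.
by apply: cvg_within_mono => y /DI[].
Qed.

Lemma branch_setD b : branch b `<=` Ihalf `\ O.
Proof. by move=> x bx; split; [exact: branch_Ihalf bx|apply/eqP; exact: branch_neq bx]. Qed.

Lemma avoidsS n x : avoids T O n.+1 x <-> x != O /\ avoids T O n (T x).
Proof.
split=> [h|[h0 h] [|j]// jn]; first split => [|j jn]; first exact: (h 0%N).
  by rewrite -iterSr; exact: h.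
by rewrite iterSr; exact: h.
Qed.

Lemma avoidsD n m x : avoids T O (n + m) x <-> avoids T O n x /\ avoids T O m (iter n T x).
Proof.
elim: n x => [|n IH] x; first by split => [?|[]//]; split.
by rewrite addSn !avoidsS IH iterSr; tauto.
Qed.

(** Chain rule for derivatives relative to the interval; injectivity of [T] on a
    branch keeps the intermediate slopes away from a zero denominator. *)
Lemma cvg_slope_iter n x : Ihalf x -> avoids T O n x ->
  slope (iter n T) x y @[y --> within Ihalf x^'] -->
  \prod_(j < n) derI T (iter j T x).
Proof.
elim: n x => [|n IH] x Ix.
  move=> _; rewrite big_ord0; have PF := Ihalf_dnbhs_proper Ix.
  apply: cvg_near_cst; apply: near_Ihalf_dnbhs; apply: filterS filterT => y _ yx _.
  by apply/eqP; rewrite /slope/= divff// subr_eq0.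
move=> /avoidsS[xO aTx]; rewrite big_ord_recl/=.
have PF := Ihalf_dnbhs_proper Ix.
under eq_bigr do rewrite -iterS iterSr.
rewrite mulrC.
have h1 := IH _ (T_Ihalf Ix) aTx.
have h2 := cvg_comp _ _ (cvg_T_within Ix xO) h1.
apply: cvg_trans (cvgM h2 (cvg_slope Ix xO)).
apply: near_eq_cvg.
apply: near_Ihalf_dnbhs; have := nbhs_branch (exists_branch Ix xO).
apply: filterS => y hb yx Iy.
have Tyx : T y != T x.
  apply: contra yx => /eqP Tyx; apply/eqP.
  exact: (T_inj (hb Iy) (exists_branch Ix xO)).
rewrite /slope [LHS]/= -!iterSr mulrA divfK//.
by rewrite subr_eq0.
Qed.

Lemma derI_iter n x : Ihalf x -> avoids T O n x ->
  derI (iter n T) x = \prod_(j < n) derI T (iter j T x).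
Proof.
move=> Ix ax; have PF := Ihalf_dnbhs_proper Ix.
by apply: cvg_lim => //; exact: cvg_slope_iter.
Qed.

Section Expanding.
Variables (C theta : R).
Hypotheses (C0 : 0 < C) (th1 : 1 < theta) (eT : expanding C theta T O).

(** By the chain rule this is the inverse of the derivative of [T^n] at [x]. *)
Definition wgt n x : R := \prod_(j < n) (derI T (iter j T x))^-1.

Lemma wgt0 x : wgt 0 x = 1.
Proof. by rewrite /wgt big_ord0. Qed.

Lemma wgtD n m x : wgt (n + m) x = wgt n x * wgt m (iter n T x).
Proof.
rewrite /wgt big_split_ord/=; congr (_ * _).
by apply: eq_bigr => j _; rewrite addnC iterD.
Qed.

Lemma wgt1 x : wgt 1 x = (derI T x)^-1.
Proof. by rewrite /wgt big_ord_recl big_ord0 mulr1. Qed.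

Lemma derI_gt0 x : Ihalf x -> x != O -> 0 < derI T x.
Proof.
move=> Ix xO; have th0 : 0 < theta by exact: lt_trans th1.
apply: (@lt_le_trans _ _ (C * theta ^+ 1)); first by rewrite expr1 mulr_gt0.
by apply: (@eT 1%N x Ix); case.
Qed.

Lemma wgt_le n x : Ihalf x -> avoids T O n x -> wgt n x <= C^-1 * theta ^- n.
Proof.
move=> Ix ax; rewrite /wgt prodfV -derI_iter// -invfM lef_pV2 ?eT ?posrE//.
  by apply: lt_le_trans (eT Ix ax); rewrite mulr_gt0// exprn_gt0// (lt_trans _ th1).
by rewrite mulr_gt0// exprn_gt0// (lt_trans _ th1).
Qed.

Lemma dinv_gt0 b x : branch b x -> 0 < (derI T x)^-1.
Proof.
by move=> bx; rewrite invr_gt0 derI_gt0 ?(branch_neq bx)//; exact: branch_Ihalf bx.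
Qed.

Lemma dinv_le b x : branch b x -> (derI T x)^-1 <= (C * theta)^-1.
Proof.
move=> bx; rewrite -wgt1 invfM -[X in _ / X]expr1 wgt_le//; first exact: branch_Ihalf bx.
by case=> // _; exact: branch_neq bx.
Qed.

Definition img b : set R := T @` branch b.

Lemma continuous_segment b u v : branch b u -> branch b v -> u <= v ->
  {within `[u, v], continuous T}.
Proof.
move=> bu bv uv; apply: continuous_T_within => x xuv.
apply: (@branch_setD b); apply: (branch_is_interval bu bv).
by move: xuv; rewrite /= in_itv.
Qed.

Lemma img_is_interval b : is_interval (img b).
Proof.
move=> _ _ [u bu <-] [v bv <-] c /andP[uc cv].
have uv : u <= v by rewrite -(T_le bu bv) (le_trans uc).
have [|x xuv <-] := @IVT _ T u v c uv (continuous_segment bu bv uv).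
  by rewrite ge_min uc le_max cv orbT.
exists x => //; apply: (branch_is_interval bu bv).
by move: xuv; rewrite in_itv/=.
Qed.

Definition invb_set b y : set R :=
  [set x | x = (if b then O else - 2^-1) \/ branch b x /\ T x <= y].

(** Defining the inverse of a branch by a supremum extends it to a monotone
    function on the whole line, hence to a measurable one; the left end of the
    branch in [invb_set] makes the set nonempty. *)
Definition invb b y : R := sup (invb_set b y).

Lemma invb_set_sup b y : has_sup (invb_set b y).
Proof.
have /andP[s1 s2] := sing_itv; split; first by eexists; left; reflexivity.
exists 2^-1 => x [->|[/branch_Ihalf + _]]; first by case: b; lra.
by rewrite /Ihalf/= in_itv/= => /andP[].
Qed.

Lemma invb_homo b : nondecreasing_fun (invb b).
Proof.
move=> y y' yy'; apply: le_sup; last first.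
- exact: invb_set_sup.
- by have [] := invb_set_sup b y.
move=> x [xl|[bx Tx]]; exists x; rewrite lexx; split => //; first by left.
by right; split=> //; exact: le_trans yy'.
Qed.

Lemma invbK b x : branch b x -> invb b (T x) = x.
Proof.
move=> bx; apply/eqP; rewrite eq_le; apply/andP; split.
  apply: ge_sup; first by have [] := invb_set_sup b (T x).
  move=> x' [->|[bx' ]]; last by rewrite (T_le bx' bx).
  have /andP[s1 s2] := sing_itv.
  move: bx => /branchP[]; rewrite /Ihalf/= in_itv/= => /andP[h1 h2].
  by case: b => h; lra.
by apply: sup_ubound; [have [] := invb_set_sup b (T x)|right].
Qed.

Lemma invb_branch b y : img b y -> branch b (invb b y).
Proof. by move=> [x bx <-]; rewrite invbK. Qed.

Lemma T_invb b y : img b y -> T (invb b y) = y.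
Proof. by move=> [x bx <-]; rewrite invbK. Qed.

Lemma invb_lt b y y' : img b y -> img b y' -> (invb b y < invb b y') = (y < y').
Proof.
by move=> iy iy'; rewrite -(T_lt (invb_branch iy) (invb_branch iy')) !T_invb.
Qed.

Lemma measurable_branch b : measurable (branch b).
Proof. apply: is_interval_measurable; exact: branch_is_interval. Qed.

Lemma measurable_img b : measurable (img b).
Proof. apply: is_interval_measurable; exact: img_is_interval. Qed.

Lemma measurable_invb b : measurable_fun setT (invb b).
Proof. by apply: nondecreasing_measurable => //; exact: invb_homo. Qed.

Lemma measurable_T_branch b : measurable_fun (branch b) T.
Proof.
apply: subspace_continuous_measurable_fun; first exact: measurable_branch.
exact/continuous_T_within/branch_setD.
Qed.

Lemma Ihalf_branches : Ihalf = branch false `|` branch true `|` [set O].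
Proof.
apply/seteqP; split => x.
  move=> Ix; have [->|/(exists_branch Ix)] := eqVneq x O; first by right.
  by case: (O < x) => h; left; [right|left].
by move=> [[|]/branch_Ihalf//|->]; rewrite /Ihalf/= in_itv/=;
  have /andP[s1 s2] := sing_itv; apply/andP; split; lra.
Qed.

Lemma measurable_T : measurable_fun (@Ihalf R) T.
Proof.
rewrite Ihalf_branches; apply/measurable_funU => //.
  by apply: measurableU; exact: measurable_branch.
split; last exact: measurable_fun_set1.
by apply/measurable_funU; try exact: measurable_branch; split; exact: measurable_T_branch.
Qed.

Lemma continuous_dinv b : {within branch b, continuous (fun x => (derI T x)^-1)}.
Proof.
apply/subspace_continuousP => x bx.
have [_ ] := lm_C1 lT => /(continuous_subspaceW (@branch_setD b)).
move=> /subspace_continuousP/(_ x bx) h.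
apply: cvgV => //; rewrite gt_eqF// derI_gt0//; last exact: branch_neq bx.
exact: branch_Ihalf bx.
Qed.

(** * The transfer operator and its action on weighted pairs *)

(** The weight [1/T'] of the transfer operator, read at the image point, and zero
    at points without a preimage in the branch. *)
Definition winv b : R -> R := (fun y => (derI T (invb b y))^-1) \_ (img b).

Lemma measurable_winv b : measurable_fun setT (winv b).
Proof.
apply/(measurable_restrict _ _ _) => //; first exact: measurable_img.
rewrite setTI.
apply: (@measurable_comp _ _ _ _ _ _ (branch b) (fun x => (derI T x)^-1)).
- exact: measurable_branch.
- by move=> _ [y iy <-]; exact: invb_branch.
- apply: subspace_continuous_measurable_fun; first exact: measurable_branch.
  exact: continuous_dinv.
- exact: measurable_funTS (measurable_invb b).
Qed.

Let G := (C * theta)^-1.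

Let G0 : 0 < G.
Proof. by rewrite invr_gt0 mulr_gt0// (lt_trans _ th1). Qed.

Lemma winvE b y : img b y -> winv b y = (derI T (invb b y))^-1.
Proof. by move=> iy; rewrite /winv patchE mem_set. Qed.

Lemma winv_out b y : ~ img b y -> winv b y = 0.
Proof. by move=> iy; rewrite /winv patchE memNset. Qed.

Lemma winv_ge0 b y : 0 <= winv b y.
Proof.
have [iy|iy] := pselect (img b y); last by rewrite winv_out.
by rewrite winvE// ltW// (dinv_gt0 (invb_branch iy)).
Qed.

Lemma winv_le b y : winv b y <= G.
Proof.
have [iy|iy] := pselect (img b y); last by rewrite winv_out// ltW.
by rewrite winvE// (dinv_le (invb_branch iy)).
Qed.

Lemma winv_wgt b n y : img b y -> wgt n.+1 (invb b y) = winv b y * wgt n y.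
Proof. by move=> iy; rewrite -[n.+1]add1n wgtD wgt1 winvE//= (T_invb iy). Qed.

Definition transfer (f : R -> R) (y : R) : R :=
  \sum_(b : bool) winv b y * f (invb b y).

(** The density of the image under [T^n] of Lebesgue measure on the interval. *)
Definition dens n : R -> R := iter n transfer (cst 1).

Lemma densS n : dens n.+1 = transfer (dens n).
Proof. by []. Qed.

Lemma transfer_ge0 f : (forall x, 0 <= f x) -> forall y, 0 <= transfer f y.
Proof. by move=> f0 y; apply: sumr_ge0 => b _; rewrite mulr_ge0 ?winv_ge0. Qed.

Lemma dens_ge0 n y : 0 <= dens n y.
Proof. by elim: n y => [|n IH] y; [exact: ler01|exact: transfer_ge0]. Qed.

Lemma measurable_transfer f : measurable_fun setT f -> measurable_fun setT (transfer f).
Proof.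
move=> mf; apply: measurable_sum => b; apply: measurable_funM.
  exact: measurable_winv.
exact: measurableT_comp mf (measurable_invb _).
Qed.

Lemma measurable_dens n : measurable_fun setT (dens n).
Proof. by elim: n => [|n IH]; [exact: measurable_cst|exact: measurable_transfer]. Qed.

(** A first exponential bound, with which [dens_uniform_bound] starts. *)
Lemma dens_crude n y : dens n y <= (2 * G) ^+ n.
Proof.
elim: n y => [|n IH] y; first by rewrite expr0.
rewrite densS /transfer big_bool exprS -mulrA mulr_natl mulr2n.
by apply: lerD; apply: ler_pM; rewrite ?winv_ge0 ?dens_ge0 ?winv_le.
Qed.

Implicit Types (t : R * R * R) (c : seq (R * R * R)).

Definition pullable b t : bool := (t.1.2 \in img b) && (t.2 \in img b).

(** A pair survives only if both points have a preimage in the branch; the weight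
    is multiplied by [1/T'] at the first point. *)
Definition pull b c := [seq (t.1.1 * winv b t.1.2, invb b t.1.2, invb b t.2) |
  t <- c & pullable b t].

Definition step c := pull false c ++ pull true c.

Definition admissible_pairs c := pairwise below c /\
  forall t, t \in c -> [/\ 0 <= t.1.1, Ihalf t.1.2 & Ihalf t.2].

Lemma pullableP b t : reflect (img b t.1.2 /\ img b t.2) (pullable b t).
Proof.
by apply: (iffP andP) => -[]; rewrite ?inE => h1 h2; split; rewrite ?inE.
Qed.

Lemma mem_pull b c u : u \in pull b c -> exists t,
  [/\ t \in c, img b t.1.2, img b t.2 &
      u = (t.1.1 * winv b t.1.2, invb b t.1.2, invb b t.2)].
Proof.
by move=> /mapP[t]; rewrite mem_filter => /andP[/pullableP[h1 h2] tc] ->; exists t.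
Qed.

Lemma mem_step c u : u \in step c -> exists b t,
  [/\ t \in c, img b t.1.2, img b t.2 &
      u = (t.1.1 * winv b t.1.2, invb b t.1.2, invb b t.2)].
Proof.
by rewrite mem_cat => /orP[] /mem_pull[t h]; [exists false, t|exists true, t].
Qed.

Lemma pull_below b c : pairwise below c -> pairwise below (pull b c).
Proof.
move=> pc; rewrite pairwise_map.
have := pairwise_filter (pullable b) pc.
have : all (pullable b) [seq t <- c | pullable b t] by exact: filter_all.
elim: [seq t <- c | pullable b t] => //= t s IH /andP[/pullableP[t1 t2] /[dup] /allP sb /IH{}IH].
move=> /andP[/allP ts /IH ->]; rewrite andbT; apply/allP => u us.
have /belowP[? ? ? ?] := ts _ us.
have /pullableP[u1 u2] := sb _ us.
by apply/belowP; rewrite /= !invb_lt.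
Qed.

(** Monotone inverse branches keep the order within a branch, and the left
    branch lies to the left of the right one: this is why [step] lists the left
    branch first. *)
Lemma step_admissible c : admissible_pairs c -> admissible_pairs (step c).
Proof.
move=> [pc wc]; split.
  rewrite pairwise_cat !pull_below// !andbT.
  apply/allrelP => t u /mem_pull[t' [_ t1 t2 ->]] /mem_pull[u' [_ u1 u2 ->]].
  move: (branch_side (invb_branch t1)) (branch_side (invb_branch t2)).
  move: (branch_side (invb_branch u1)) (branch_side (invb_branch u2)) => ? ? ? ?.
  by apply/belowP; split => /=; apply: (@lt_trans _ _ O).
move=> _ /mem_step[b [t [/wc[w0 _ _] h1 h2 ->]]]; split => /=.
- by rewrite mulr_ge0// winv_ge0.
- exact: branch_Ihalf (invb_branch h1).
- exact: branch_Ihalf (invb_branch h2).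
Qed.

Definition wsum c (f : R -> R) : R := \sum_(t <- c) t.1.1 * f t.1.2.

(** The quantity under study: a weighted sum of the oscillations of [f]. *)
Definition wdiff c (f : R -> R) : R := \sum_(t <- c) t.1.1 * (f t.1.2 - f t.2).

Lemma wsum_pull b c f : wsum (pull b c) f =
  \sum_(t <- c | pullable b t) t.1.1 * (winv b t.1.2 * f (invb b t.1.2)).
Proof.
rewrite /wsum big_map big_filter; apply: eq_bigr => t _ /=.
by rewrite mulrA.
Qed.

Lemma wsum_transfer c f : wsum c (transfer f) =
  \sum_(b : bool) \sum_(t <- c) t.1.1 * (winv b t.1.2 * f (invb b t.1.2)).
Proof.
by rewrite exchange_big; apply: eq_bigr => t _; rewrite /transfer mulr_sumr.
Qed.

Lemma wsum_step c f : wsum (step c) f = \sum_(b : bool) wsum (pull b c) f.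
Proof. by rewrite big_bool /= /wsum big_cat addrC. Qed.

Lemma wsum_step_le c f : (forall x, 0 <= f x) -> admissible_pairs c ->
  wsum (step c) f <= wsum c (transfer f).
Proof.
move=> f0 [_ wc]; rewrite wsum_step wsum_transfer; apply: ler_sum => b _.
rewrite wsum_pull big_mkcond/= big_seq [leRHS]big_seq; apply: ler_sum => t /wc[w0 _ _].
by case: ifP => // _; rewrite !mulr_ge0// winv_ge0.
Qed.

Lemma wsum_step_diag c f : (forall t, t \in c -> t.1.2 = t.2) ->
  wsum (step c) f = wsum c (transfer f).
Proof.
move=> dc; rewrite wsum_step wsum_transfer; apply: eq_bigr => b _.
rewrite wsum_pull big_mkcond/= big_seq [RHS]big_seq; apply: eq_bigr => t /dc dt.
case: ifPn => // /pullableP h; rewrite winv_out ?mul0r ?mulr0// => i.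
by apply: h; rewrite -dt.
Qed.

Section OneStep.
Variables (P : nat) (V : R).
Hypotheses (P0 : (0 < P)%N).
Hypothesis gV : forall b c, pairwise below c ->
  (forall t, t \in c -> branch b t.1.2 /\ branch b t.2) ->
  \sum_(t <- c) `|(derI T t.1.2)^-1 - (derI T t.2)^-1| ^+ P <= V.

(** The error of one pull-back for weights at most [s] of sum at most [t] and a
    threshold [tau]: the variation of [1/T'] on the two branches, then the pairs
    that straddle an end of the image of a branch, of which there are at most four. *)
Definition loss (tau s t : R) : R :=
  2 * (tau * t + s * V / tau ^+ P.-1) + 4 * G * s.

(** The contribution of one branch.  On a pair that pulls back, separate the
    oscillation of [f] from that of the weight; a pair of which only the first
    point has a preimage is counted by [size_crossing_pairs]; if only the second
    point has one, the term is nonpositive. *)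
Lemma wdiff_branch b c (f : R -> R) (M tau s u0 : R) :
  admissible_pairs c -> (forall x, 0 <= f x) -> (forall x, Ihalf x -> f x <= M) ->
  (forall t, t \in c -> t.1.1 <= s) -> wsum c (cst 1) <= u0 -> 0 < tau -> 0 <= s ->
  \sum_(t <- c) t.1.1 * (winv b t.1.2 * f (invb b t.1.2) - winv b t.2 * f (invb b t.2))
  <= wdiff (pull b c) f + M * (tau * u0 + s * V / tau ^+ P.-1 + 2 * G * s).
Proof.
move=> [pc wc] f0 fM ws wt tau0 s0.
have I0 : @Ihalf R 0 by rewrite /Ihalf/= in_itv/=; apply/andP; split; lra.
have M0 : 0 <= M by exact: le_trans (f0 0) (fM _ I0).
pose crossing t := (t.1.2 \in img b) && (t.2 \notin img b).
pose D t : R := `|winv b t.1.2 - winv b t.2|.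
have H t : t \in c ->
  t.1.1 * (winv b t.1.2 * f (invb b t.1.2) - winv b t.2 * f (invb b t.2)) <=
  (if pullable b t then t.1.1 * winv b t.1.2 * (f (invb b t.1.2) - f (invb b t.2)) else 0)
  + (M * (tau * t.1.1) + M * (s / tau ^+ P.-1) * (if pullable b t then D t ^+ P else 0))
  + (if crossing t then M * G * s else 0).
  move=> tc; have [w0 I1 I2] := wc _ tc; have wts := ws _ tc.
  have mt : 0 <= M * (tau * t.1.1) by rewrite !mulr_ge0// ltW.
  rewrite /crossing /pullable; case: (boolP (t.1.2 \in img b)) => [|] i1; last first.
    rewrite /= winv_out; last by move=> h; move/negP: i1; apply; exact: mem_set.
    rewrite mul0r sub0r mulrN addr0 add0r mulr0 addr0 (le_trans _ mt)//.
    by rewrite oppr_le0 !mulr_ge0// winv_ge0.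
  case: (boolP (t.2 \in img b)) => [|] i2 /=; last first.
    rewrite add0r mulr0 addr0 (winv_out (y := t.2)); last first.
      by move=> h; move/negP: i2; apply; exact: mem_set.
    rewrite mul0r subr0 -[leLHS]add0r; apply: lerD => //.
    have fb : f (invb b t.1.2) <= M.
      by apply: fM; apply: branch_Ihalf (invb_branch _); rewrite inE in i1.
    rewrite (_ : M * G * s = s * (G * M)); last by ring.
    apply: ler_pM => //; first by rewrite mulr_ge0// winv_ge0.
    by apply: ler_pM => //; rewrite ?winv_ge0 ?winv_le.
  rewrite addr0 -/(D t).
  have fb : f (invb b t.2) <= M.
    by apply: fM; apply: branch_Ihalf (invb_branch _); rewrite inE in i2.
  have d1 : D t <= tau + D t ^+ P / tau ^+ P.-1 by apply: le_threshold => //; exact: normr_ge0.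
  have -> : t.1.1 * (winv b t.1.2 * f (invb b t.1.2) - winv b t.2 * f (invb b t.2)) =
    t.1.1 * winv b t.1.2 * (f (invb b t.1.2) - f (invb b t.2)) +
    t.1.1 * ((winv b t.1.2 - winv b t.2) * f (invb b t.2)) by ring.
  rewrite lerD2l.
  have a1 : (winv b t.1.2 - winv b t.2) * f (invb b t.2) <= D t * M.
    by rewrite (le_trans (ler_norm _))// normrM (ger0_norm (f0 _)) ler_wpM2l.
  have D0 : 0 <= D t by exact: normr_ge0.
  apply: (le_trans (ler_wpM2l w0 a1)).
  rewrite (_ : _ * (D t * M) = M * (t.1.1 * D t)); last by ring.
  rewrite -[M * (s / _) * _]mulrA -mulrDr ler_wpM2l//.
  apply: (le_trans (ler_wpM2l w0 d1)); rewrite mulrDr [tau * _]mulrC lerD2l.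
  rewrite -[s / _ * _]mulrA [_^-1 * _]mulrC; apply: ler_pM => //.
  by rewrite divr_ge0 ?exprn_ge0 ?(ltW tau0).
rewrite big_seq; apply: le_trans (ler_sum _ H) _; rewrite -big_seq.
rewrite !big_split/= -!big_mkcond/=.
have -> : wdiff (pull b c) f = \sum_(t <- c | pullable b t)
    t.1.1 * winv b t.1.2 * (f (invb b t.1.2) - f (invb b t.2)).
  by rewrite /wdiff big_map big_filter.
rewrite -addrA lerD2l.
have s1 : \sum_(t <- c) M * (tau * t.1.1) <= M * (tau * u0).
  rewrite -!mulr_sumr ler_wpM2l// ler_wpM2l ?(ltW tau0)//.
  by apply: le_trans wt; rewrite /wsum; apply: ler_sum => t _; rewrite mulr1.
have s2 : \sum_(t <- c) M * (s / tau ^+ P.-1) * (if pullable b t then D t ^+ P else 0)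
    <= M * (s * V / tau ^+ P.-1).
  have -> : M * (s * V / tau ^+ P.-1) = M * (s / tau ^+ P.-1) * V.
    by ring.
  rewrite -mulr_sumr ler_wpM2l//.
    by rewrite mulr_ge0// divr_ge0// exprn_ge0 ?ltW.
  rewrite -big_mkcond/=.
  have := gV (b := b) (pull_below b pc).
  rewrite big_map big_filter/= => h; apply: le_trans (h _).
    apply/eq_ler/eq_bigr => t /pullableP[h1 h2].
    by rewrite /D !winvE.
  move=> _ /mem_pull[t [_ h1 h2 ->]] /=.
  by split; apply: invb_branch _.
have s3 : \sum_(t <- c | crossing t) M * G * s <= M * (2 * G * s).
  rewrite big_const_seq iter_addr_0 -!mulrA -[leLHS]mulrnAr ler_wpM2l//.
  rewrite -[leLHS]mulr_natl.
  rewrite ler_wpM2r//; first by rewrite mulr_ge0// ltW.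
  rewrite ler_nat -size_filter; apply: (@size_crossing_pairs _ (img b)).
  - exact: img_is_interval.
  - exact: pairwise_filter.
  - move=> t; rewrite mem_filter => /andP[/andP[h1 /negP h2] _]; split.
      by rewrite inE in h1.
    by move=> h; apply: h2; exact: mem_set.
by rewrite !mulrDr; apply: lerD => //; exact: lerD.
Qed.

Lemma wdiff_step c (f : R -> R) (M tau s u0 : R) :
  admissible_pairs c -> (forall x, 0 <= f x) -> (forall x, Ihalf x -> f x <= M) ->
  (forall t, t \in c -> t.1.1 <= s) -> wsum c (cst 1) <= u0 -> 0 < tau -> 0 <= s ->
  wdiff c (transfer f) <= wdiff (step c) f + M * loss tau s u0.
Proof.
move=> ac f0 fM ws wt tau0 s0.
have -> : wdiff c (transfer f) = \sum_(b : bool) \sum_(t <- c) t.1.1 *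
    (winv b t.1.2 * f (invb b t.1.2) - winv b t.2 * f (invb b t.2)).
  rewrite exchange_big; apply: eq_bigr => t _ /=.
  by rewrite /transfer -sumrB mulr_sumr.
rewrite big_bool/=; have h b := wdiff_branch b ac f0 fM ws wt tau0 s0.
apply: (le_trans (lerD (h true) (h false))).
rewrite /wdiff /step big_cat /loss/=; apply/eq_ler; ring.
Qed.

(** Iterating [wdiff_step] down to [dens 0 = 1], which has no oscillation, leaves
    only the losses.  The bounds are indexed by the level: at level [j] the weights
    are at most [s j] because the accumulated factor is [wgt j], and their sum is at
    most [u j] because it is [L^j] of the weights, evaluated through [dens j]. *)
Lemma wdiff_dens m c (tau s u M : nat -> R) :
  admissible_pairs c -> (forall j, 0 < tau j) -> (forall j, 0 <= s j) ->
  (forall j t x, t \in c -> Ihalf x -> avoids T O j x -> iter j T x = t.1.2 ->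
     t.1.1 * wgt j x <= s j) ->
  (forall j, wsum c (dens j) <= u j) ->
  (forall k x, (k < m)%N -> Ihalf x -> dens k x <= M k) ->
  wdiff c (dens m) <= \sum_(j < m) M (m - j.+1)%N * loss (tau j) (s j) (u j).
Proof.
elim: m c tau s u => [|m IH] c tau s u ac tau0 s0 ws wu dM.
  by rewrite big_ord0 /wdiff big1// => t _; rewrite /dens/= /cst subrr mulr0.
have w0 t : t \in c -> t.1.1 <= s 0%N.
  move=> tc; have [_ Hc] := ac; have [_ I1 _] := Hc t tc.
  by have := ws 0%N t t.1.2 tc I1; rewrite wgt0 mulr1; apply.
rewrite densS; apply: (le_trans (wdiff_step ac (dens_ge0 m) _ w0 (wu 0%N)
  (tau0 0%N) (s0 0%N))); first by move=> x; exact: dM.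
rewrite big_ord_recl subn1/= addrC lerD2l.
apply: (IH (step c) (tau \o succn) (s \o succn) (u \o succn)) => //=.
- exact: step_admissible.
- move=> j t x /mem_step[b [t' [t'c h1 h2 ->]]] /= Ix ax xE.
  have := ws j.+1 t' x t'c Ix.
  rewrite -addn1 wgtD wgt1 xE -winvE// addn1 iterS xE T_invb//.
  rewrite [wgt j x * _]mulrC mulrA; apply => //.
  rewrite -addn1; apply/avoidsD; split=> //; case=> // _.
  by rewrite /= xE; apply: branch_neq (invb_branch h1).
- move=> j; apply: le_trans (wu j.+1); rewrite densS.
  by apply: wsum_step_le => //; exact: dens_ge0.
- by move=> k x km; apply: dM; rewrite ltnS ltnW.
Qed.

End OneStep.

(** * Itineraries and preimages *)

(** The element of the [n]-th refinement that contains [z], by recursion along the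
    itinerary of [z]; the case [n = 0] is the whole interval. *)
Fixpoint cyl n (z : R) : set R :=
  if n is n'.+1 then
    [set x | branch (O < z) x /\ cyl n' (T z) (T x)]
  else Ihalf.

(** Lexicographic order of itineraries.  As the branches are increasing, it is
    the order of the points ([itin_lt_lt]), and it depends only on the cylinders
    ([itin_lt_cyl]). *)
Fixpoint itin_lt n (x u : R) : bool :=
  if n is n'.+1 then
    (~~ (O < x) && (O < u)) || ((O < x) == (O < u)) && itin_lt n' (T x) (T u)
  else false.

Lemma cyl_Ihalf n z x : cyl n z x -> Ihalf x.
Proof. by case: n => // n [/branch_Ihalf]. Qed.

Lemma cyl_avoids n z x : cyl n z x -> avoids T O n x.
Proof.
elim: n z x => // n IH z x [/branch_neq xO /IH h].
by apply/avoidsS.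
Qed.

Lemma cyl_refl n z : Ihalf z -> avoids T O n z -> cyl n z z.
Proof.
elim: n z => // n IH z Iz /avoidsS[zO aTz]; split; first exact: exists_branch.
exact/IH/aTz/T_Ihalf.
Qed.

Lemma cyl_is_interval n z : is_interval (cyl n z).
Proof.
elim: n z => [|n IH] z; first exact: interval_is_interval.
move=> x y [bx cx] [bY cy] v /andP[xv vy].
have bv : branch (O < z) v by apply: (branch_is_interval bx bY); rewrite xv.
by split => //; apply: (IH _ _ _ cx cy); rewrite (T_le bx bv) (T_le bv bY) xv.
Qed.

Lemma itin_lt_cyl n x u x' u' : itin_lt n x u -> cyl n x x' -> cyl n u u' ->
  itin_lt n x' u'.
Proof.
elim: n x u x' u' => // n IH x u x' u' /= h [bx cx] [bu cu].
rewrite (branch_ltP bx) (branch_ltP bu); case/orP: h => [->//|].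
by move=> /andP[-> h]; rewrite (IH _ _ _ _ h)// orbT.
Qed.

Lemma itin_lt_lt n x u : Ihalf x -> avoids T O n x -> Ihalf u -> avoids T O n u ->
  itin_lt n x u -> x < u.
Proof.
elim: n x u => // n IH x u Ix /avoidsS[xO ax] Iu /avoidsS[uO au] /=.
case/orP => [/andP[]|/andP[/eqP xu h]].
  by rewrite -leNgt => xO' Ou; exact: le_lt_trans Ou.
have bx := exists_branch Ix xO; have := exists_branch Iu uO.
rewrite -xu => bu; rewrite -(T_lt bx bu).
by apply: IH => //; exact: T_Ihalf.
Qed.

Lemma cylE n z x : cyl n z x <-> Ihalf x /\
  forall j, (j < n)%N -> branch (O < iter j T z) (iter j T x).
Proof.
elim: n z x => [|n IH] z x; first by split => [?|[]].
split => [[bx /IH[_ h]]|[Ix h]].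
  split => [|[|j] jn]; [exact: branch_Ihalf bx|exact: bx|].
  by rewrite !iterSr; exact: h.
split; first exact: (h 0%N).
by apply/IH; split => [|j jn]; [exact: T_Ihalf|rewrite -!iterSr; exact: h].
Qed.

Lemma cyl_refinement n z : (0 < n)%N -> Ihalf z -> avoids T O n z ->
  refinement T (branches O) n (cyl n z).
Proof.
move=> n0 Iz az; split; first by exists z; exact: cyl_refl.
exists (fun j => branch (O < iter j T z)); first by move=> j _; exact: branches_branch.
apply/seteqP; split => x; first by move=> /cylE[_ h] j /= jn; exact: h.
by move=> h; apply/cylE; split => [|j jn];
  [exact: branch_Ihalf (h 0%N n0)|exact: (h j jn)].
Qed.

(** Pulling back the pair [(y, y)] enumerates the preimages [x] of [y] under [T^n]
    as pairs [(x, x)], from left to right and with weights [wgt n x]. *)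
Definition preims n (y : R) := iter n step [:: (1, y, y)].

Lemma preimsP n y t : t \in preims n y -> Ihalf y ->
  [/\ t.1.2 = t.2, t.1.1 = wgt n t.1.2, Ihalf t.1.2, avoids T O n t.1.2 &
      iter n T t.1.2 = y].
Proof.
move=> + Iy; elim: n t => [|n IH] t /=.
  by rewrite inE => /eqP->; split => //=; rewrite wgt0.
move=> /mem_step[b [t' [/IH[h1 h2 h3 h4 h5] i1 i2 ->]]]; split => /=.
- by rewrite h1.
- by rewrite winv_wgt// h2 mulrC.
- exact: branch_Ihalf (invb_branch i1).
- by apply/avoidsS; rewrite T_invb//; split => //; exact: branch_neq (invb_branch i1).
- by rewrite -iterS iterSr T_invb.
Qed.

Lemma preims_admissible n y : Ihalf y -> admissible_pairs (preims n y).
Proof.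
move=> Iy; elim: n => [|n IH]; last exact: step_admissible.
by split=> // t; rewrite inE => /eqP->; split => //=.
Qed.

Lemma wsum_preims n y f : Ihalf y -> wsum (preims n y) f = iter n transfer f y.
Proof.
move=> Iy; elim: n f => [|n IH] f; first by rewrite /wsum big_seq1/= mul1r.
rewrite /preims iterS wsum_step_diag; last by move=> t /preimsP-/(_ Iy)[].
by rewrite IH -iterSr.
Qed.

Lemma preims_sorted n y : Ihalf y ->
  pairwise (fun t t' => itin_lt n t.1.2 t'.1.2) (preims n y).
Proof.
move=> Iy; elim: n => // n IH; rewrite /preims iterS -/(preims n y) /step.
have H b : pairwise (fun t t' => itin_lt n.+1 t.1.2 t'.1.2) (pull b (preims n y)).
  rewrite pairwise_map; have := pairwise_filter (pullable b) IH.
  have : all (pullable b) [seq t <- preims n y | pullable b t] by exact: filter_all.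
  elim: [seq t <- _ | _] => // t s IHs /=.
  move=> /andP[/pullableP[t1 t2] /[dup] /allP sb /IHs{}IHs].
  move=> /andP[/allP ts /IHs ->]; rewrite andbT; apply/allP => u us /=.
  have /pullableP[u1 u2] := sb _ us.
  rewrite (branch_ltP (invb_branch t1)) (branch_ltP (invb_branch u1)) eqxx.
  by rewrite !T_invb// ts ?orbT.
rewrite pairwise_cat !H !andbT; apply/allrelP => t u.
move=> /mem_pull[t' [_ t1 t2 ->]] /mem_pull[u' [_ u1 u2 ->]] /=.
by rewrite (branch_ltP (invb_branch t1)) (branch_ltP (invb_branch u1)).
Qed.

Section Companions.
Variables (n : nat) (y : R) (comp : R -> R).
Hypotheses (Iy : Ihalf y).
Hypothesis compP : forall z, Ihalf z -> avoids T O n z -> cyl n z (comp z).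

(** Each preimage is paired with a companion in its [n]-cylinder.  The cylinders
    of distinct preimages are disjoint intervals, so the pairs are admissible. *)
Definition with_comp := [seq (t.1.1, t.1.2, comp t.1.2) | t <- preims n y].

Lemma with_comp_admissible : admissible_pairs with_comp.
Proof.
have [_ ap] := preims_admissible n Iy.
split; last first.
  move=> _ /mapP[t tp ->] /=; have [w0 I1 _] := ap _ tp; split => //.
  have [_ _ Iz az _] := preimsP tp Iy; exact: cyl_Ihalf (compP Iz az).
rewrite /with_comp pairwise_map.
apply: (sub_in_pairwise _ (allss (preims n y)) (preims_sorted n Iy)) => t u tp up /= tu.
have [_ _ It at_ _] := preimsP tp Iy.
have [_ _ Iu au _] := preimsP up Iy.
have ct := compP It at_; have cu := compP Iu au.
have rt := cyl_refl It at_; have ru := cyl_refl Iu au.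
have h x x' : cyl n t.1.2 x -> cyl n u.1.2 x' -> x < x'.
  move=> cx cx'; apply: (@itin_lt_lt n); rewrite ?(itin_lt_cyl tu cx cx')//.
  - exact: cyl_Ihalf cx.
  - exact: cyl_avoids cx.
  - exact: cyl_Ihalf cx'.
  - exact: cyl_avoids cx'.
by apply/belowP; split; apply: h.
Qed.

Lemma wsum_with_comp f : wsum with_comp f = iter n transfer f y.
Proof. by rewrite -wsum_preims// /wsum /with_comp big_map. Qed.

End Companions.

(** * Duality between the transfer operator and the map *)

Local Notation mu := (@lebesgue_measure R).

(** Open interior of a branch, on which [T] has a two-sided derivative: the branch
    itself contains an end of the interval. *)
Definition lo (b : bool) : R := if b then O else - 2^-1.
Definition hi (b : bool) : R := if b then 2^-1 else O.

Lemma lo_lt_hi b : lo b < hi b.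
Proof. by have /andP[s1 s2] := sing_itv; case: b. Qed.

Lemma branch_oo b x : lo b < x < hi b -> branch b x.
Proof.
have /andP[s1 s2] := sing_itv; case: b; rewrite /lo /hi => /andP[h1 h2];
  by apply/branchP; rewrite /Ihalf/= in_itv/=; split => //; apply/andP; split; lra.
Qed.

Lemma near_oo b x : lo b < x < hi b -> \forall y \near x, lo b < y < hi b.
Proof.
move=> /andP[h1 h2]; near=> y; apply/andP; split; near: y.
  exact: lt_nbhsr.
exact: lt_nbhsl.
Unshelve. all: by end_near. Qed.

Lemma is_derive_T b x : lo b < x < hi b -> is_derive x 1 T (derI T x).
Proof.
move=> xb; have bx := branch_oo xb.
have h : slope T x y @[y --> x^'] --> derI T x.
  move=> V /(cvg_slope (branch_Ihalf bx) (branch_neq bx))/dnbhs_Ihalf_near.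
  have := near_oo xb; apply: filterS2 => y /branch_oo/branch_Ihalf Iy hy yx.
  exact: hy.
have h' : h^-1 *: (T (h *: 1 + x) - T x) @[h --> (0 : R)^'] --> derI T x.
  have sh : (fun t : R => t *: 1 + x) @ 0^' --> x^'.
    move=> V; rewrite /= /dnbhs /within/= => /nbhs_ballP[e /= e0 H].
    apply/nbhs_ballP; exists e => //= t; rewrite /ball/= sub0r normrN => te t0.
    apply: H; last by rewrite scaler1 -subr_eq0 addrK.
    by rewrite /ball/= scaler1 opprD addrCA subrr addr0 normrN.
  apply: cvg_trans (cvg_comp _ _ sh h); apply: near_eq_cvg.
  near=> t; rewrite /slope /= scaler1 addrK mulrC; congr (_ * _).
by apply: DeriveDef; [apply/cvg_ex; exists (derI T x)|exact/cvg_lim/h'].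
Unshelve. all: by end_near. Qed.

Lemma continuous_derive1_T b x : lo b < x < hi b -> derive1 T @ x --> derive1 T x.
Proof.
move=> xb; have bx := branch_oo xb.
have e y : lo b < y < hi b -> derive1 T y = derI T y.
  by move=> yb; have ? := is_derive_T yb; rewrite derive1E derive_val.
rewrite e//; apply: (@cvg_trans _ (derI T @ x)).
  by apply: near_eq_cvg; near=> y; rewrite e//; near: y; exact: near_oo.
have [_ ] := lm_C1 lT => /(continuous_subspaceW (@branch_setD b)).
move=> /subspace_continuousP/(_ x bx) h V /h.
rewrite /= /nbhs/= /within/=; have := near_oo xb.
apply: filterS2 => y /branch_oo bY; exact.
Unshelve. all: by end_near. Qed.

Lemma continuous_T_oo b x : lo b < x < hi b -> T @ x --> T x.
Proof.
move=> xb; have ? := is_derive_T xb.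
exact/differentiable_continuous/derivable1_diffP.
Qed.

(** Substitution [y = T x]: the integrand becomes [(1/T') T' = 1].  The interval is
    compact in the open branch, away from the singularity where [T'] is infinite. *)
Lemma integral_winv_itv b (s t : R) : lo b < s -> s <= t -> t < hi b ->
  (\int[mu]_(y in `[T s, T t]) (winv b y)%:E = (t - s)%:E)%E.
Proof.
move=> ls st tr.
have inb x : x \in `[s, t] -> lo b < x < hi b.
  by rewrite in_itv/= => /andP[h1 h2]; apply/andP; split; lra.
have bs : branch b s by apply/branch_oo/inb; rewrite in_itv/= lexx.
have bt : branch b t by apply/branch_oo/inb; rewrite in_itv/= lexx andbT.
have subi y : y \in `[T s, T t] -> img b y.
  rewrite in_itv/= => yst; apply: (@img_is_interval b (T s) (T t)) => //.
    by exists s.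
  by exists t.
transitivity (\int[mu]_(y in `[T s, T t]) ((derI T (invb b y))^-1)%:E)%E.
  by apply: eq_integral => y; rewrite inE => /subi iy; rewrite winvE.
rewrite (integration_by_substitution_increasing (F := T)
  (G := fun y => (derI T (invb b y))^-1)) //; last 6 first.
- move=> x y /inb/branch_oo bx /inb/branch_oo bY; by rewrite (T_lt bx bY).
- move=> x; rewrite in_itv/= => /andP[h1 h2].
  by apply: (@continuous_derive1_T b); apply/inb; rewrite in_itv/= !ltW.
- apply: (cvgP (derive1 T s)); apply: cvg_at_right_filter.
  by apply: (@continuous_derive1_T b); apply/inb; rewrite in_itv/= lexx.
- apply: (cvgP (derive1 T t)); apply: cvg_at_left_filter.
  by apply: (@continuous_derive1_T b); apply/inb; rewrite in_itv/= lexx andbT.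
- split.
  + move=> x; rewrite in_itv/= => /andP[h1 h2].
    by have [] := @is_derive_T b x; rewrite ?inb// in_itv/= !ltW.
  + apply: cvg_at_right_filter; apply: (@continuous_T_oo b).
    by apply/inb; rewrite in_itv/= lexx.
  + apply: cvg_at_left_filter; apply: (@continuous_T_oo b).
    by apply/inb; rewrite in_itv/= lexx andbT.
- have ci : {within `[T s, T t], continuous (invb b)}.
    apply: segment_can_le_continuous => //; first exact: (continuous_segment bs bt).
    by move=> x /inb/branch_oo bx; rewrite invbK.
  apply/subspace_continuousP => y yst.
  have iy := subi _ yst.
  have /subspace_continuousP/(_ _ (invb_branch iy)) := continuous_dinv (b := b).
  apply: cvg_comp => V Vy.
  have /subspace_continuousP/(_ y yst)/(_ _ Vy) := ci.
  rewrite /= /nbhs/= /within/=; apply: filterS => z h zst.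
  by apply: (h zst); apply: invb_branch; exact: subi.
transitivity (\int[mu]_(x in `[s, t]) (cst 1%E x))%E.
  apply: eq_integral => x; rewrite inE => /= /inb xb; have bx := branch_oo xb.
  have ? := is_derive_T xb.
  rewrite /= fctE /= invbK// derive1E derive_val mulVf// gt_eqF//.
  by rewrite derI_gt0//; [exact: branch_Ihalf bx|exact: branch_neq bx].
transitivity (mu `[s, t]%classic); first by rewrite integral_cst// mul1e.
rewrite lebesgue_measure_itv/= lte_fin -EFinB.
by move: st; rewrite le_eqVlt => /predU1P[->|->//]; rewrite subrr ltxx.
Qed.

Lemma measurable_preimage_invb b (E : set R) : measurable E ->
  measurable (invb b @^-1` E).
Proof.
by move=> mE; rewrite -[_ @^-1` _]setTI; exact: (measurable_invb b measurableT).
Qed.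

(** Lebesgue measure transported to the branch by its inverse; it is shown to be
    Lebesgue measure on the branch ([branch_massE]). *)
Definition branch_mass b (E : set (measurableTypeR R)) : \bar R :=
  (\int[mu]_(y in invb b @^-1` E) (winv b y)%:E)%E.

Let branch_mass0 b : branch_mass b set0 = 0%E.
Proof. by rewrite /branch_mass preimage_set0 integral_set0. Qed.

Let branch_mass_ge0 b E : (0 <= branch_mass b E)%E.
Proof. by apply: integral_ge0 => y _; rewrite lee_fin winv_ge0. Qed.

Let branch_mass_sigma_additive b : semi_sigma_additive (branch_mass b).
Proof.
move=> F mF tF mUF; rewrite /branch_mass preimage_bigcup ge0_integral_bigcup//=.
- apply: is_cvg_ereal_nneg_natsum_cond => n _ _.
  by apply: integral_ge0 => y _; rewrite lee_fin winv_ge0.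
- by move=> n; apply: measurable_preimage_invb; exact: mF.
- by apply/measurable_EFinP; apply: measurable_funTS; exact: measurable_winv.
- by move=> y _; rewrite lee_fin winv_ge0.
- apply/trivIsetP => i j _ _ ij; rewrite -preimage_setI.
  by move/trivIsetP: tF => ->//; rewrite preimage_set0.
Qed.

HB.instance Definition _ b := isMeasure.Build _ _ _ (branch_mass b)
  (branch_mass0 b) (branch_mass_ge0 b) (@branch_mass_sigma_additive b).

Lemma branch_mass_img b E : measurable E -> branch_mass b E =
  (\int[mu]_(y in invb b @^-1` E `&` img b) (winv b y)%:E)%E.
Proof.
move=> mE; rewrite /branch_mass [RHS]integral_mkcondr; apply: eq_integral => y _.
by rewrite patchE; case: ifPn => // /negP iy; rewrite winv_out// => /mem_set.
Qed.

Lemma branch_mass_oo b E : measurable E -> branch_mass b (E `&` `]lo b, hi b[) = mu (E `&` `]lo b, hi b[).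
Proof.
move=> mE; apply: lebesgue_measure_unique_oo => //; first exact: lo_lt_hi.
move=> s t ls st tr; change (branch_mass b `]s, t]%classic = (t - s)%:E).
rewrite branch_mass_img//.
have bs : branch b s by apply: branch_oo; apply/andP; split; lra.
have bt : branch b t by apply: branch_oo; apply/andP; split; lra.
have -> : invb b @^-1` `]s, t] `&` img b = `]T s, T t]%classic.
  apply/seteqP; split => y /=; rewrite !in_itv/=.
    move=> [/andP[h1 h2] iy]; have bi := invb_branch iy.
    by rewrite -(T_invb iy) (T_lt bs bi) (T_le bi bt) h1.
  move=> /andP[h1 h2].
  have iy : img b y by apply: (@img_is_interval b (T s) (T t)); rewrite ?(ltW h1)//;
    [exists s|exists t].
  have bi := invb_branch iy; split => //.
  by rewrite -(T_lt bs bi) -(T_le bi bt) !T_invb// h1.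
have mw : measurable_fun `]T s, T t[ (EFin \o winv b).
  by apply/measurable_EFinP; apply: measurable_funTS; exact: measurable_winv.
by rewrite -(integral_winv_itv ls st tr) integral_itv_bndoo// [RHS]integral_itv_bndoo.
Qed.

Lemma branch_end b x : branch b x -> ~ `]lo b, hi b[%classic x ->
  x = if b then hi b else lo b.
Proof.
case: b; rewrite /branch /right_branch /left_branch /lo /hi /= !in_itv/=
  => /andP[h1 h2] H; apply/eqP; rewrite eq_le.
  by rewrite h2/= leNgt; apply/negP => h; apply: H; rewrite h1.
by rewrite h1 andbT leNgt; apply/negP => h; apply: H; rewrite h2 h.
Qed.

(** Inside the open branch this is [branch_mass_oo]; what remains is a single
    point, which neither measure charges. *)
Lemma branch_massE b E : measurable E -> branch_mass b E = mu (E `&` branch b).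
Proof.
move=> mE; set B := `]lo b, hi b[%classic.
have mB : measurable (B : set R) by exact: measurable_itv.
have mbr := measurable_branch b.
have -> : branch_mass b E = (branch_mass b (E `&` B) + branch_mass b (E `&` ~` B))%E.
  exact: (measure_splitI (branch_mass b) mE mB).
rewrite [RHS](measure_splitI _ (measurableI _ _ mE mbr) mB).
have -> : (E `&` branch b `&` B = E `&` B)%classic.
  apply/seteqP; split => x; first by move=> [[]].
  by move=> [Ex Bx]; split => //; split => //; apply: branch_oo; move: Bx;
    rewrite /B/= in_itv.
rewrite branch_mass_oo//; congr (_ + _)%E; transitivity (0 : \bar R).
  rewrite branch_mass_img; last exact: (measurableI _ _ mE (measurableC mB)).
  apply: (integral_Sset1 (T (if b then hi b else lo b))) => y [[_ nB] iy].
  by rewrite /= -(branch_end (invb_branch iy) nB) T_invb.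
apply/esym; apply: (@subset_measure0 _ _ _ mu _ [set (if b then hi b else lo b)]).
- exact: (measurableI _ _ (measurableI _ _ mE mbr) (measurableC mB)).
- exact: measurable_set1.
- by move=> x [[_ bx] nB]; rewrite /= -(branch_end bx nB).
- exact: lebesgue_measure_set1.
Qed.

Lemma integral_branch b (u : R -> R) : measurable_fun setT u -> (forall x, 0 <= u x) ->
  (\int[mu]_(y in setT) (winv b y * u (invb b y))%:E =
   \int[mu]_(x in branch b) (u x)%:E)%E.
Proof.
move=> mfu u0; apply: ge0_integral_weighted_comp => //.
- exact: measurable_winv.
- exact: winv_ge0.
- exact: measurable_invb.
- exact: measurable_branch.
move=> E mE; rewrite -branch_massE// /branch_mass [RHS]integral_mkcond; apply: eq_integral => y _.
rewrite patchE indicE; case: ifPn => [/set_mem yE|/negP yE].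
  by rewrite mem_set// mulr1.
by rewrite memNset ?mulr0// => /mem_set.
Qed.

Lemma measurable_preimage_T b A : measurable A -> measurable (branch b `&` T @^-1` A).
Proof. by move=> mA; exact: (measurable_T_branch (measurable_branch b)). Qed.

Lemma integral_winv_preimage b A (f : R -> R) : measurable A ->
  measurable_fun setT f -> (forall x, 0 <= f x) ->
  (\int[mu]_(y in A) (winv b y * f (invb b y))%:E =
   \int[mu]_(x in branch b `&` T @^-1` A) (f x)%:E)%E.
Proof.
move=> mA mf f0; pose D := branch b `&` T @^-1` A.
have mD : measurable D := measurable_preimage_T b mA.
pose u x := f x * \1_D x.
have mfu : measurable_fun setT u.
  by apply: measurable_funM => //; exact: measurable_indic.
have u0 x : 0 <= u x by rewrite mulr_ge0.
transitivity (\int[mu]_(y in setT) (winv b y * u (invb b y))%:E)%E.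
  rewrite integral_mkcond; apply: eq_integral => y _.
  rewrite patchE /u indicE; have [iy|iy] := pselect (img b y); last first.
    by rewrite winv_out// !mul0r; case: ifP.
  case: ifPn => [/set_mem yA|/negP yA].
    by rewrite mem_set ?mulr1//; split; [exact: invb_branch|rewrite /= T_invb].
  by rewrite memNset ?mulr0// => -[_]; rewrite /= T_invb// => /mem_set.
rewrite integral_branch// [RHS]integral_mkcondr; apply: eq_integral => x /set_mem bx.
rewrite patchE /u indicE; case: ifPn => [/set_mem xA|/negP xA].
  by rewrite mem_set ?mulr1.
by rewrite memNset ?mulr0// => -[_ /mem_set].
Qed.

(** Duality: the transfer operator transports densities by [T]. *)
Lemma integral_transfer A (f : R -> R) : measurable A ->
  measurable_fun setT f -> (forall x, 0 <= f x) ->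
  (\int[mu]_(y in A) (transfer f y)%:E =
   \int[mu]_(x in Ihalf `&` T @^-1` A) (f x)%:E)%E.
Proof.
move=> mA mf f0.
have mD b : measurable (branch b `&` T @^-1` A) := measurable_preimage_T b mA.
have mff (D : set R) : measurable_fun D (EFin \o f).
  by apply/measurable_EFinP; exact: measurable_funTS.
rewrite Ihalf_branches !setIUl.
have mU := measurableU _ _ (mD false) (mD true).
have mO : measurable ([set O] `&` T @^-1` A).
  have [h|h] := pselect (A (T O)).
    rewrite (_ : _ `&` _ = [set O]); first exact: measurable_set1.
    by apply/seteqP; split => x [] //= ->.
  rewrite (_ : _ `&` _ = set0); first exact: measurable0.
  by apply/seteqP; split => x [] //= ->.
rewrite (ge0_integral_setU mu mU mO)//; last 3 first.
- exact: mff.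
- by move=> x _; rewrite lee_fin.
- apply/disj_setPS => x [] [] [bx _] [/= xO _];
  by have := branch_neq bx; rewrite xO eqxx.
rewrite [X in (_ + X)%E](integral_Sset1 O); last by move=> x [].
rewrite adde0 (ge0_integral_setU mu (mD false) (mD true))//; last 3 first.
- exact: mff.
- by move=> x _; rewrite lee_fin.
- apply/disj_setPS => x [] [/branch_side h1 _] [/branch_side h2 _].
  by move: h1; rewrite ltNge (ltW h2).
rewrite -!integral_winv_preimage// -ge0_integralD//; last 4 first.
- by move=> y _; rewrite lee_fin mulr_ge0 ?winv_ge0.
- apply/measurable_EFinP; apply: measurable_funM; apply: measurable_funTS.
    exact: measurable_winv.
  exact: (measurableT_comp mf (measurable_invb _)).
- by move=> y _; rewrite lee_fin mulr_ge0 ?winv_ge0.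
- apply/measurable_EFinP; apply: measurable_funM; apply: measurable_funTS.
    exact: measurable_winv.
  exact: (measurableT_comp mf (measurable_invb _)).
by apply: eq_integral => y _; rewrite /transfer big_bool/= EFinD addeC.
Qed.

Lemma integral_dens n : (\int[mu]_(x in Ihalf) (dens n x)%:E = 1)%E.
Proof.
elim: n => [|n IH].
  transitivity (\int[mu]_(x in Ihalf) (cst 1%E (x : R)))%E; first exact: eq_integral.
  rewrite integral_cst ?mul1e; first exact: lebesgue_Ihalf.
  exact: measurable_Ihalf.
rewrite densS integral_transfer//; last 3 first.
- exact: measurable_Ihalf.
- exact: measurable_dens.
- exact: dens_ge0.
rewrite (_ : _ `&` _ = Ihalf)//; apply/seteqP; split => x; first by case.
by move=> Ix; split => //; exact: T_Ihalf.
Qed.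

(** * Bounds for the densities *)

Lemma measurable_cyl n z : measurable (cyl n z).
Proof. apply: is_interval_measurable; exact: cyl_is_interval. Qed.

Lemma integral_dens_le1 n D : measurable D -> D `<=` Ihalf ->
  (\int[mu]_(x in D) (dens n x)%:E <= 1)%E.
Proof.
move=> mD DI; rewrite -(integral_dens n); apply: ge0_subset_integral => //.
- exact: measurable_Ihalf.
- by apply/measurable_EFinP; apply: measurable_funTS; exact: measurable_dens.
- by move=> x _; rewrite lee_fin dens_ge0.
Qed.

(** A density cannot exceed [2 / delta] on a whole set of measure at least
    [delta]. *)
Lemma exists_dens_le m n z (delta : R) : 0 < delta ->
  (delta%:E <= mu (cyl n z))%E -> exists x, cyl n z x /\ dens m x <= 2 / delta.
Proof.
move=> d0 dJ; apply: contrapT => H.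
have lt2 x : cyl n z x -> 2 / delta < dens m x.
  by move=> cx; rewrite ltNge; apply/negP => h; apply: H; exists x.
have := integral_dens_le1 m (measurable_cyl n z) (@cyl_Ihalf n z).
apply/negP; rewrite -ltNge; apply: (@lt_le_trans _ _ (2%:E)); first by rewrite lte_fin ltr1n.
apply: (@le_trans _ _ (\int[mu]_(x in cyl n z) (cst (2 / delta)%:E x))%E).
  rewrite integral_cst; last exact: measurable_cyl.
  apply: (@le_trans _ _ ((2 / delta)%:E * delta%:E)%E).
    by rewrite -EFinM divfK// gt_eqF.
  by rewrite lee_wpmul2l// lee_fin divr_ge0// ltW.
apply: ge0_le_integral => //.
- exact: measurable_cyl.
- by move=> x _; rewrite lee_fin divr_ge0// ltW.
- by apply/measurable_EFinP; apply: measurable_funTS; exact: measurable_dens.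
- by move=> x /lt2/ltW; rewrite lee_fin.
Qed.

Section Bounds.
Variables (P : nat) (V : R).
Hypotheses (P0 : (0 < P)%N).
Hypothesis gV : forall b c, pairwise below c ->
  (forall t, t \in c -> branch b t.1.2 /\ branch b t.2) ->
  \sum_(t <- c) `|(derI T t.1.2)^-1 - (derI T t.2)^-1| ^+ P <= V.

Let Cth_ge0 j : 0 <= C^-1 * theta ^- j.
Proof. by rewrite mulr_ge0 ?invr_ge0 ?exprn_ge0// ltW// (lt_trans _ th1). Qed.

(** Compares [dens m] at the preimages of [y] with its values at companions in the
    same [n]-cylinders, where it is at most [2 / delta]. *)
Lemma dens_bound n m y (delta : R) (tau u M : nat -> R) :
  (0 < n)%N -> Ihalf y -> 0 < delta ->
  (forall J, refinement T (branches O) n J -> (delta%:E <= mu J)%E) ->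
  (forall j, 0 < tau j) -> (forall j, dens (n + j) y <= u j) ->
  (forall k x, (k < m)%N -> Ihalf x -> dens k x <= M k) ->
  dens (n + m) y <= dens n y * (2 / delta) +
    \sum_(j < m) M (m - j.+1)%N * loss P V (tau j) (C^-1 * theta ^- (n + j)) (u j).
Proof.
move=> n0 Iy d0 dJ tau0 du dM.
pose comp z := xget z [set x | cyl n z x /\ dens m x <= 2 / delta].
have compP z : Ihalf z -> avoids T O n z -> cyl n z (comp z) /\ dens m (comp z) <= 2 / delta.
  move=> Iz az.
  have := exists_dens_le m d0 (dJ _ (cyl_refinement n0 Iz az)).
  by move=> /(xgetPex z).
have compc z : Ihalf z -> avoids T O n z -> cyl n z (comp z) by move=> ? /compP[].
have -> : dens (n + m) y = wsum (with_comp n y comp) (dens m).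
  by rewrite wsum_with_comp// /dens iterD.
have -> : wsum (with_comp n y comp) (dens m) =
    \sum_(t <- with_comp n y comp) t.1.1 * dens m t.2 + wdiff (with_comp n y comp) (dens m).
  by rewrite /wsum /wdiff -big_split/=; apply: eq_bigr => t _; ring.
apply: lerD.
  rewrite -[dens n y](wsum_with_comp n comp Iy (cst 1)) /wsum mulr_suml.
  rewrite /with_comp !big_map !big_seq; apply: ler_sum => t tp.
  have [h1 h2 h3 h4 h5] := preimsP tp Iy.
  rewrite /= mulr1 ler_wpM2l//; last by have [] := compP _ h3 h4.
  by have [_ /(_ _ tp)[]] := preims_admissible n Iy.
apply: (@wdiff_dens P V P0 gV m _ tau (fun j => C^-1 * theta ^- (n + j)) u M) => //.
- exact: with_comp_admissible.
- move=> j _ x /mapP[t tp ->] Ix ax /= xE.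
  have [h1 h2 h3 h4 h5] := preimsP tp Iy.
  rewrite h2 mulrC -xE -wgtD addnC; apply: wgt_le => //.
  by rewrite addnC; apply/avoidsD; rewrite xE.
- by move=> j; rewrite wsum_with_comp// -iterD; exact: du.
Qed.

(** The pairs consist of two points of each cell, with equal weights of sum 1, so
    that [wdiff] is the mean oscillation over the mesh. *)
Lemma dens_mesh N k (z z' : nat -> R) (tau M : nat -> R) : (0 < N)%N ->
  (forall r, (r < N)%N -> bin N r (z r) /\ bin N r (z' r)) ->
  (forall j, 0 < tau j) -> (forall j x, Ihalf x -> dens j x <= M j) ->
  \sum_(r < N) N%:R^-1 * (dens k (z r) - dens k (z' r)) <=
    \sum_(j < k) M (k - j.+1)%N * loss P V (tau j) (C^-1 * theta ^- j / N%:R) (M j).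
Proof.
move=> N0 zb tau0 dM; have NR : 0 < N%:R :> R by rewrite ltr0n.
pose c : seq (R * R * R) := [seq (N%:R^-1, z r, z' r) | r <- iota 0 N].
have -> : \sum_(r < N) N%:R^-1 * (dens k (z r) - dens k (z' r)) = wdiff c (dens k).
  by rewrite /wdiff big_map -[N in iota 0 N]subn0 big_mkord.
have cP t : t \in c -> exists2 r, (r < N)%N & t = (N%:R^-1, z r, z' r).
  by move=> /mapP[r]; rewrite mem_iota add0n => /andP[_ rN] ->; exists r.
apply: (@wdiff_dens P V P0 gV k _ tau (fun j => C^-1 * theta ^- j / N%:R) M M) => //.
- split; last first.
    move=> t /cP[r rN ->]; have [h1 h2] := zb _ rN; split => //=.
    + exact: bin_Ihalf h1.
    + exact: bin_Ihalf h2.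
  rewrite pairwise_map.
  have := iota_ltn_sorted 0 N; rewrite sorted_pairwise; last exact: ltn_trans.
  apply: (sub_in_pairwise _ (allss (iota 0 N))) => i j.
  rewrite !mem_iota !add0n => /andP[_ iN] /andP[_ jN] ij.
  have [a1 a2] := zb _ iN; have [b1 b2] := zb _ jN.
  have h (x x' : R) : bin N i x -> bin N j x' -> x < x'.
    rewrite /bin/= !in_itv/= => /andP[_ h1] /andP[h2 _].
    apply: (lt_le_trans h1); apply: le_trans h2.
    by rewrite lerD2l ler_pM2r ?invr_gt0// ler_nat.
  by apply/belowP; split; exact: h.
- by move=> j; rewrite divr_ge0// ltW.
- move=> j _ x /cP[r rN ->] Ix ax /= _; rewrite mulrC ler_pM2r ?invr_gt0//.
  exact: wgt_le.
- move=> j; rewrite /wsum big_map/=.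
  apply: (@le_trans _ _ (\sum_(r <- iota 0 N) N%:R^-1 * M j)).
    rewrite !big_seq; apply: ler_sum => r; rewrite mem_iota add0n => /andP[_ rN].
    rewrite ler_wpM2l ?invr_ge0 ?(ltW NR)//; apply: dM.
    by have [h _] := zb _ rN; exact: (bin_Ihalf rN h).
  rewrite -mulr_sumr big_const_seq count_predT size_iota iter_addr_0.
  by rewrite -[M j *+ N]mulr_natr mulrCA mulVf ?mulr1// gt_eqF.
- by move=> j x _; exact: dM.
Qed.

End Bounds.
End Expanding.
End Branches.

(** * Bounds that are uniform in the map *)

Section Growth.
Context {R : realType}.
Local Notation mu := (@lebesgue_measure R).

Lemma reindex_leq m n (j : 'I_m) : (m - j.+1 + (n + j) <= n + m)%N.
Proof. by have jm := ltn_ord j; lia. Qed.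

Lemma bernoulli_expr (v : R) n : 1 <= v -> 1 + n%:R * (v - 1) <= v ^+ n.
Proof.
move=> v1; elim: n => [|n IH]; first by rewrite mul0r addr0 expr0.
rewrite exprS; apply: (@le_trans _ _ (v * (1 + n%:R * (v - 1)))); last first.
  by rewrite ler_wpM2l// (le_trans ler01).
rewrite -natr1 -subr_ge0 (_ : _ - _ = n%:R * (v - 1) ^+ 2); last by ring.
by rewrite mulr_ge0// sqr_ge0.
Qed.

Lemma exists_expr_ge (v x : R) : 1 < v -> exists2 n, (0 < n)%N & x <= v ^+ n.
Proof.
move=> v1; have v10 : 0 < v - 1 by rewrite subr_gt0.
have [x0|x0] := leP x 0.
  by exists 1%N => //; rewrite expr1 (le_trans x0)// (le_trans ler01)// ltW.
have q0 : 0 <= x / (v - 1) by rewrite divr_ge0// ltW.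
exists (Num.bound (x / (v - 1))).+1 => //.
apply: le_trans (bernoulli_expr _ (ltW v1)).
have := ltW (archi_boundP q0); rewrite ler_pdivrMr// => h.
apply: (le_trans h); rewrite -natr1 mulrDl mul1r addrCA lerDl.
by rewrite addr_ge0// ltW.
Qed.

Lemma sum_geometric_le (v : R) k : 1 < v ->
  \sum_(j < k) (v ^+ j)^-1 <= v / (v - 1).
Proof.
move=> v1; have v10 : 0 < v - 1 by rewrite subr_gt0.
have v0 : 0 < v by exact: lt_trans v1.
suff -> : \sum_(j < k) (v ^+ j)^-1 = v / (v - 1) * (1 - (v ^+ k)^-1).
  rewrite ler_piMr ?divr_ge0 ?(ltW v0) ?(ltW v10)//.
  by rewrite gerBl invr_ge0 exprn_ge0// ltW.
elim: k => [|k IH]; first by rewrite big_ord0 expr0 invr1 subrr mulr0.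
rewrite big_ord_recr/= IH exprS; have vk : v ^+ k != 0 by rewrite expf_neq0// gt_eqF.
by field; rewrite vk !gt_eqF.
Qed.

Variables (C theta V : R) (P : nat) (delta : nat -> R).
Hypotheses (C0 : 0 < C) (th1 : 1 < theta) (V0 : 0 <= V) (P0 : (0 < P)%N).
Hypothesis delta0 : forall n, (0 < n)%N -> 0 < delta n.

(** The maps for which the constants are uniform.  The variation bound is kept in
    the form in which it is used, with the integer exponent [P]. *)
Record uniform_map (T : R -> R) (O : R) : Prop := UniformMap {
  um_lorenz : lorenz_map T O;
  um_expanding : expanding C theta T O;
  um_variation : forall b c, pairwise below c ->
    (forall t, t \in c -> branch O b t.1.2 /\ branch O b t.2) ->
    \sum_(t <- c) `|(derI T t.1.2)^-1 - (derI T t.2)^-1| ^+ P <= V;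
  um_partition : forall n, (0 < n)%N -> forall J,
    refinement T (branches O) n J -> ((delta n)%:E <= mu J)%E }.

Let G := (C * theta)^-1.
Let G0 : 0 < G.
Proof. by rewrite invr_gt0 mulr_gt0// (lt_trans _ th1). Qed.

Let K (B : R) : R := 2 * (B + V / C) + 4 * G / C.

Let K_ge0 B : 0 <= B -> 0 <= K B.
Proof.
move=> B0; have := ltW C0; have := ltW G0 => G0' C0'.
have h1 : 0 <= V / C by exact: divr_ge0.
have h2 : 0 <= 4 * G / C by rewrite divr_ge0// mulr_ge0.
rewrite /K; lra.
Qed.

(** In the next two lemmas [x] is [v^j], and [Th = theta^j] bounds the decay of the
    weights.  With the threshold [x^-(P+1)], the loss gains a factor [x] over the
    lowered bound [x^(P e)]; the hypothesis [x^(P*P) <= Th] is what is needed for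
    [s / tau^(P-1)], as [(P+1)(P-1) + 1 = P^2]. *)
Lemma loss_growth (x Th B : R) e : 1 <= x -> x ^+ (P * P) <= Th -> 0 <= B ->
  loss C theta P V (x ^- P.+1) (C^-1 * Th^-1) (B * x ^+ (P * e.+1)) <=
  K B * (x ^+ (P * e) / x).
Proof.
move=> x1 xTh B0; have x0 : 0 < x by exact: lt_le_trans x1.
have xn k : 0 < x ^+ k by exact: exprn_gt0.
have xk1 k : 1 <= x ^+ k by exact: exprn_ege1.
have Th0 : 0 < Th by exact: lt_le_trans xTh.
have CV : 0 < C^-1 by rewrite invr_gt0.
have key1 : Th^-1 * x ^+ (P.+1 * P.-1) <= x^-1.
  rewrite -ler_pdivlMr// -invrM ?unitfE ?gt_eqF// lef_pV2 ?posrE ?mulr_gt0//.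
  apply: le_trans xTh; rewrite -exprSr; apply: eq_ler; congr (_ ^+ _).
  by case: P P0 => // p _ /=; lia.
have key2 : Th^-1 <= x^-1.
  apply: le_trans key1; rewrite ler_peMr// invr_ge0 ltW//.
have big a : 0 <= a -> a / x <= a * (x ^+ (P * e) / x).
  by move=> a0; rewrite mulrA ler_pM2r ?invr_gt0// ler_peMr.
rewrite /loss /K -/G.
have -> : x ^- P.+1 * (B * x ^+ (P * e.+1)) = B * (x ^+ (P * e) / x).
  rewrite mulnS exprD [x ^+ P.+1]exprS; field.
  by rewrite !gt_eqF.
have t2 : C^-1 * Th^-1 * V / x ^- P.+1 ^+ P.-1 <= V / C * (x ^+ (P * e) / x).
  apply: (@le_trans _ _ (V / C / x)); last by apply: big; rewrite divr_ge0// ltW.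
  rewrite exprVn invrK -exprM.
  rewrite (_ : _ * x ^+ _ = V / C * (Th^-1 * x ^+ (P.+1 * P.-1))); last by ring.
  by rewrite ler_wpM2l// divr_ge0// ltW.
have t3 : 4 * G * (C^-1 * Th^-1) <= 4 * G / C * (x ^+ (P * e) / x).
  apply: (@le_trans _ _ (4 * G / C / x)); last first.
    by apply: big; rewrite !mulr_ge0// ltW.
  by rewrite mulrA ler_wpM2l// !mulr_ge0// ltW.
move: t2 t3; set y := x ^+ _ / x; set a := C^-1 * Th^-1 * V / _; set b := 4 * G * _.
move=> t2 t3; rewrite (_ : (_ + 4 * G / C) * y = 2 * (B * y + V / C * y) + 4 * G / C * y); last by ring.
by lra.
Qed.

(** For a mesh of [l^P] cells the weights are at most [Th^-1 / l^P] up to a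
    constant; the threshold [1 / (x l)] balances the first two terms of the loss at
    the order [1 / l]. *)
Lemma loss_mesh (x Th M : R) l : 1 <= x -> x ^+ (P * P) <= Th -> 0 <= M -> (0 < l)%N ->
  loss C theta P V (x^-1 / l%:R) (C^-1 * Th^-1 / (l ^ P)%N%:R) M <= K M / l%:R / x.
Proof.
move=> x1 xTh M0 l0; have x0 : 0 < x by exact: lt_le_trans x1.
have xn k : 0 < x ^+ k by exact: exprn_gt0.
have xk1 k : 1 <= x ^+ k by exact: exprn_ege1.
have Th0 : 0 < Th by exact: lt_le_trans xTh.
have CV : 0 < C^-1 by rewrite invr_gt0.
have L0 : 0 < l%:R :> R by rewrite ltr0n.
have L1 : 1 <= l%:R :> R by rewrite ler1n.
have Ln k : 0 < l%:R ^+ k :> R by exact: exprn_gt0.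
have xP : x ^+ P <= Th.
  by apply: le_trans xTh; apply: ler_weXn2l => //; rewrite leq_pmulr.
have e1 : x ^+ P = x * x ^+ P.-1 by rewrite -exprS prednK.
have e2 : l%:R ^+ P = l%:R * l%:R ^+ P.-1 :> R by rewrite -exprS prednK.
have xx : x <= Th.
  by apply: le_trans xP; rewrite -[leLHS]expr1; exact: ler_weXn2l.
rewrite /loss /K -/G natrX.
have t2 : C^-1 * Th^-1 / l%:R ^+ P * V / (x^-1 / l%:R) ^+ P.-1 <= V / C * (l%:R^-1 / x).
  rewrite (_ : _ / (x^-1 / l%:R) ^+ P.-1 = V / C * (l%:R^-1 * (Th^-1 * x ^+ P.-1))); last first.
    rewrite e2 exprMn !exprVn; field.
    by rewrite !gt_eqF.
  rewrite ler_wpM2l ?divr_ge0 ?(ltW C0)// ler_wpM2l ?invr_ge0 ?(ltW L0)//.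
  rewrite -ler_pdivlMr// -invfM lef_pV2 ?posrE ?mulr_gt0//; first by rewrite -e1.
have t3 : 4 * G * (C^-1 * Th^-1 / l%:R ^+ P) <= 4 * G / C * (l%:R^-1 / x).
  rewrite -!mulrA ler_wpM2l// ler_wpM2l ?(ltW G0)// ler_wpM2l ?(ltW CV)//.
  have a1 : l%:R ^- P <= l%:R^-1 :> R.
    by rewrite lef_pV2 ?posrE// e2 ler_peMr ?(ltW L0)// exprn_ege1.
  have a2 : Th^-1 <= x^-1 by rewrite lef_pV2 ?posrE.
  by rewrite mulrC; apply: ler_pM => //; rewrite invr_ge0 ltW.
rewrite (_ : x^-1 / l%:R * M = M * (l%:R^-1 / x)); last by rewrite mulrC [x^-1 * _]mulrC.
rewrite -(mulrA (2 * (M + V / C) + 4 * G / C)).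
move: t2 t3; set y := l%:R^-1 / x; set a := _ * V / _; set b := 4 * G * (_ / _).
move=> t2 t3.
rewrite (_ : (_ + 4 * G / C) * y = 2 * (M * y + V / C * y) + 4 * G / C * y); last by ring.
by lra.
Qed.

Variable v : R.
Hypotheses (v1 : 1 < v) (vth : v ^+ (P * P) <= theta).

Let S := v / (v - 1).

Let S0 : 0 <= S.
Proof. by rewrite divr_ge0 ?subr_ge0 ?(ltW v1)// (le_trans ler01)// ltW. Qed.

Let theta_expr i : (v ^+ i) ^+ (P * P) <= theta ^+ i.
Proof. by rewrite exprAC; apply: lerXn2r => //; rewrite nnegrE ?exprn_ge0// ltW// (lt_trans ltr01). Qed.

(** Lowers the exponential growth rate of the bound by a factor [v^P].  The losses
    from level [n] on form a geometric series of size [v^-n]: for [n] large its sum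
    is at most one half, and [dens_bound] closes an induction on the time. *)
Lemma growth_step e :
  (exists2 B, 0 <= B & forall T O, uniform_map T O -> forall k y, Ihalf y ->
     dens T O k y <= B * (v ^+ k) ^+ (P * e.+1)) ->
  exists2 B, 0 <= B & forall T O, uniform_map T O -> forall k y, Ihalf y ->
     dens T O k y <= B * (v ^+ k) ^+ (P * e).
Proof.
move=> [B B0 HB].
have v0 : 0 < v by exact: lt_trans v1.
have vk0 k : 0 < v ^+ k by exact: exprn_gt0.
have vk1 k : 1 <= v ^+ k by rewrite exprn_ege1// ltW.
(* [S] bounds the geometric series of the losses. *)
have [n n0 Kn] := exists_expr_ge (2 * K B * S) v1.
have dn := delta0 n0.
pose A := B * (v ^+ n) ^+ (P * e.+1).
have A0 : 0 <= A by rewrite mulr_ge0// exprn_ge0// ltW.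
pose B' := 2 * (A * (2 / delta n)) + A.
have d20 : 0 <= 2 / delta n by rewrite divr_ge0// ltW.
have B'0 : 0 <= B' by rewrite addr_ge0// mulr_ge0// mulr_ge0.
exists B' => // T O uT; elim/ltn_ind => k IH y Iy.
have a1 i : 1 <= (v ^+ i) ^+ (P * e) by exact: exprn_ege1.
have [kn|nk] := leqP k n.
  apply: (le_trans (HB _ _ uT k y Iy)); apply: (@le_trans _ _ A).
    rewrite ler_wpM2l//; apply: lerXn2r; rewrite ?nnegrE ?(ltW (vk0 _))//.
    by apply: ler_weXn2l => //; exact: ltW.
  rewrite -[A]mulr1; apply: ler_pM => //.
  by rewrite lerDr mulr_ge0// mulr_ge0.
have [m mE] : exists m, k = (n + m)%N by exists (k - n)%N; rewrite subnKC// ltnW.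
have [lT eT gV pT] := uT.
have := @dens_bound R T O lT C theta C0 th1 eT P V P0 gV n m y (delta n)
  (fun j => (v ^+ (n + j)) ^- P.+1) (fun j => B * (v ^+ (n + j)) ^+ (P * e.+1))
  (fun i => B' * (v ^+ i) ^+ (P * e)) n0 Iy dn (pT n n0).
rewrite -mE => /(_ _ _ _)/le_trans; apply.
- by move=> j; rewrite invr_gt0 exprn_gt0.
- by move=> j; exact: HB.
- by move=> i x im Ix; apply: IH => //; rewrite mE ltn_addl.
have t1 : dens T O n y * (2 / delta n) <= B' / 2 * (v ^+ k) ^+ (P * e).
  apply: (@le_trans _ _ (B' / 2)); last by rewrite ler_peMr// divr_ge0.
  apply: (@le_trans _ _ (A * (2 / delta n))); first by rewrite ler_wpM2r// HB.
  by rewrite ler_pdivlMr// /B' mulrC lerDl.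
have t2 : \sum_(j < m) B' * (v ^+ (m - j.+1)) ^+ (P * e) *
    loss C theta P V ((v ^+ (n + j)) ^- P.+1) (C^-1 * theta ^- (n + j))
      (B * (v ^+ (n + j)) ^+ (P * e.+1)) <= B' / 2 * (v ^+ k) ^+ (P * e).
  apply: (@le_trans _ _ (\sum_(j < m)
      (B' * (v ^+ k) ^+ (P * e) * (K B / v ^+ n)) * (v ^+ j)^-1)).
    apply: ler_sum => j _.
    apply: (@le_trans _ _ (B' * (v ^+ (m - j.+1)) ^+ (P * e) *
        (K B * ((v ^+ (n + j)) ^+ (P * e) / v ^+ (n + j))))).
      rewrite ler_wpM2l//; first by rewrite mulr_ge0// exprn_ge0// ltW.
      exact: loss_growth.
    rewrite [X in _ / X]exprD invfM.
    rewrite (_ : _ * _ = B' * ((v ^+ (m - j.+1)) ^+ (P * e) * (v ^+ (n + j)) ^+ (P * e)) *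
      (K B / v ^+ n) * (v ^+ j)^-1); last by ring.
    rewrite ler_wpM2r ?invr_ge0 ?(ltW (vk0 _))//.
    rewrite ler_wpM2r ?divr_ge0 ?K_ge0 ?(ltW (vk0 _))// ler_wpM2l//.
    rewrite -exprMn -exprD; apply: lerXn2r; rewrite ?nnegrE ?(ltW (vk0 _))//.
    apply: ler_weXn2l; first exact: ltW.
    by rewrite mE; apply: reindex_leq.
  rewrite -mulr_sumr.
  apply: (@le_trans _ _ (B' * (v ^+ k) ^+ (P * e) * (K B / v ^+ n) * S)).
    rewrite ler_wpM2l//; last exact: sum_geometric_le.
    by rewrite mulr_ge0 ?divr_ge0 ?K_ge0 ?mulr_ge0 ?exprn_ge0 ?(ltW (vk0 _))// ltW.
  have hq : K B / v ^+ n * S <= 2^-1.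
    rewrite mulrAC ler_pdivrMr// [leRHS]mulrC ler_pdivlMr//.
    by rewrite mulrC mulrA.
  rewrite -mulrA (mulrAC B' 2^-1) ler_wpM2l//.
  by rewrite mulr_ge0// exprn_ge0// ltW.
apply: (le_trans (lerD t1 t2)); rewrite -mulrDl -mulrDl -mulr2n -[_ *+ 2]mulr_natr.
by rewrite mulfK.
Qed.

(** Start from the crude rate [2 G <= v^E] and lower it with [growth_step] until
    the rate is 1. *)
Lemma dens_uniform_bound : exists2 M, 0 < M & forall T O, uniform_map T O ->
  forall k y, Ihalf y -> dens T O k y <= M.
Proof.
have v0 : 0 < v by exact: lt_trans v1.
have [E E0 GE] := exists_expr_ge (2 * G) v1.
suff [B B0 HB] : exists2 B, 0 <= B & forall T O, uniform_map T O -> forall k y, Ihalf y ->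
     dens T O k y <= B * (v ^+ k) ^+ (P * 0).
  exists (B + 1); first by rewrite ltr_wpDl.
  move=> T O uT k y Iy; apply: (le_trans (HB _ _ uT k y Iy)).
  by rewrite muln0 expr0 mulr1 lerDl.
suff : forall e, exists2 B, 0 <= B & forall T O, uniform_map T O -> forall k y, Ihalf y ->
     dens T O k y <= B * (v ^+ k) ^+ (P * (E - e)) by move=> /(_ E); rewrite subnn.
elim=> [|e IH].
  rewrite subn0; exists 1 => // T O uT k y Iy; rewrite mul1r.
  have [lT eT _ _] := uT; apply: (le_trans (dens_crude lT C0 th1 eT k y)).
  rewrite exprAC; apply: lerXn2r; rewrite ?nnegrE ?exprn_ge0 ?mulr_ge0 ?(ltW v0) ?(ltW G0)//.
  apply: (le_trans GE); apply: ler_weXn2l; first exact: ltW.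
  by rewrite leq_pmull.
have [eE|Ee] := ltnP e E.
  by apply: growth_step; rewrite (_ : (E - e.+1).+1 = (E - e)%N)//; lia.
by rewrite (_ : (E - e.+1)%N = (E - e)%N)//; lia.
Qed.

Lemma dens_uniform_mesh : exists2 c, 0 <= c & forall T O, uniform_map T O ->
  forall k l (z z' : nat -> R), (0 < l)%N ->
  (forall r, (r < l ^ P)%N -> bin (l ^ P) r (z r) /\ bin (l ^ P) r (z' r)) ->
  \sum_(r < l ^ P) (l ^ P)%:R^-1 * (dens T O k (z r) - dens T O k (z' r)) <= c / l%:R.
Proof.
have v0 : 0 < v by exact: lt_trans v1.
have vk0 k : 0 < v ^+ k by exact: exprn_gt0.
have [M M0 HM] := dens_uniform_bound.
have KM0 := K_ge0 (ltW M0).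
exists (M * K M * S); first by rewrite mulr_ge0// mulr_ge0// ltW.
move=> T O uT k l z z' l0 zb; have [lT eT gV _] := uT.
have L0 : 0 < l%:R :> R by rewrite ltr0n.
have := @dens_mesh R T O lT C theta C0 th1 eT P V P0 gV (l ^ P) k z z'
  (fun j => (v ^+ j)^-1 / l%:R) (fun _ => M).
rewrite expn_gt0 l0 => /(_ isT zb _ _)/le_trans; apply.
- by move=> j; rewrite divr_gt0 ?invr_gt0.
- by move=> j x Ix; exact: HM.
apply: (@le_trans _ _ (\sum_(j < k) M * (K M / l%:R) * (v ^+ j)^-1)).
  apply: ler_sum => j _; rewrite -[leRHS]mulrA ler_wpM2l ?(ltW M0)//.
  by apply: loss_mesh => //; [rewrite exprn_ege1// ltW|exact: ltW].
rewrite -mulr_sumr (_ : M * K M * S / _ = M * (K M / l%:R) * S); last by ring.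
rewrite ler_wpM2l//; last exact: sum_geometric_le.
by rewrite mulr_ge0 ?divr_ge0 ?K_ge0 ?(ltW M0) ?(ltW L0).
Qed.

End Growth.

(** * Convergence along ultrafilters *)

Section UltraLimit.
Context {R : realType} {I : Type}.
Variable U : set_system I.
Hypothesis UU : UltraFilter U.

Lemma ultra_bounded_cvg (x : I -> R) (a b : R) : (forall i, a <= x i <= b) ->
  cvg (x i @[i --> U]).
Proof.
move=> xab.
have [|p [_ cp]] := @segment_compact R a b (x @ U) _.
  suff : U (x @^-1` `[a, b]) by [].
  by apply: (filterS _ (filterT : U setT)) => i _; rewrite /= in_itv/=; exact: xab.
apply/cvg_ex; exists p => V Vp.
have [//|UV] := in_ultra_setVsetC (x @^-1` V) UU.
have [y [nVy Vy]] := cp (~` V) V UV Vp.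
by [].
Qed.

End UltraLimit.

(** If convergence fails for a neighbourhood, the filter stays proper after adding
    the complement of its preimage, and any ultrafilter above it is a
    counterexample. *)
Lemma ultra_cvg (R : realType) (I : Type) (F : set_system I) (FF : ProperFilter F)
    (S : topologicalType) (f : I -> S) (l : S) :
  (forall U, UltraFilter U -> F `<=` U -> f i @[i --> U] --> l) ->
  f i @[i --> F] --> l.
Proof.
move=> H V Vl; apply: contrapT => FV.
pose G := filter_from F (fun A => A `&` ~` (f @^-1` V)).
have GF : ProperFilter G.
  apply: filter_from_proper; last first.
    move=> A FA; apply: contrapT => /nonemptyPn h; apply: FV.
    suff : F (f @^-1` V) by [].
    apply: (filterS _ FA) => i Ai; apply: contrapT => nV.
    have : (A `&` ~` (f @^-1` V)) i by [].
    by rewrite h.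
  apply: filter_from_filter; first by exists setT; exact: filterT.
  move=> A B FA FB; exists (A `&` B); first exact: filterI.
  by move=> i [[Ai Bi] nV].
have [W [WU GW]] := ultraFilterLemma GF.
have FW : F `<=` W.
  by move=> A FA; apply: GW; exists A => // i [].
have WV := H W WU FW V Vl.
have WnV : W (~` (f @^-1` V)) by apply: GW; exists setT; [exact: filterT|move=> i []].
have WV' : W (f @^-1` V) by exact: WV.
by have [i [Vi nVi]] := filter_ex (filterI WV' WnV).
Qed.

(** * Set-wise limits of densities *)

Section SetFunctions.
Context {R : realType}.
Local Notation mu := (@lebesgue_measure R).

Lemma additive_bigsetU (f : set R -> R) (F : (set R)^nat) n :
  f set0 = 0 ->
  (forall A B, measurable A -> measurable B -> A `&` B = set0 ->
    f (A `|` B) = f A + f B) ->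
  (forall k, measurable (F k)) -> trivIset setT F ->
  f (\big[setU/set0]_(i < n) F i) = \sum_(i < n) f (F i).
Proof.
move=> f0 fD mF tF; elim: n => [|n IH]; first by rewrite !big_ord0.
rewrite !big_ord_recr/= fD ?IH//; first exact: bigsetU_measurable.
apply/seteqP; split => // x [+ Fn]; rewrite -bigcup_mkord => -[k /= kn Fk].
by have kE := tF k n I I (ex_intro _ x (conj Fk Fn)); rewrite kE ltnn in kn.
Qed.

(** Real values make the limits and the estimates below plain real analysis. *)
Definition len (A : set R) : R := fine (mu (A `&` Ihalf)).

Lemma lenE A : measurable A -> (len A)%:E = mu (A `&` Ihalf).
Proof.
move=> mA; have mAI := measurableI _ _ mA measurable_Ihalf.
rewrite /len fineK// ge0_fin_numE//.
apply: (@le_lt_trans _ _ (mu (@Ihalf R))); last by rewrite lebesgue_Ihalf ltry.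
by apply: le_measure; rewrite ?inE//; exact: measurable_Ihalf.
Qed.

Lemma len_ge0 A : 0 <= len A.
Proof. exact: fine_ge0. Qed.

Lemma lenD A B : measurable A -> measurable B -> A `&` B = set0 ->
  len (A `|` B) = len A + len B.
Proof.
move=> mA mB AB; apply: EFin_inj; rewrite EFinD !lenE//; last exact: measurableU.
rewrite setIUl measureU//.
- exact: (measurableI _ _ mA measurable_Ihalf).
- exact: (measurableI _ _ mB measurable_Ihalf).
- by rewrite setIACA AB set0I.
Qed.

Lemma len0 : len set0 = 0.
Proof. by rewrite /len set0I measure0. Qed.

Lemma len_bigcup_cvg (F : (set R)^nat) : (forall k, measurable (F k)) ->
  trivIset setT F -> (\sum_(i < n) len (F i)) @[n --> \oo] --> len (\bigcup_n F n).
Proof.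
move=> mF tF; have mU : measurable (\bigcup_n F n) by exact: bigcup_measurable.
suff : (\sum_(i < n) len (F i))%:E @[n --> \oo] --> (len (\bigcup_n F n))%:E.
  by move=> /fine_cvg.
rewrite lenE//.
have := @measure_semi_sigma_additive _ _ _ (mrestr mu measurable_Ihalf) F mF tF mU.
rewrite /mrestr => h; apply: cvg_trans h; apply: near_eq_cvg.
by apply: nearW => n; rewrite -sumEFin big_mkord; apply: eq_bigr => i _; rewrite lenE.
Qed.

Section Mass.
Variables (f : R -> R) (M : R).
Hypotheses (mf : measurable_fun setT f) (f0 : forall x, 0 <= f x).
Hypothesis intf : (\int[mu]_(x in Ihalf) (f x)%:E = 1)%E.

(** Restricting to the interval inside the definition lets arbitrary Borel sets be
    used as arguments. *)
Definition mass (A : set R) : R := fine (\int[mu]_(x in A `&` Ihalf) (f x)%:E)%E.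

Let mEf (D : set R) : measurable_fun D (EFin \o f).
Proof. by apply/measurable_EFinP; exact: measurable_funTS. Qed.

Let mI A : measurable A -> measurable (A `&` @Ihalf R).
Proof. by move=> mA; exact: (measurableI _ _ mA measurable_Ihalf). Qed.

Lemma mass_le1E A : measurable A -> (\int[mu]_(x in A `&` Ihalf) (f x)%:E <= 1)%E.
Proof.
move=> mA; rewrite -intf; apply: ge0_subset_integral => //.
- exact: mI.
- exact: measurable_Ihalf.
- exact: mEf.
- by move=> x _; rewrite lee_fin.
Qed.

Lemma massE A : measurable A -> (mass A)%:E = (\int[mu]_(x in A `&` Ihalf) (f x)%:E)%E.
Proof.
move=> mA; rewrite /mass fineK// ge0_fin_numE; last first.
  by apply: integral_ge0 => x _; rewrite lee_fin.
by rewrite (le_lt_trans (mass_le1E mA))// ltry.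
Qed.

Lemma mass_ge0 A : 0 <= mass A.
Proof. by apply: fine_ge0; apply: integral_ge0 => x _; rewrite lee_fin. Qed.

Lemma mass_le1 A : measurable A -> mass A <= 1.
Proof. by move=> mA; rewrite -lee_fin massE// mass_le1E. Qed.

Lemma mass0 : mass set0 = 0.
Proof. by rewrite /mass set0I integral_set0. Qed.

Lemma massT : mass setT = 1.
Proof. by rewrite /mass setTI intf. Qed.

Lemma massD A B : measurable A -> measurable B -> A `&` B = set0 ->
  mass (A `|` B) = mass A + mass B.
Proof.
move=> mA mB AB; apply: EFin_inj; rewrite EFinD !massE//; last exact: measurableU.
rewrite setIUl ge0_integral_setU//.
- exact: mI.
- exact: mI.
- exact: mEf.
- by move=> x _; rewrite lee_fin.
- by apply/disj_setPS; rewrite setIACA AB set0I.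
Qed.

Lemma mass_ge A a : measurable A -> 0 <= a -> (forall x, A x -> Ihalf x -> a <= f x) ->
  a * len A <= mass A.
Proof.
move=> mA a0 af; rewrite -lee_fin EFinM lenE// massE//.
rewrite -integral_cst; last exact: mI.
apply: ge0_le_integral => //.
- exact: mI.
- exact: mEf.
- by move=> x [Ax Ix]; rewrite lee_fin af.
Qed.

Lemma mass_le A b : measurable A -> 0 <= b -> (forall x, A x -> Ihalf x -> f x <= b) ->
  mass A <= b * len A.
Proof.
move=> mA b0 bf; rewrite -lee_fin EFinM lenE// massE//.
rewrite -integral_cst; last exact: mI.
apply: ge0_le_integral => //.
- exact: mI.
- by move=> x _; rewrite lee_fin.
- exact: mEf.
- by move=> x [Ax Ix]; rewrite lee_fin bf.
Qed.

Lemma mass_cover A B S : measurable A -> measurable B -> measurable S ->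
  A `<=` B `|` S -> mass A <= mass B + mass S.
Proof.
move=> mA mB mS AS.
have mAB := measurableI _ _ mA mB; have mAD := measurableD mA mB.
have mono (D E : set R) : measurable D -> measurable E -> D `<=` E -> mass D <= mass E.
  move=> mD mE DE; have mED := measurableD mE mD.
  by rewrite -(setDUK DE) (massD mD mED (setDIK _ _)) lerDl mass_ge0.
rewrite -(setUIDK A B) (massD mAB mAD); last first.
  by apply/seteqP; split => // x [[_ Bx] []].
apply: lerD; apply: mono => //.
by move=> x [Ax nBx]; case: (AS x Ax).
Qed.

End Mass.

Section Limit.
Context {I : Type}.
Variables (U : set_system I) (phi : I -> R -> R) (M : R).
Hypothesis UU : UltraFilter U.
Hypothesis mphi : forall i, measurable_fun setT (phi i).
Hypothesis phi0 : forall i x, 0 <= phi i x.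
Hypothesis M0 : 0 <= M.
Hypothesis phiM : forall i x, Ihalf x -> phi i x <= M.
Hypothesis intphi : forall i, (\int[mu]_(x in Ihalf) (phi i x)%:E = 1)%E.

Let UP : ProperFilter U.
Proof. by case: UU. Qed.

(** The value outside the Borel sets only makes the function total, as needed for a
    measure. *)
Definition umass (A : set R) : R :=
  if `[< measurable A >] then lim (mass (phi i) A @[i --> U]) else 0.

Lemma umass_cvg A : measurable A -> mass (phi i) A @[i --> U] --> umass A.
Proof.
move=> mA; rewrite /umass asboolT//.
apply: (@ultra_bounded_cvg _ _ _ UU _ 0 1) => i.
by rewrite mass_ge0//= mass_le1.
Qed.

Lemma ulim_le (x y : I -> R) a b : x @ U --> a -> y @ U --> b ->
  (forall i, x i <= y i) -> a <= b.
Proof.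
move=> xa yb xy; rewrite -subr_ge0.
have h : (y i - x i) @[i --> U] --> b - a by exact: cvgB.
rewrite -(cvg_lim _ h)//; apply: limr_ge; first by apply/cvg_ex; exists (b - a).
by apply: nearW => i; rewrite subr_ge0.
Qed.

Lemma umass_ge0 A : 0 <= umass A.
Proof.
have [mA|mA] := pselect (measurable A); last by rewrite /umass asboolF.
by apply: (ulim_le (cvg_cst 0) (umass_cvg mA)) => i; exact: mass_ge0.
Qed.

Lemma umass_ext A B : measurable A -> measurable B -> A `&` Ihalf = B `&` Ihalf ->
  umass A = umass B.
Proof.
move=> mA mB AB; rewrite /umass !asboolT//; congr (lim _).
by rewrite (_ : (fun i => mass (phi i) A) = (fun i => mass (phi i) B))//;
  apply/funext => i; rewrite /mass AB.
Qed.

Lemma umass0 : umass set0 = 0.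
Proof.
have h := umass_cvg measurable0.
have e : (fun i => mass (phi i) set0) = cst 0 by apply/funext => i; exact: mass0.
by rewrite e in h; apply: (cvg_unique _ h (cvg_cst _)).
Qed.

Lemma umassT : umass setT = 1.
Proof.
have h := umass_cvg measurableT.
have e : (fun i => mass (phi i) setT) = cst 1 by apply/funext => i; exact: massT.
by rewrite e in h; apply: (cvg_unique _ h (cvg_cst _)).
Qed.

Lemma umassD A B : measurable A -> measurable B -> A `&` B = set0 ->
  umass (A `|` B) = umass A + umass B.
Proof.
move=> mA mB AB.
have h : mass (phi i) A + mass (phi i) B @[i --> U] --> umass A + umass B.
  by apply: cvgD; exact: umass_cvg.
have h' := umass_cvg (measurableU _ _ mA mB).
apply: (cvg_unique _ h') => //; apply: cvg_trans h; apply: near_eq_cvg.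
by apply: nearW => i; rewrite massD.
Qed.

(** This inequality makes the limit absolutely continuous and countably additive. *)
Lemma umass_le_len A : measurable A -> umass A <= M * len A.
Proof.
move=> mA; apply: (ulim_le (umass_cvg mA) (cvg_cst _)) => i.
by apply: mass_le => // x _; exact: phiM.
Qed.

Lemma umass_le A B : measurable A -> measurable B -> A `<=` B -> umass A <= umass B.
Proof.
move=> mA mB AB; have mD := measurableD mB mA.
rewrite -(setDUK AB) umassD//; last by rewrite setDIK.
by rewrite lerDl umass_ge0.
Qed.

Definition umeas (A : set (measurableTypeR R)) : \bar R := (umass A)%:E.

Let umeas0 : umeas set0 = 0%E.
Proof. by rewrite /umeas umass0. Qed.

Let umeas_ge0 A : (0 <= umeas A)%E.
Proof. by rewrite lee_fin umass_ge0. Qed.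

Let umeas_sigma_additive : semi_sigma_additive umeas.
Proof.
move=> F mF tF mUF; set D := \bigcup_n F n.
pose B n := \big[setU/set0]_(i < n) F i.
have mB n : measurable (B n) by apply: bigsetU_measurable => i _; exact: mF.
have BD n : B n `<=` D by rewrite /B -bigcup_mkord => x [k _ Fk]; exists k.
have eqB n : umass (B n) = \sum_(i < n) umass (F i).
  by apply: (@additive_bigsetU umass) => //; [exact: umass0|exact: umassD].
have lenB n : len (B n) = \sum_(i < n) len (F i).
  by apply: (@additive_bigsetU len) => //; [exact: len0|exact: lenD].
have le1 n : umass (B n) <= umass D by exact: (umass_le (mB n) mUF (BD n)).
have le2 n : umass D - M * (len D - len (B n)) <= umass (B n).
  have mDB := measurableD mUF (mB n).
  have e1 : umass D = umass (B n) + umass (D `\` B n).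
    by rewrite -(umassD (mB n) mDB (setDIK _ _)) setDUK.
  have e2 : len D = len (B n) + len (D `\` B n).
    by rewrite -(lenD (mB n) mDB (setDIK _ _)) setDUK.
  by have := umass_le_len mDB; rewrite e1 e2; lra.
have cv : umass (B n) @[n --> \oo] --> umass D.
  have lo : umass D - M * (len D - len (B n)) @[n --> \oo] --> umass D.
    rewrite -[X in _ --> X]subr0 -[X in _ - X](mulr0 M) -[X in M * X](subrr (len D)).
    apply: cvgB; first exact: cvg_cst.
    apply: cvgMr; apply: cvgB; first exact: cvg_cst.
    under eq_cvg do rewrite lenB.
    exact: len_bigcup_cvg.
  by apply: (squeeze_cvgr _ lo (cvg_cst (umass D))); apply: nearW => n; rewrite le1 le2.
apply: (@cvg_trans _ ((umass (B n))%:E @[n --> \oo])); last first.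
  by apply: cvg_EFin; [exact: nearW|exact: cv].
apply: near_eq_cvg; apply: nearW => n.
by rewrite /umeas big_mkord sumEFin eqB.
Qed.

HB.instance Definition _ := isMeasure.Build _ _ _ umeas
  umeas0 umeas_ge0 umeas_sigma_additive.

Let umeasT : umeas setT = 1%E.
Proof. by rewrite /umeas umassT. Qed.

HB.instance Definition _ := @Measure_isProbability.Build _ _ R umeas umeasT.

Variable T : R -> R.
Hypothesis mT : measurable_fun (@Ihalf R) T.
Hypothesis rays : forall a,
  mass (phi i) (T @^-1` `[a, +oo[ `&` Ihalf) - mass (phi i) `[a, +oo[ @[i --> U] --> 0.

Let T' : measurableTypeR R -> measurableTypeR R := T \_ Ihalf.

Let mT' : measurable_fun setT T'.
Proof. exact: (measurable_restrictT _ measurable_Ihalf).1. Qed.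

Lemma measurable_preimage_Ihalf A : measurable A -> measurable (T @^-1` A `&` Ihalf).
Proof. by move=> mA; rewrite setIC; exact: mT measurable_Ihalf _ mA. Qed.

Let preT' A : T' @^-1` A `&` Ihalf = T @^-1` A `&` Ihalf.
Proof.
by apply/seteqP; split => x [+ Ix]; rewrite /T' /= patchE mem_set.
Qed.

Lemma umass_invariant A : measurable A -> umass (T @^-1` A `&` Ihalf) = umass A.
Proof.
move=> mA; have mpre B : measurable B -> measurable (T' @^-1` B).
  by move=> mB; rewrite -[_ @^-1` _]setTI; exact: mT'.
have e B : measurable B -> umass (T @^-1` B `&` Ihalf) = umass (T' @^-1` B).
  move=> mB; apply: umass_ext; [exact: measurable_preimage_Ihalf|exact: mpre|].
  by rewrite -setIA setIid preT'.
rewrite e//; apply: EFin_inj.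
change (pushforward umeas T' A = umeas A).
apply: (@measure_unique _ R (measurableTypeR R) (@RGenCInfty.G R)
  (fun n => `[- n%:R, +oo[%classic : set R)) => //.
- exact: RGenCInfty.measurableE.
- move=> _ _ [x ->] [y ->]; exists (Num.max x y); apply/seteqP.
  split=> z; rewrite /= !in_itv/= !andbT ge_max; first by move=> [-> ->].
  by move=> /andP[].
- by move=> n; exists (- n%:R).
- apply/seteqP; split => // x _; exists (Num.bound `|x|) => //=.
  rewrite in_itv/= andbT lerNl (le_trans (ler_norm _))// normrN.
  by rewrite ltW// archi_boundP.
- move=> _ [a ->]; congr EFin.
  change (umass (T' @^-1` `[a, +oo[) = umass `[a, +oo[).
  rewrite -e//; apply/eqP; rewrite -subr_eq0; apply/eqP.
  apply: (cvg_unique _ _ (rays a)) => //.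
  by apply: cvgB; apply: umass_cvg => //; exact: measurable_preimage_Ihalf.
- by move=> n; rewrite ltry.
Qed.

(** Absolute continuity comes from [umass_le_len].  Invariance on the rays, a
    pi-system that generates the Borel sets, is invariance on all of them. *)
Lemma umeas_acip : is_acip T [the probability (measurableTypeR R) R of umeas].
Proof.
split => /=.
- rewrite -[RHS]umeasT /umeas; congr EFin; apply: umass_ext => //.
    exact: measurable_Ihalf.
  by rewrite setIid setTI.
- apply/null_content_dominatesP => A mA A0.
  change ((umass A)%:E = 0%:E); congr EFin.
  apply/eqP; rewrite eq_le umass_ge0 andbT.
  rewrite (le_trans (umass_le_len mA))// /len.
  rewrite (_ : mu (A `&` Ihalf) = 0%E) ?mulr0//.
  apply: (@subset_measure0 _ _ _ mu _ A) => //.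
  exact: (measurableI _ _ mA measurable_Ihalf).
- move=> A mA AI; rewrite /umeas setIC; congr EFin; exact: umass_invariant.
Qed.

End Limit.

Lemma measurable_bin N r : measurable (bin N r : set R).
Proof. exact: measurable_itv. Qed.

Lemma len_bin N r : (r < N)%N -> len (bin N r) = N%:R^-1.
Proof.
move=> rN; have N0 : 0 < N%:R :> R by rewrite ltr0n; case: N rN.
rewrite /len (_ : bin N r `&` Ihalf = bin N r); last first.
  by apply/setIidl => x; exact: bin_Ihalf.
rewrite /bin lebesgue_measure_itv/= lte_fin ltrD2l ltr_pM2r ?invr_gt0// ltr_nat ltnSn.
by rewrite -EFinB/= -[r.+1%:R]natr1 mulrDl mul1r; lra.
Qed.

Lemma integral_Ihalf_bins N (f : R -> \bar R) : (0 < N)%N ->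
  measurable_fun Ihalf f -> (forall x, Ihalf x -> (0 <= f x)%E) ->
  (\int[mu]_(x in Ihalf) f x = \sum_(r < N) \int[mu]_(x in bin N r) f x)%E.
Proof.
move=> N0 mf f0; have NR : 0 < N%:R :> R by rewrite ltr0n.
(* The cells cover the interval up to its right end, a null set. *)
pose J n : set R := `[- 2^-1, - 2^-1 + n%:R / N%:R[%classic.
have JI n : (n <= N)%N -> J n `<=` Ihalf.
  move=> nN x; rewrite /J /Ihalf/= !in_itv/= => /andP[h1 h2].
  have : n%:R / N%:R <= 1 :> R by rewrite ler_pdivrMr// mul1r ler_nat.
  by move=> h; apply/andP; split; lra.
have JE : (\int[mu]_(x in Ihalf) f x = \int[mu]_(x in J N) f x)%E.
  have mfo : measurable_fun (`]- 2^-1, 2^-1[%classic : set R) f.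
    apply: measurable_funS mf => //; first exact: measurable_Ihalf.
    by move=> x; rewrite /Ihalf/= !in_itv/= => /andP[h1 h2]; rewrite !ltW.
  rewrite /J divff ?gt_eqF// (_ : - 2^-1 + 1 = 2^-1 :> R); last by lra.
  by rewrite /Ihalf integral_itv_bndoo// [RHS]integral_itv_bndoo.
rewrite JE.
suff H n : (n <= N)%N ->
    (\int[mu]_(x in J n) f x = \sum_(r < n) \int[mu]_(x in bin N r) f x)%E by exact: H.
elim: n => [|n IH] nN.
  by rewrite big_ord0 /J mul0r addr0 set_itvco0 integral_set0.
rewrite big_ord_recr/= -IH; last exact: ltnW.
have JS : J n.+1 = J n `|` bin N n.
  apply/seteqP; split => x; rewrite /J /bin /= !in_itv/=.
    move=> /andP[h1 h2]; have [h3|h3] := ltP x (- 2^-1 + n%:R / N%:R).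
      by left; rewrite h1.
    by right.
  have q0 : 0 <= n%:R / N%:R :> R by exact: divr_ge0.
  have q1 : n%:R / N%:R <= n.+1%:R / N%:R :> R by rewrite ler_pM2r ?invr_gt0// ler_nat.
  by move=> [] /andP[h1 h2]; apply/andP; split; lra.
rewrite JS ge0_integral_setU//.
- exact: measurable_itv.
- exact: measurable_itv.
- apply: measurable_funS mf; first exact: measurable_Ihalf.
  by rewrite -JS; exact: JI.
- by move=> x; rewrite -JS => /(JI _ nN); exact: f0.
- apply/disj_setPS => x; rewrite /J /bin /= !in_itv/= => -[/andP[_ h1] /andP[h2 _]].
  by move: h1; rewrite ltNge h2.
Qed.

Section Oscillation.
Variables (P : nat) (c : R) (f : R -> R) (M : R).
Hypothesis f0 : forall x, 0 <= f x.
Hypothesis fM : forall x, Ihalf x -> f x <= M.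
Hypothesis mesh : forall l (z z' : nat -> R), (0 < l)%N ->
  (forall r, (r < l ^ P)%N -> bin (l ^ P) r (z r) /\ bin (l ^ P) r (z' r)) ->
  \sum_(r < l ^ P) (l ^ P)%:R^-1 * (f (z r) - f (z' r)) <= c / l%:R.

Definition binf N r : R := inf (f @` bin N r).
Definition bsup N r : R := sup (f @` bin N r).

Lemma bin_nonempty N r : (r < N)%N -> f @` bin N r !=set0.
Proof.
move=> rN; have N0 : 0 < N%:R :> R by rewrite ltr0n; case: N rN.
exists (f (- 2^-1 + r%:R / N%:R)), (- 2^-1 + r%:R / N%:R) => //.
by rewrite /bin/= in_itv/= lexx/= ltrD2l ltr_pM2r ?invr_gt0// ltr_nat.
Qed.

Lemma bin_has_sup N r : (r < N)%N -> has_sup (f @` bin N r).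
Proof.
move=> rN; split; first exact: bin_nonempty.
by exists M => _ [x /(bin_Ihalf rN) Ix <-]; exact: fM.
Qed.

Lemma bin_has_inf N r : (r < N)%N -> has_inf (f @` bin N r).
Proof.
move=> rN; split; first exact: bin_nonempty.
by exists 0 => _ [x _ <-].
Qed.

Lemma binf_le N r x : (r < N)%N -> bin N r x -> binf N r <= f x.
Proof. by move=> rN bx; apply: ge_inf; [have [] := bin_has_inf rN|exists x]. Qed.

Lemma bsup_ge N r x : (r < N)%N -> bin N r x -> f x <= bsup N r.
Proof. by move=> rN bx; apply: sup_ubound; [have [] := bin_has_sup rN|exists x]. Qed.

Lemma binf_ge0 N r : (r < N)%N -> 0 <= binf N r.
Proof. by move=> rN; apply: lb_le_inf; [exact: bin_nonempty|move=> _ [x _ <-]]. Qed.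

Lemma bsup_le N r : (r < N)%N -> bsup N r <= M.
Proof.
move=> rN; apply: ge_sup; first exact: bin_nonempty.
by move=> _ [x /(bin_Ihalf rN) Ix <-]; exact: fM.
Qed.

Lemma binf_le_bsup N r : (r < N)%N -> binf N r <= bsup N r.
Proof.
move=> rN; have [_ [x bx _]] := bin_nonempty rN.
exact: le_trans (binf_le rN bx) (bsup_ge rN bx).
Qed.

(** The hypothesis speaks of one choice of two points per cell; take points that
    nearly attain the supremum and the infimum. *)
Lemma sum_osc_le l : (0 < l)%N ->
  \sum_(r < l ^ P) (l ^ P)%:R^-1 * (bsup (l ^ P) r - binf (l ^ P) r) <= c / l%:R.
Proof.
move=> l0; set N := (l ^ P)%N; have N0 : (0 < N)%N by rewrite expn_gt0 l0.
have NR : 0 < N%:R :> R by rewrite ltr0n.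
apply/ler_addgt0Pr => e e0.
have e2 : 0 < e / 2 by rewrite divr_gt0.
pose z r := xget 0 [set x | bin N r x /\ bsup N r - e / 2 < f x].
pose z' r := xget 0 [set x | bin N r x /\ f x < binf N r + e / 2].
have zP r : (r < N)%N -> bin N r (z r) /\ bsup N r - e / 2 < f (z r).
  move=> rN; have [_ [x bx <-] h] := sup_adherent e2 (bin_has_sup rN).
  by apply: (@xgetPex _ 0 [set x | bin N r x /\ bsup N r - e / 2 < f x]); exists x.
have z'P r : (r < N)%N -> bin N r (z' r) /\ f (z' r) < binf N r + e / 2.
  move=> rN; have [_ [x bx <-] h] := inf_adherent e2 (bin_has_inf rN).
  by apply: (@xgetPex _ 0 [set x | bin N r x /\ f x < binf N r + e / 2]); exists x.
apply: (@le_trans _ _ (\sum_(r < N) N%:R^-1 * (f (z r) - f (z' r)) + e)).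
  rewrite -[X in _ <= _ + X](_ : \sum_(r < N) N%:R^-1 * e = e); last first.
    by rewrite sumr_const card_ord -[LHS]mulr_natl mulrA divff ?mul1r// gt_eqF.
  rewrite -big_split/=; apply: ler_sum => r _.
  rewrite -mulrDr ler_wpM2l ?invr_ge0 ?(ltW NR)//.
  have [_ h1] := zP r (ltn_ord r); have [_ h2] := z'P r (ltn_ord r); lra.
rewrite lerD2r; apply: mesh => // r rN.
by have [? _] := zP r rN; have [? _] := z'P r rN.
Qed.

End Oscillation.
(** Where the two functions are ordered, their L1 distance is a difference of
    masses. *)
Lemma integral_dist (f g : R -> R) A (m m' : R) : measurable A -> A `<=` Ihalf ->
  measurable_fun Ihalf f -> measurable_fun Ihalf g ->
  (forall x, A x -> 0 <= g x <= f x) ->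
  (\int[mu]_(x in A) (f x)%:E = m%:E)%E -> (\int[mu]_(x in A) (g x)%:E = m'%:E)%E ->
  (\int[mu]_(x in A) `|f x - g x|%:E = (m - m')%:E)%E.
Proof.
move=> mA AI mf mg fg fm gm.
have mfA : measurable_fun A f by exact: measurable_funS measurable_Ihalf AI mf.
have mgA : measurable_fun A g by exact: measurable_funS measurable_Ihalf AI mg.
have e : (\int[mu]_(x in A) `|f x - g x|%:E + m'%:E = m%:E)%E.
  rewrite -fm -gm -ge0_integralD//.
  - apply: eq_integral => x; rewrite inE => /fg /andP[_ h].
    by rewrite -EFinD ger0_norm ?subr_ge0// subrK.
  - apply/measurable_EFinP; apply: measurableT_comp => //; exact: measurable_funB.
  - by move=> x /fg /andP[h _]; rewrite lee_fin.
  - exact/measurable_EFinP.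
rewrite EFinB -e -addeA -EFinB subrr adde0//.
Qed.

(** * From set-wise convergence to convergence in L1 *)

Section L1Limit.
Context {I : Type} (P : nat) (c M : R).
Variables (U : set_system I) (phi : I -> R -> R).
Hypothesis UU : UltraFilter U.
Hypothesis c0 : 0 <= c.
Hypothesis mphi : forall i, measurable_fun setT (phi i).
Hypothesis phi0 : forall i x, 0 <= phi i x.
Hypothesis phiM : forall i x, Ihalf x -> phi i x <= M.
Hypothesis intphi : forall i, (\int[mu]_(x in Ihalf) (phi i x)%:E = 1)%E.
Hypothesis mesh : forall i l (z z' : nat -> R), (0 < l)%N ->
  (forall r, (r < l ^ P)%N -> bin (l ^ P) r (z r) /\ bin (l ^ P) r (z' r)) ->
  \sum_(r < l ^ P) (l ^ P)%:R^-1 * (phi i (z r) - phi i (z' r)) <= c / l%:R.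
Variable h : R -> R.
Hypothesis mh : measurable_fun Ihalf h.
Hypothesis h0 : forall x, Ihalf x -> 0 <= h x.
Hypothesis hU : forall A, measurable A -> A `<=` Ihalf ->
  (\int[mu]_(x in A) (h x)%:E = (umass U phi A)%:E)%E.

Definition uinf N r := lim (binf (phi i) N r @[i --> U]).
Definition usup N r := lim (bsup (phi i) N r @[i --> U]).

Lemma uinf_cvg N r : (r < N)%N -> binf (phi i) N r @[i --> U] --> uinf N r.
Proof.
move=> rN; apply: (@ultra_bounded_cvg _ _ _ UU _ 0 M) => i.
rewrite (binf_ge0 (phi0 i) rN)/=.
exact: le_trans (binf_le_bsup (phi0 i) (@phiM i) rN) (bsup_le (@phiM i) rN).
Qed.

Lemma usup_cvg N r : (r < N)%N -> bsup (phi i) N r @[i --> U] --> usup N r.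
Proof.
move=> rN; apply: (@ultra_bounded_cvg _ _ _ UU _ 0 M) => i.
rewrite (bsup_le (@phiM i) rN) andbT.
exact: le_trans (binf_ge0 (phi0 i) rN) (binf_le_bsup (phi0 i) (@phiM i) rN).
Qed.

Lemma umass_ge_uinf N r A : (r < N)%N -> measurable A -> A `<=` bin N r ->
  uinf N r * len A <= umass U phi A.
Proof.
move=> rN mA Ab.
have cv : binf (phi i) N r * len A @[i --> U] --> uinf N r * len A.
  by apply: cvgMr_tmp; exact: uinf_cvg.
apply: (ulim_le UU cv (umass_cvg UU mphi phi0 intphi mA)) => i.
apply: mass_ge => //; first exact: binf_ge0.
by move=> x /Ab bx _; apply: binf_le.
Qed.

Lemma umass_le_usup N r A : (r < N)%N -> measurable A -> A `<=` bin N r ->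
  umass U phi A <= usup N r * len A.
Proof.
move=> rN mA Ab.
have cv : bsup (phi i) N r * len A @[i --> U] --> usup N r * len A.
  by apply: cvgMr_tmp; exact: usup_cvg.
apply: (ulim_le UU (umass_cvg UU mphi phi0 intphi mA) cv) => i.
have b0 : 0 <= bsup (phi i) N r.
  exact: le_trans (binf_ge0 (phi0 i) rN) (binf_le_bsup (phi0 i) (@phiM i) rN).
by apply: mass_le => // x /Ab bx _; apply: (bsup_ge (@phiM i) rN).
Qed.

Lemma cvg_sumr (K : set_system I) (FK : Filter K) n (u : 'I_n -> I -> R) (v : 'I_n -> R) :
  (forall r, u r i @[i --> K] --> v r) -> \sum_(r < n) u r i @[i --> K] --> \sum_(r < n) v r.
Proof. by move=> uv; apply: cvg_big => //; exact: add_continuous. Qed.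

(** Bounds the mean distance on a cell between the [i]-th density and the limit
    density.  Its first term is the oscillation that remains in the limit; the
    others vanish along the ultrafilter. *)
Definition bin_gap i N r : R := (usup N r - uinf N r) +
  (`|bsup (phi i) N r - usup N r| + `|binf (phi i) N r - uinf N r|).

(** Split the cell according to the sign of [phi i - h].  On each part the distance
    is a difference of two masses, which are bounded by the extrema of [phi i] and
    by their limits times the length of the part. *)
Lemma bin_dist_le i N r : (r < N)%N ->
  (\int[mu]_(x in bin N r) `|phi i x - h x|%:E <= (N%:R^-1 * bin_gap i N r)%:E)%E.
Proof.
move=> rN; have mI := @measurable_Ihalf R.
have bI : (bin N r : set R) `<=` Ihalf by move=> x; exact: (bin_Ihalf rN).
have mpI : measurable_fun Ihalf (phi i) by exact: measurable_funTS.
have md : measurable_fun Ihalf (fun x => phi i x - h x) by exact: measurable_funB.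
pose E := Ihalf `&` (fun x => phi i x - h x) @^-1` `[0, +oo[.
have mE : measurable E by exact: md.
pose A := bin N r `&` E; pose B := bin N r `\` E.
have mA : measurable A by exact: (measurableI _ _ (measurable_bin N r) mE).
have mB : measurable B by exact: (measurableD (measurable_bin N r) mE).
have AB : bin N r = A `|` B by rewrite /A /B setUIDK.
have dAB : A `&` B = set0.
  by apply/seteqP; split => // x [[_ Ex] [_ nEx]].
have Ab : A `<=` bin N r by move=> x [].
have Bb : B `<=` bin N r by move=> x [].
have AI : A `<=` Ihalf := subset_trans Ab bI.
have BI : B `<=` Ihalf := subset_trans Bb bI.
have iA : (\int[mu]_(x in A) (phi i x)%:E = (mass (phi i) A)%:E)%E.
  by rewrite (massE (mphi i) (phi0 i) (intphi i) mA) (setIidl AI).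
have iB : (\int[mu]_(x in B) (phi i x)%:E = (mass (phi i) B)%:E)%E.
  by rewrite (massE (mphi i) (phi0 i) (intphi i) mB) (setIidl BI).
have dA : (\int[mu]_(x in A) `|phi i x - h x|%:E = (mass (phi i) A - umass U phi A)%:E)%E.
  apply: integral_dist => //; last exact: hU.
  move=> x [_ [Ix]]; rewrite /= in_itv/= andbT subr_ge0 => ->.
  by rewrite h0.
have dB : (\int[mu]_(x in B) `|phi i x - h x|%:E = (umass U phi B - mass (phi i) B)%:E)%E.
  under eq_integral => x _ do rewrite distrC.
  apply: integral_dist => //; last exact: hU.
  move=> x [bx nE]; rewrite phi0/= leNgt; apply/negP => hx; apply: nE.
  by split; [exact: bI|rewrite /= in_itv/= andbT subr_ge0 ltW].
have lenAB : N%:R^-1 = len A + len B by rewrite -(lenD mA mB dAB) -AB len_bin.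
rewrite AB ge0_integral_setU//; last 2 first.
- rewrite -AB; apply: measurable_funS mI bI _.
  by apply/measurable_EFinP; exact: measurableT_comp.
- by apply/disj_setPS; rewrite dAB.
rewrite dA dB -EFinD lee_fin lenAB.
have b0 : 0 <= bsup (phi i) N r.
  exact: le_trans (binf_ge0 (phi0 i) rN) (binf_le_bsup (phi0 i) (@phiM i) rN).
have h1 : mass (phi i) A <= bsup (phi i) N r * len A.
  by apply: mass_le => // x /Ab bx _; apply: (bsup_ge (@phiM i) rN).
have h2 := umass_ge_uinf rN mA Ab.
have h3 := umass_le_usup rN mB Bb.
have h4 : binf (phi i) N r * len B <= mass (phi i) B.
  apply: mass_ge => //; first exact: binf_ge0.
  by move=> x /Bb bx _; apply: binf_le.
have s0 : bsup (phi i) N r - uinf N r <= bin_gap i N r.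
  rewrite /bin_gap; have := ler_norm (bsup (phi i) N r - usup N r).
  have := normr_ge0 (binf (phi i) N r - uinf N r); lra.
have s1 : usup N r - binf (phi i) N r <= bin_gap i N r.
  rewrite /bin_gap; have := lerNnormlW (lexx `|binf (phi i) N r - uinf N r|).
  have := normr_ge0 (bsup (phi i) N r - usup N r); lra.
have k1 := ler_wpM2r (len_ge0 A) s0.
have k2 := ler_wpM2r (len_ge0 B) s1.
rewrite !mulrBl in k1 k2; rewrite mulrDl; lra.
Qed.

Lemma L1_dist_le i N : (0 < N)%N ->
  (L1_dist (phi i) h <= (\sum_(r < N) N%:R^-1 * bin_gap i N r)%:E)%E.
Proof.
move=> N0; rewrite /L1_dist (integral_Ihalf_bins N0).
- rewrite -sumEFin; apply: lee_sum => r _; exact: bin_dist_le.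
- apply/measurable_EFinP; apply: measurableT_comp => //.
  by apply: measurable_funB => //; exact: measurable_funTS.
- by move=> x _; rewrite lee_fin.
Qed.

Lemma L1_limit_ultra : L1_dist (phi i) h @[i --> U] --> 0%E.
Proof.
have UP : ProperFilter U by case: UU.
have key e : 0 < e -> \forall i \near U, (L1_dist (phi i) h <= e%:E)%E.
  move=> e0; pose l := (Num.bound (c / (e / 2))).+1.
  have lR : 0 < l%:R :> R by rewrite ltr0n.
  have cl : c / l%:R <= e / 2.
    have h1 : c / (e / 2) <= l%:R.
      rewrite (le_trans (ltW (archi_boundP _)))// ?divr_ge0// ?(ltW e0)//.
      by rewrite ler_nat.
    by rewrite ler_pdivrMr// mulrC -ler_pdivrMr// divr_gt0.
  pose N := (l ^ P)%N; have N0 : (0 < N)%N by rewrite expn_gt0.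
  have cv : \sum_(r < N) N%:R^-1 * bin_gap i N r @[i --> U] -->
      \sum_(r < N) N%:R^-1 * (usup N r - uinf N r).
    apply: cvg_sumr => r; apply: cvgMl_tmp.
    rewrite -[X in _ --> X]addr0 -[X in _ --> _ + X](addr0 0).
    apply: cvgD; first exact: cvg_cst.
    have dist0 (x : I -> R) a : x i @[i --> U] --> a -> `|x i - a| @[i --> U] --> 0.
      move=> xa; rewrite -(normr0 R) -(subrr a); apply: cvg_norm.
      by apply: cvgB => //; exact: cvg_cst.
    by apply: cvgD; apply: dist0; [exact: usup_cvg | exact: uinf_cvg].
  have bnd : \sum_(r < N) N%:R^-1 * (usup N r - uinf N r) <= c / l%:R.
    have cv' : \sum_(r < N) N%:R^-1 * (bsup (phi i) N r - binf (phi i) N r) @[i --> U] -->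
      \sum_(r < N) N%:R^-1 * (usup N r - uinf N r).
      apply: cvg_sumr => r; apply: cvgMl_tmp.
      by apply: cvgB; [exact: usup_cvg | exact: uinf_cvg].
    apply: (ulim_le UU cv' (cvg_cst _)) => i.
    exact: (sum_osc_le (phi0 i) (@phiM i) (@mesh i) (ltn0Sn _)).
  have lt : \sum_(r < N) N%:R^-1 * (usup N r - uinf N r) < e by lra.
  near=> i; apply: (le_trans (L1_dist_le i N0)); rewrite lee_fin.
  near: i; exact: (cvgr_le _ cv).
apply/fine_cvgP; split.
  apply: filterS (key 1 ltr01) => i h1; rewrite ge0_fin_numE.
    by rewrite (le_lt_trans h1)// ltry.
  by apply: integral_ge0 => x _; rewrite lee_fin.
apply/cvgr0Pnorm_le => e e0; apply: filterS (key e e0) => i h1 /=.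
have p0 : (0 <= L1_dist (phi i) h)%E by apply: integral_ge0 => x _; rewrite lee_fin.
rewrite ger0_norm ?fine_ge0// -lee_fin fineK// ge0_fin_numE//.
by rewrite (le_lt_trans h1)// ltry.
Unshelve. all: by end_near.
Qed.

End L1Limit.

(** Compactness principle: a limit along an ultrafilter exists without passing to
    subsequences, and uniqueness of the acip identifies all these limits. *)
Lemma L1_limit (I : Type) (F : set_system I) (phi : I -> R -> R) (P : nat) (c M : R)
    (T : R -> R) (nu : probability (measurableTypeR R) R) (h : R -> R) :
  ProperFilter F -> 0 <= c -> 0 <= M ->
  (forall i, measurable_fun setT (phi i)) -> (forall i x, 0 <= phi i x) ->
  (forall i x, Ihalf x -> phi i x <= M) ->
  (forall i, (\int[mu]_(x in Ihalf) (phi i x)%:E = 1)%E) ->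
  (forall i l (z z' : nat -> R), (0 < l)%N ->
    (forall r, (r < l ^ P)%N -> bin (l ^ P) r (z r) /\ bin (l ^ P) r (z' r)) ->
    \sum_(r < l ^ P) (l ^ P)%:R^-1 * (phi i (z r) - phi i (z' r)) <= c / l%:R) ->
  measurable_fun Ihalf T ->
  (forall a, mass (phi i) (T @^-1` `[a, +oo[ `&` Ihalf) - mass (phi i) `[a, +oo[
    @[i --> F] --> 0) ->
  is_unique_acip T nu -> is_density h nu ->
  L1_dist (phi i) h @[i --> F] --> 0%E.
Proof.
move=> FF c0 M0 mphi phi0 phiM intphi mesh mT rays [_ uniq] [mh h0 hnu].
apply: (@ultra_cvg R) => U UU FU.
have raysU a : mass (phi i) (T @^-1` `[a, +oo[ `&` Ihalf) - mass (phi i) `[a, +oo[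
    @[i --> U] --> 0
  by move=> V Vl; apply: FU; exact: (rays a V Vl).
have acip := umeas_acip UU mphi phi0 M0 phiM intphi mT raysU.
apply: (L1_limit_ultra UU c0 mphi phi0 phiM intphi mesh mh h0) => A mA AI.
by rewrite -hnu// -(uniq _ acip A mA).
Qed.

End SetFunctions.

(** * Cesaro averages of the densities *)

Section Cesaro.
Context {R : realType}.
Local Notation mu := (@lebesgue_measure R).
Variables (T : R -> R) (O C theta : R).
Hypotheses (lT : lorenz_map T O) (C0 : 0 < C) (th1 : 1 < theta).
Hypothesis eT : expanding C theta T O.

Let dge0 k y : 0 <= dens T O k y := dens_ge0 lT C0 th1 eT k y.
Let mdens k : measurable_fun setT (dens T O k) := measurable_dens lT C0 th1 eT k.
Let intdens k : (\int[mu]_(x in Ihalf) (dens T O k x)%:E = 1)%E :=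
  integral_dens lT C0 th1 eT k.

Definition cesaro n (x : R) : R := n.+1%:R^-1 * \sum_(k < n.+1) dens T O k x.

Let n0 n : 0 < n.+1%:R :> R.
Proof. by rewrite ltr0n. Qed.

Let mean_cst n (a : R) : n.+1%:R^-1 * \sum_(k < n.+1) a = a.
Proof. by rewrite sumr_const card_ord -[a *+ _]mulr_natl mulKf// gt_eqF. Qed.

Lemma cesaro_ge0 n x : 0 <= cesaro n x.
Proof. by rewrite mulr_ge0 ?invr_ge0//; apply: sumr_ge0. Qed.

Lemma measurable_cesaro n : measurable_fun setT (cesaro n).
Proof.
apply: measurable_funM => //; apply: measurable_sum => k; exact: mdens.
Qed.

Lemma cesaro_le M n y : (forall k, dens T O k y <= M) -> cesaro n y <= M.
Proof.
move=> dM; rewrite -(mean_cst n M) ler_wpM2l ?invr_ge0//.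
by apply: ler_sum => k _.
Qed.

Lemma cesaro_mesh n N (w B : R) (z z' : nat -> R) :
  (forall k, \sum_(r < N) w * (dens T O k (z r) - dens T O k (z' r)) <= B) ->
  \sum_(r < N) w * (cesaro n (z r) - cesaro n (z' r)) <= B.
Proof.
move=> H; rewrite -(mean_cst n B).
rewrite (_ : \sum_(r < N) _ = n.+1%:R^-1 *
  \sum_(k < n.+1) \sum_(r < N) w * (dens T O k (z r) - dens T O k (z' r))).
  by rewrite ler_wpM2l ?invr_ge0//; apply: ler_sum => k _; exact: H.
rewrite exchange_big mulr_sumr; apply: eq_bigr => r _.
by rewrite /cesaro -mulr_sumr -mulrBr -sumrB; ring.
Qed.

Lemma integral_cesaro_in n D : measurable D ->
  (\int[mu]_(x in D) (cesaro n x)%:E =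
   n.+1%:R^-1%:E * \sum_(k < n.+1) \int[mu]_(x in D) (dens T O k x)%:E)%E.
Proof.
move=> mD; under eq_integral => x _ do rewrite EFinM.
rewrite ge0_integralZl//; last 2 first.
- by apply/measurable_EFinP; apply: measurable_sum => k; exact: measurable_funTS (mdens k).
- by move=> x _; rewrite lee_fin; exact: sumr_ge0.
under eq_integral => x _ do rewrite -sumEFin.
rewrite ge0_integral_sum//; last 2 first.
- by move=> k; apply/measurable_EFinP; exact: measurable_funTS (mdens k).
- by move=> k x _; rewrite lee_fin.
Qed.

Lemma mass_cesaro n A : measurable A ->
  mass (cesaro n) A = n.+1%:R^-1 * \sum_(k < n.+1) mass (dens T O k) A.
Proof.
move=> mA; have mI := measurableI _ _ mA (@measurable_Ihalf R).
rewrite {1}/mass integral_cesaro_in//.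
under eq_bigr => k _ do rewrite -(massE (mdens k) (dge0 k) (intdens k) mA).
by rewrite sumEFin -EFinM.
Qed.

Lemma integral_cesaro n : (\int[mu]_(x in Ihalf) (cesaro n x)%:E = 1)%E.
Proof.
rewrite integral_cesaro_in; last exact: measurable_Ihalf.
under eq_bigr => k _ do rewrite intdens.
by rewrite sumEFin -EFinM mean_cst.
Qed.

Lemma mass_dens_preimage k A : measurable A ->
  mass (dens T O k) (T @^-1` A `&` Ihalf) = mass (dens T O k.+1) A.
Proof.
move=> mA; rewrite /mass densS; congr fine.
have mAI := measurableI _ _ mA (@measurable_Ihalf R).
rewrite (integral_transfer lT C0 th1 eT mAI (mdens k) (dge0 k)).
congr (integral _ _ _); apply/seteqP; split => x /=.
  by move=> [[Ax Ix] _]; do !split => //; exact: (T_Ihalf lT Ix).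
by move=> [Ix [Ax _]].
Qed.

(** Transporting by [T] shifts the index by one, and the sum telescopes. *)
Lemma cesaro_invariant n A : measurable A ->
  `|mass (cesaro n) (T @^-1` A `&` Ihalf) - mass (cesaro n) A| <= n.+1%:R^-1.
Proof.
move=> mA; have mpre : measurable (T @^-1` A `&` @Ihalf R).
  exact: (measurable_preimage_Ihalf (measurable_T lT) mA).
rewrite !mass_cesaro// -mulrBr.
rewrite (eq_bigr (fun k : 'I_n.+1 => mass (dens T O k.+1) A)); last first.
  by move=> k _; exact: mass_dens_preimage.
rewrite -sumrB -(big_mkord xpredT (fun k => mass (dens T O k.+1) A - mass (dens T O k) A)).
rewrite telescope_sumr//.
rewrite normrM ger0_norm ?invr_ge0// ler_piMr ?invr_ge0//.
have m0 k := mass_ge0 (dge0 k) A.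
have m1 k := mass_le1 (mdens k) (dge0 k) (intdens k) mA.
have := m0 0; have := m1 0; have := m0 n.+1; have := m1 n.+1.
by rewrite ler_norml => *; apply/andP; split; lra.
Qed.

(** The preimage has the mass under [dens 1] of the interval itself. *)
Lemma len_preimage_itv M a b : a <= b -> (forall y, Ihalf y -> dens T O 1 y <= M) ->
  len (T @^-1` `[a, b] `&` Ihalf) <= M * (b - a).
Proof.
move=> ab dM.
have mab : measurable (`[a, b]%classic : set R) by exact: measurable_itv.
have M0 : 0 <= M.
  by apply: le_trans (dM 0 _); rewrite ?dge0// /Ihalf/= in_itv/=; apply/andP; split; lra.
have -> : len (T @^-1` `[a, b] `&` Ihalf) = mass (dens T O 0) (T @^-1` `[a, b] `&` Ihalf).
  rewrite /len /mass; congr fine.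
  transitivity (\int[mu]_(x in T @^-1` `[a, b] `&` Ihalf `&` Ihalf) (cst 1%E (x : R)))%E; last exact: eq_integral.
  rewrite integral_cst ?mul1e//; rewrite -setIA setIid.
  exact: (measurable_preimage_Ihalf (measurable_T lT) mab).
rewrite mass_dens_preimage//.
apply: (le_trans (mass_le (mdens 1) (dge0 1) (intdens 1) mab M0 _)); first by move=> x _; exact: dM.
rewrite ler_wpM2l// -lee_fin lenE//.
apply: (@le_trans _ _ (mu `[a, b]%classic)).
  by apply: le_measure; rewrite ?inE//; exact: (measurableI _ _ mab measurable_Ihalf).
rewrite lebesgue_measure_itv/= lte_fin.
by case: ltP => h; rewrite -?EFinB// lee_fin subr_ge0.
Qed.

End Cesaro.

(** * The family of maps *)

Section Final.
Context {R : realType}.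
Local Notation mu := (@lebesgue_measure R).

(** [P] is an integer above [p = 1 / alpha]; the lengths [delta n] are selected
    simultaneously for all [n]. *)
Lemma uniform_family (alpha emax : R) (X : R -> lorenz_system R) :
  lorenz_family alpha emax X ->
  exists (C theta V : R) (P : nat) (delta : nat -> R),
    [/\ 0 < C, 1 < theta, 0 <= V, (0 < P)%N &
        (forall n, (0 < n)%N -> 0 < delta n) /\
        (forall e, 0 <= e < emax ->
          uniform_map C theta V P delta (base (X e)) (sing (X e)))].
Proof.
move=> lf; have [C [theta [C0 th1 eT]]] := lf_expanding lf.
have [W W0 HW] := lf_variation lf.
have /andP[al0 _] := lf_alpha lf.
have p0 : 0 < alpha^-1 by rewrite invr_gt0.
pose P := Num.bound alpha^-1.
have pP : alpha^-1 <= P%:R by apply/ltW/archi_boundP/ltW.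
have P0 : (0 < P)%N by rewrite -(ltr_nat R) (lt_le_trans p0).
pose G := (C * theta)^-1.
have G0 : 0 < G by rewrite invr_gt0 mulr_gt0// (lt_trans _ th1).
pose V := G ^+ P * (W `^ alpha^-1 * G^-1 `^ alpha^-1).
have V0 : 0 <= V by rewrite mulr_ge0 ?exprn_ge0 ?(ltW G0)// mulr_ge0 ?powR_ge0.
have /choice[delta deltaP] : forall n : nat, exists d : R, (0 < n)%N -> 0 < d /\
    forall e : R, 0 <= e < emax -> forall J,
      refinement (base (X e)) (branches (sing (X e))) n J -> (d%:E <= mu J)%E.
  move=> n; have [n0|n0] := posnP n; first by exists 0.
  by have [d d0 H] := lf_partition lf n0; exists d.
exists C, theta, V, P, delta; split => //; split => [n n0|e eP].
  by have [] := deltaP n n0.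
have lT := lt_base (lf_type lf eP); split => //; [exact: eT| |by move=> n n0 J; have [_] := deltaP n n0; apply].
move=> b c sc cb.
apply: (@sum_expr_le_pvariation R (fun x => (derI (base (X e)) x)^-1)
  alpha^-1 W G P (branch (sing (X e)) b)) => //.
- exact: ltW.
- move=> x bx; rewrite (ltW (dinv_gt0 lT C0 th1 (eT e eP) bx))/=.
  exact: (dinv_le lT C0 th1 (eT e eP) bx).
- apply: HW => //; exact: branches_branch.
Qed.

Lemma exists_root (theta : R) N : 1 < theta -> exists2 v : R, 1 < v & v ^+ N <= theta.
Proof.
move=> th1; pose v := theta `^ N.+1%:R^-1.
have v0 : 0 <= v by exact: powR_ge0.
have vE : v ^+ N.+1 = theta.
  rewrite -powR_mulrn// /v -powRrM mulVf ?pnatr_eq0// powRr1//.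
  by rewrite (le_trans ler01)// ltW.
have v1 : 1 < v.
  rewrite ltNge; apply/negP => v1; move: th1; rewrite -vE ltNge.
  by rewrite exprn_ile1.
exists v => //; rewrite -[leRHS]vE; apply: ler_weXn2l => //; exact: ltW.
Qed.

Lemma L1_dist_ge0 (f g : R -> R) : (0 <= L1_dist f g)%E.
Proof. by apply: integral_ge0 => x _; rewrite lee_fin. Qed.

Lemma L1_dist_triangle (f g k : R -> R) : measurable_fun Ihalf f ->
  measurable_fun Ihalf g -> measurable_fun Ihalf k ->
  (L1_dist g k <= L1_dist f g + L1_dist f k)%E.
Proof.
move=> mf mg mk; have mI := @measurable_Ihalf R.
have md (a b : R -> R) : measurable_fun Ihalf a -> measurable_fun Ihalf b ->
    measurable_fun Ihalf (fun x => `|a x - b x|%:E).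
  move=> ma mb; apply/measurable_EFinP; apply: measurableT_comp => //.
  exact: measurable_funB.
rewrite /L1_dist -ge0_integralD//; last 2 first.
- exact: md.
- exact: md.
apply: ge0_le_integral => //.
- exact: md.
- by apply: emeasurable_funD; exact: md.
move=> x _; rewrite -EFinD lee_fin -[f x - g x]opprB normrN.
by rewrite (le_trans _ (ler_normD _ _))// addrA subrK.
Qed.

Lemma norm_sub_transfer (p q r s d b : R) : `|p - r| <= d -> p <= q + s -> q <= p + s ->
  s <= b / 2 -> d <= b / 2 -> `|q - r| <= b.
Proof. by rewrite !ler_norml => /andP[h1 h2] *; apply/andP; split; lra. Qed.

(** A point outside [H] that only one of the two maps sends into the ray has both
    its images within [d] of the end of the ray. *)
Lemma ray_le_close (T0 T1 : R -> R) (H : set R) (a d : R) :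
  (forall x, Ihalf x -> ~ H x -> `|T1 x - T0 x| <= d) ->
  (T1 @^-1` `[a, +oo[ `&` Ihalf `<=` (T0 @^-1` `[a, +oo[ `&` Ihalf) `|`
     (H `|` (T0 @^-1` `[a - d, a + d] `&` Ihalf))) /\
  (T0 @^-1` `[a, +oo[ `&` Ihalf `<=` (T1 @^-1` `[a, +oo[ `&` Ihalf) `|`
     (H `|` (T0 @^-1` `[a - d, a + d] `&` Ihalf))).
Proof.
move=> close; split => x [+ Ix]; rewrite /= in_itv/= andbT => ax;
  have [Hx|nHx] := pselect (H x); try (by right; left);
  have := close x Ix nHx; rewrite ler_norml => /andP[c1 c2].
- have [ha|ha] := leP a (T0 x); first by left; split => //=; rewrite in_itv/= andbT.
  by right; right; split => //=; rewrite in_itv/=; apply/andP; split; lra.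
- have [ha|ha] := leP a (T1 x); first by left; split => //=; rewrite in_itv/= andbT.
  by right; right; split => //=; rewrite in_itv/=; apply/andP; split; lra.
Qed.

End Final.

Theorem proposition3p6 (R : realType) (alpha emax : R)
    (X : R -> lorenz_system R)
    (mu : R -> probability (measurableTypeR R) R) (h : R -> R -> R) :
  lorenz_family alpha emax X ->
  (forall e : R, 0 <= e < emax ->
     is_unique_acip (base (X e)) (mu e) /\ is_density (h e) (mu e)) ->
  L1_dist (h e) (h 0) @[e --> 0^'+] --> 0%E.
Proof.
move=> lf acip; have emax0 := lf_emax lf.
have [C [theta [V [P [delta [C0 th1 V0 P0 [d0 uX]]]]]]] := uniform_family lf.
have [v v1 vth] := exists_root (P * P) th1.
have [M M0 HM] := dens_uniform_bound C0 th1 V0 P0 d0 v1 vth.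
have [c c0 Hc] := dens_uniform_mesh C0 th1 V0 P0 d0 v1 vth.
have lT e (eP : 0 <= e < emax) : lorenz_map (base (X e)) (sing (X e)) := um_lorenz (uX e eP).
have eT e (eP : 0 <= e < emax) : expanding C theta (base (X e)) (sing (X e)) :=
  um_expanding (uX e eP).
have in0 : 0 <= (0 : R) < emax by rewrite lexx.
pose A e n := cesaro (base (X e)) (sing (X e)) n.
have mA e n : 0 <= e < emax -> measurable_fun setT (A e n).
  by move=> eP; exact: (measurable_cesaro (lT e eP) C0 th1 (eT e eP)).
have A0 e n x : 0 <= e < emax -> 0 <= A e n x.
  by move=> eP; exact: (cesaro_ge0 (lT e eP) C0 th1 (eT e eP)).
have AM e n x : 0 <= e < emax -> Ihalf x -> A e n x <= M.
  by move=> eP Ix; apply: cesaro_le => k; exact: HM (uX e eP) k x Ix.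
have Aint e n : 0 <= e < emax -> (\int[lebesgue_measure]_(x in Ihalf) (A e n x)%:E = 1)%E.
  by move=> eP; exact: (integral_cesaro (lT e eP) C0 th1 (eT e eP)).
have Amesh e n l (z z' : nat -> R) : 0 <= e < emax -> (0 < l)%N ->
    (forall r, (r < l ^ P)%N -> bin (l ^ P) r (z r) /\ bin (l ^ P) r (z' r)) ->
    \sum_(r < l ^ P) (l ^ P)%:R^-1 * (A e n (z r) - A e n (z' r)) <= c / l%:R.
  by move=> eP l0 zb; apply: cesaro_mesh => k; exact: Hc (uX e eP) k l z z' l0 zb.
have Ainv e n B : 0 <= e < emax -> measurable B ->
    `|mass (A e n) (base (X e) @^-1` B `&` Ihalf) - mass (A e n) B| <= n.+1%:R^-1.
  by move=> eP mB; exact: (cesaro_invariant (lT e eP) C0 th1 (eT e eP)).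
have stepB e : 0 <= e < emax -> L1_dist (A e n) (h e) @[n --> \oo] --> 0%E.
  move=> eP; have [uniq dens] := acip e eP.
  apply: (@L1_limit R nat \oo (A e) P c M (base (X e)) (mu e)) => //.
  - exact: ltW.
  - by move=> n; exact: mA.
  - by move=> n x; exact: A0.
  - by move=> n x; exact: AM.
  - by move=> n; exact: Aint.
  - by move=> n l z z'; exact: Amesh.
  - exact: measurable_T (lT e eP).
  move=> a; apply/cvgr0Pnorm_le => eps eps0.
  apply: filterS (near_infty_natSinv_lt (PosNum eps0)) => n /ltW/=.
  by apply: le_trans; exact: Ainv.
have /choice[m mP] : forall e : R, exists m : nat, 0 < e < emax ->
    (L1_dist (A e m) (h e) <= e%:E)%E /\ m.+1%:R^-1 <= e.
  move=> e; have [/andP[e0 eM]|nP] := pselect (0 < e < emax); last by exists 0%N.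
  have eP : 0 <= e < emax by rewrite ltW.
  have c1 : \forall n \near \oo, (L1_dist (A e n) (h e) <= e%:E)%E.
    have /fine_cvgP[fin /cvgr0_norm_le/(_ _ e0)] := stepB e eP.
    apply: filterS2 fin => n fn /=.
    by rewrite ger0_norm ?fine_ge0 ?L1_dist_ge0// -lee_fin fineK.
  have c2 : \forall n \near \oo, n.+1%:R^-1 <= e.
    by apply: filterS (near_infty_natSinv_lt (PosNum e0)) => n /ltW.
  have [n [n1 n2]] := filter_ex (filterI c1 c2).
  by exists n.
(* Outside the range of the parameter use the member [e = 0], so that the
   bounds hold for all indices. *)
pose cl e : R := if 0 <= e < emax then e else 0.
have clP e : 0 <= cl e < emax by rewrite /cl; case: ifP.
have near_cl : \forall e \near 0^'+, 0 < e < emax.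
  near=> e; apply/andP; split; near: e; first exact: nbhs_right_gt.
  exact: nbhs_right_lt.
pose phi e := A (cl e) (m (cl e)).
have stepC : L1_dist (phi e) (h 0) @[e --> 0^'+] --> 0%E.
  have [uniq dens] := acip 0 in0.
  apply: (@L1_limit R R 0^'+ phi P c M (base (X 0)) (mu 0)) => //.
  - exact: ltW.
  - by move=> e; exact: mA.
  - by move=> e x; exact: A0.
  - by move=> e x; exact: AM.
  - by move=> e; exact: Aint.
  - by move=> e l z z'; exact: Amesh.
  - exact: measurable_T (lT 0 in0).
  move=> a; apply/cvgr0Pnorm_le => eps eps0.
  have [K K0 close] := lf_close lf.
  (* The exceptional set has length at most [eta (1 + 2 K M)], hence mass at most
     [eps / 2] under a density bounded by [M]. *)
  pose eta := eps / 2 / (M * (1 + M * (2 * K))).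
  have eta0 : 0 < eta.
    by rewrite !divr_gt0// mulr_gt0// ltr_wpDr// mulr_ge0 ?mulr_ge0 ?(ltW M0) ?(ltW K0).
  have [e0 [H [/andP[e00 e0M] [iH HI] muH He0 cl_e]]] := close eta eta0.
  near=> e.
  have e_gt0 : 0 < e by near: e; exact: nbhs_right_gt.
  have e_lt : e < e0 by near: e; exact: nbhs_right_lt.
  have e_eps : e < eps / 2 by near: e; apply: nbhs_right_lt; rewrite divr_gt0.
  have eP : 0 < e < emax by rewrite e_gt0 (lt_trans e_lt).
  have eP' : 0 <= e < emax by rewrite (ltW e_gt0) (lt_trans e_lt).
  have clE : cl e = e by rewrite /cl eP'.
  have e_in : 0 <= e < e0 by rewrite (ltW e_gt0).
  have [_ _ supH] := cl_e e e_in.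
  have [_ m2] := mP e eP.
  pose T0 := base (X 0); pose T1 := base (X e); pose f := A e (m e).
  have -> : phi e = f by rewrite /phi clE.
  have cls x : Ihalf x -> ~ H x -> `|T1 x - T0 x| <= K * eta.
    move=> Ix nHx; rewrite -lee_fin; apply: le_trans supH.
    apply: le_trans (ereal_sup_ubound _); last by exists x.
    by rewrite lee_fin lerDl.
  have [sub1 sub2] := ray_le_close a cls.
  have mH : measurable H by exact: is_interval_measurable.
  have mray : measurable (`[a, +oo[%classic : set R) by exact: measurable_itv.
  have mr0 := measurable_preimage_Ihalf (measurable_T (lT 0 in0)) mray.
  have mr1 := measurable_preimage_Ihalf (measurable_T (lT e eP')) mray.
  have mband : measurable (`[a - K * eta, a + K * eta]%classic : set R) by exact: measurable_itv.
  have mb := measurable_preimage_Ihalf (measurable_T (lT 0 in0)) mband.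
  have mS := measurableU _ _ mH mb.
  have massS : mass f (H `|` (T0 @^-1` `[a - K * eta, a + K * eta] `&` Ihalf)) <= eps / 2.
    have fP := mA e (m e) eP'; have f0 x := A0 e (m e) x eP'.
    have fI := Aint e (m e) eP'.
    apply: (le_trans (mass_cover fP f0 fI mS mH mb (@subset_refl _ _))).
    have fM x : Ihalf x -> f x <= M by move=> Ix; exact: AM.
    have h1 := mass_le fP f0 fI mH (ltW M0) (fun x _ => fM x).
    have h2 := mass_le fP f0 fI mb (ltW M0) (fun x _ => fM x).
    have h3 : len H <= eta.
      rewrite -lee_fin lenE// (setIidl HI) muH lee_fin; exact: ltW.
    have Ke : a - K * eta <= a + K * eta.
      by have := mulr_gt0 K0 eta0; lra.
    have h4 := len_preimage_itv (lT 0 in0) C0 th1 (eT 0 in0) Ke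
      (fun y Iy => HM _ _ (uX 0 in0) 1%N y Iy).
    apply: (le_trans (lerD h1 h2)).
    have -> : eps / 2 = M * eta + M * (M * ((a + K * eta) - (a - K * eta))).
      have : eta * (M * (1 + M * (2 * K))) = eps / 2.
        by rewrite divfK// gt_eqF// mulr_gt0// ltr_wpDr// mulr_ge0 ?mulr_ge0 ?(ltW M0) ?(ltW K0).
      by move=> <-; ring.
    by apply: lerD; rewrite ler_wpM2l// ltW.
  have k1 := mass_cover (mA e (m e) eP') (fun x => A0 e (m e) x eP') (Aint e (m e) eP') mr1 mr0 mS sub1.
  have k2 := mass_cover (mA e (m e) eP') (fun x => A0 e (m e) x eP') (Aint e (m e) eP') mr0 mr1 mS sub2.
  have k3 := Ainv e (m e) _ eP' mray.
  exact: (norm_sub_transfer k3 k1 k2 massS (ltW (le_lt_trans m2 e_eps))).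
have mhI e : 0 <= e < emax -> measurable_fun Ihalf (h e).
  by move=> eP; have [_ []] := acip e eP.
have up : (e%:E + L1_dist (phi e) (h 0%R))%E @[e --> 0^'+] --> 0%E.
  rewrite -[X in _ --> X]adde0; apply: cvgeD => //.
  by apply: cvg_EFin; [exact: nearW|apply: cvg_at_right_filter; exact: cvg_id].
apply: (squeeze_cvge _ (cvg_cst 0%E) up).
apply: filterS near_cl => e eP; have /andP[e_gt0 e_lt] := eP.
have eP' : 0 <= e < emax by rewrite ltW.
rewrite L1_dist_ge0/=.
have clE : cl e = e by rewrite /cl eP'.
have [m1 _] := mP e eP.
have mphi : measurable_fun (@Ihalf R) (A e (m e)) by apply: measurable_funTS; exact: mA.
apply: (le_trans (L1_dist_triangle mphi (mhI e eP') (mhI 0 in0))).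
by rewrite /phi clE; apply: leeD.
Unshelve. all: by end_near.
Qed.
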